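(* Let $\theta$ be an inner function and let $\Phi$ be a subset of $C(\mathbb{T})$; if $\theta$ is constant, assume in addition that $\Phi$ contains the constant function $1$. Put $E=\theta H^1_\Phi:=\{\theta g:\ g\in H^1_\Phi\}$. Let $f\in H^1$ be such that the coset $f+E$ has norm $1$ in the quotient space $H^1/E$. Then the following are equivalent: (i) $f+E$ is an extreme point of $\mathrm{ball}\,(H^1/E)$; (ii) there is an outer function $F\in H^1$ such that $\mathcal{M}(f;H^1,E)=\{F\}$.
   Context: $\mathbb{T}=\{\zeta\in\mathbb{C}:|\zeta|=1\}$ with normalized Haar (arc-length) measure $m$; $L^p=L^p(\mathbb{T},m)$ with norm $\|\cdot\|_p$. For $f\in L^1$, $\widehat f(k)=\int_{\mathbb{T}}\bar\zeta^k f(\zeta)\,dm(\zeta)$, and the Hardy space is $H^p=\{f\in L^p:\widehat f(k)=0 \text{ for all } k<0\}$, with norm $\|\cdot\|_p$; $H^p$ functions are identified with their holomorphic Poisson extensions to the unit disk $\mathbb{D}$. An inner function is $\theta\in H^\infty$ with $|\theta|=1$ a.e. on $\mathbb{T}$. A function $F\in H^1$ is outer if it has no zeros in $\mathbb{D}$ and $\log|F(z)|$ is the Poisson integral of its boundary values $\log|F|$. For $\Phi\subset C(\mathbb{T})$, $H^1_\Phi:=\{g\in H^1:\int_{\mathbb{T}} g\phi\,dm=0 \text{ for all }\phi\in\Phi\}$. For a Banach space $X$ and closed subspace $Y$, $X/Y$ has norm $\|x+Y\|_{X/Y}=\inf_{y\in Y}\|x+y\|_X$; $\mathrm{ball}\,(Z)$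 is the closed unit ball of a Banach space $Z$; a point $z$ of $\mathrm{ball}\,(Z)$ is extreme if it is not of the form $\frac12(u+v)$ with distinct $u,v\in\mathrm{ball}\,(Z)$. Finally $\mathcal{M}(x;X,Y):=\{\xi\in x+Y:\ \|\xi\|_X=\|x+Y\|_{X/Y}\}$, the set of elements of minimal norm in the coset $x+Y$. *)

(* Defs.v *)
From HB Require Import structures.
From mathcomp Require Import all_boot all_algebra.
From mathcomp Require Import all_classical all_reals all_analysis.
From mathcomp Require Import complex.
Import GRing.Theory Num.Theory.
Import numFieldNormedType.Exports.

Set Implicit Arguments.
Unset Strict Implicit.
Unset Printing Implicit Defensive.

Local Open Scope classical_set_scope.
Local Open Scope ring_scope.

(* Conventions: the circle T is parametrized by t in [0,1] via zeta = e^{2 pi i t};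
   normalized Haar measure on T is then Lebesgue measure on [0,1].
   A function on T is a function R -> R[i] (only its values on [0,1] matter for
   L^p / H^p notions; continuity on T is continuity + 1-periodicity). *)

Section HardyDefs.
Variable R : realType.

Definition Iu : set R := `[0, 1]%classic.
Definition mu := (@lebesgue_measure R).

Definition aeI (P : R -> Prop) : Prop := {ae mu, forall t, Iu t -> P t}.

Definition cabs (z : R[i]) : R := Normc.normc z.

Definition cint (f : R -> R[i]) : R[i] :=
  Complex (\int[mu]_(t in Iu) complex.Re (f t)) (\int[mu]_(t in Iu) complex.Im (f t)).

Definition L1norm (f : R -> R[i]) : R := \int[mu]_(t in Iu) cabs (f t).

Definition isL1 (f : R -> R[i]) : Prop :=
  [/\ measurable_fun Iu (fun t => complex.Re (f t)),
      measurable_fun Iu (fun t => complex.Im (f t)) &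
      (\int[mu]_(t in Iu) (cabs (f t))%:E < +oo)%E].

Definition isLinf (f : R -> R[i]) : Prop :=
  [/\ measurable_fun Iu (fun t => complex.Re (f t)),
      measurable_fun Iu (fun t => complex.Im (f t)) &
      exists M : R, aeI (fun t => cabs (f t) <= M)].

Definition expi (x : R) : R[i] := Complex (cos x) (sin x).

Definition fhat (f : R -> R[i]) (k : int) : R[i] :=
  cint (fun t => expi (- (2 * pi * k%:~R * t)) * f t).

Definition isH1 (f : R -> R[i]) : Prop :=
  isL1 f /\ forall k : int, (k < 0)%R -> fhat f k = 0.

Definition isHinf (f : R -> R[i]) : Prop :=
  isLinf f /\ forall k : int, (k < 0)%R -> fhat f k = 0.

Definition inner (th : R -> R[i]) : Prop :=
  isHinf th /\ aeI (fun t => cabs (th t) = 1).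

Definition is_const (th : R -> R[i]) : Prop :=
  exists c : R[i], aeI (fun t => th t = c).

Definition isCT (phi : R -> R[i]) : Prop :=
  [/\ continuous (fun t : R => complex.Re (phi t)),
      continuous (fun t : R => complex.Im (phi t)) &
      forall t, phi (t + 1) = phi t].

Definition H1Phi (Phi : set (R -> R[i])) (g : R -> R[i]) : Prop :=
  isH1 g /\ forall phi, Phi phi -> cint (fun t => g t * phi t) = 0.

Definition inE (th : R -> R[i]) (Phi : set (R -> R[i])) (h : R -> R[i]) : Prop :=
  exists g, H1Phi Phi g /\ aeI (fun t => h t = th t * g t).

Definition qnorm (th : R -> R[i]) (Phi : set (R -> R[i])) (f : R -> R[i]) : R :=
  inf [set L1norm (fun t => f t + th t * g t) | g in H1Phi Phi].

(* f + E is an extreme point of ball(H^1/E): cosets u = g+E, v = h+E in the ball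
   with f + E = (u+v)/2 must coincide *)
Definition extremeQ (th : R -> R[i]) (Phi : set (R -> R[i])) (f : R -> R[i]) : Prop :=
  qnorm th Phi f <= 1 /\
  forall g h : R -> R[i], isH1 g -> isH1 h ->
    qnorm th Phi g <= 1 -> qnorm th Phi h <= 1 ->
    inE th Phi (fun t => f t - (g t + h t) / 2) ->
    inE th Phi (fun t => g t - h t).

Definition Mset (th : R -> R[i]) (Phi : set (R -> R[i])) (f xi : R -> R[i]) : Prop :=
  [/\ isH1 xi, inE th Phi (fun t => xi t - f t) & L1norm xi = qnorm th Phi f].

Definition poisson (z : R[i]) (t : R) : R :=
  (1 - cabs z ^+ 2) / (cabs (expi (2 * pi * t) - z) ^+ 2).

Definition Pext (f : R -> R[i]) (z : R[i]) : R[i] :=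
  cint (fun t => (poisson z t)%:C%C * f t).

Definition outer (F : R -> R[i]) : Prop :=
  [/\ isH1 F,
      forall z, cabs z < 1 -> Pext F z != 0,
      aeI (fun t => F t != 0),
      mu.-integrable Iu (EFin \o (fun t => ln (cabs (F t)))) &
      forall z, cabs z < 1 ->
        ln (cabs (Pext F z)) = \int[mu]_(t in Iu) (poisson z t * ln (cabs (F t)))].

End HardyDefs.

(* Main.v *)
(* The quotient norm is attained in every coset: factor H^1 functions as products
   of two H^2 functions and pass to ultrafilter limits of Fourier coefficients.  If
   two elements of the unit ball average to a function F of norm 1, they are
   F (1 + k) and F (1 - k) with k real and |k| <= 1.  So everything rests on the
   real bounded k for which F k is in H^1.

   F is outer iff all such k are constant.  Minimizing \int |F| |p|^2 over
   polynomials p with p(0) = 1 yields p_n with F p_n^2 -> U in L^1, |U| constant,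
   and both F U and F U^* in H^1; F is outer exactly when U is constant, which is
   read off from Jensen's inequality.  This gives (ii) => (i) at once.

   For (i) => (ii), let F (1 + h) and F (1 - h) be minimizers, and let w be a
   nonconstant inner function dividing E (w = theta, or w = z if theta is
   constant).  Extremality applied to h Re(l w^n), for suitable constants l,
   shows by induction that every w^n divides F h, so F h = 0 and the minimizer is
   unique; extremality once more shows that it is outer. *)

Require Import Defs.
From HB Require Import structures.
From mathcomp Require Import all_boot all_order all_algebra.
From mathcomp Require Import all_classical all_reals all_analysis.
From mathcomp Require Import measurable_realfun complex ring lra.
Import Order.TTheory GRing.Theory Num.Theory.
Import numFieldNormedType.Exports.
Local Open Scope classical_set_scope.
Local Open Scope ring_scope.
Set Implicit Arguments.
Unset Strict Implicit.
Unset Printing Implicit Defensive.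
Arguments cabs : simpl never.
Arguments cint : simpl never.
Arguments fhat : simpl never.
Arguments L1norm : simpl never.

(** * Real integrals over the unit interval *)

Section RealIntegral.
Variable R : realType.
Local Notation Iu := (@Iu R).
Implicit Types (f g : R -> R) (P Q : R -> Prop).

(** Everything is read off from Fourier coefficients, so products and weak limits in H^1 need finite
    convolution formulas for coefficients. Szegő's problem supplies F = a b / A with |a|^2 = |b|^2 =
    A |F|: Cauchy-Schwarz is then an equality, so norms survive weak limits, and the same identity
    halves exponents, which is the source of Jensen's inequality. Continuity of the members of Φ is
    what lets the conditions on g survive a limit in which only Fourier coefficients converge: they
    are uniform limits of trigonometric polynomials. For uniqueness, the obstacle is that h F
    already lies in E, so extremality applied to h itself says nothing new. The factor Re (l w^n) is
    a real modulation that stays analytic on h F, because conj(w^n) cancels the factor w^n that has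
    already been extracted from h F. *)

Definition leb : {measure set (measurableTypeR R) -> \bar R} :=
  @lebesgue_measure R.
Definition mI f : Prop := measurable_fun Iu f.
Definition intg f : Prop := leb.-integrable Iu (EFin \o f).
Definition RI f : R := \int[leb]_(t in Iu) f t.

Lemma measurable_Iu : @measurable _ (measurableTypeR R) Iu.
Proof. exact: measurable_itv. Qed.

Lemma lebesgue_Iu : leb Iu = 1%E.
Proof.
have -> : leb Iu = @lebesgue_measure R `[0, 1]%classic by [].
by rewrite lebesgue_measure_itv /= lte_fin ltr01 oppr0 adde0.
Qed.

Lemma aeIE P : aeI P = {ae leb, forall t, Iu t -> P t}.
Proof. by []. Qed.

Let filter_ae : Filter (nbhs (almost_everywhere leb)).
Proof. exact: (ae_filter_ringOfSetsType leb). Qed.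
#[local] Existing Instance filter_ae.

Lemma aeI_all P : (forall t, Iu t -> P t) -> aeI P.
Proof. by rewrite aeIE => h; apply: aeW => t; exact: h. Qed.

Lemma aeIS P Q : aeI P -> (forall t, Iu t -> P t -> Q t) -> aeI Q.
Proof. by rewrite !aeIE => hP h; apply: filterS hP => t hp It; exact: h (hp It). Qed.

Lemma aeIS2 P1 P2 Q : aeI P1 -> aeI P2 ->
  (forall t, Iu t -> P1 t -> P2 t -> Q t) -> aeI Q.
Proof.
by rewrite !aeIE => h1 h2 h; apply: filterS2 h1 h2 => t p1 p2 It; exact: h (p1 It) (p2 It).
Qed.

Lemma aeIS3 P1 P2 P3 Q : aeI P1 -> aeI P2 -> aeI P3 ->
  (forall t, Iu t -> P1 t -> P2 t -> P3 t -> Q t) -> aeI Q.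
Proof.
rewrite !aeIE => h1 h2 h3 h; apply: filterS3 h1 h2 h3 => t p1 p2 p3 It.
exact: h (p1 It) (p2 It) (p3 It).
Qed.

Lemma aeI_exists P : aeI P -> exists2 t, Iu t & P t.
Proof.
move=> h; apply: contrapT => hn.
have hF : @aeI R (fun=> False).
  by apply: aeIS h _ => t It Pt; apply: hn; exists t.
case: hF => N [mN N0 sub].
have : leb Iu = 0%E.
  apply: (subset_measure0 measurable_Iu mN _ N0) => t It; apply: sub => /=.
  by move/(_ It).
by rewrite lebesgue_Iu => /eqP; rewrite onee_eq0.
Qed.

Lemma intg_mI f : intg f -> mI f.
Proof. by move=> /measurable_int /measurable_EFinP. Qed.

Lemma mI_cst c : mI (fun=> c).
Proof. exact: measurable_cst. Qed.

Lemma mI_D f g : mI f -> mI g -> mI (fun t => f t + g t).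
Proof. exact: measurable_funD. Qed.

Lemma mI_M f g : mI f -> mI g -> mI (fun t => f t * g t).
Proof. exact: measurable_funM. Qed.

Lemma mI_N f : mI f -> mI (fun t => - f t).
Proof. exact: measurable_funN. Qed.

Lemma mI_B f g : mI f -> mI g -> mI (fun t => f t - g t).
Proof. exact: measurable_funB. Qed.

Lemma mI_X f n : mI f -> mI (fun t => f t ^+ n).
Proof. exact: measurable_funX. Qed.

Lemma mI_comp (h : R -> R) f :
  measurable_fun setT h -> mI f -> mI (fun t => h (f t)).
Proof. by move=> mh mf; exact: (measurableT_comp mh mf). Qed.

Lemma mI_ln f : mI f -> mI (fun t => ln (f t)).
Proof. by apply: mI_comp; exact: measurable_ln. Qed.

Lemma mI_norm f : mI f -> mI (fun t => `|f t|).
Proof. by apply: mI_comp; exact: normr_measurable. Qed.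

Lemma mI_powR f p : mI f -> mI (fun t => f t `^ p).
Proof. by apply: (@mI_comp (fun x => x `^ p)); exact: measurable_powR. Qed.

Lemma mI_eq f g : (forall t, Iu t -> f t = g t) -> mI f -> mI g.
Proof.
by move=> fg; apply: eq_measurable_fun => t; rewrite inE; exact: fg.
Qed.

Lemma mI_sqrt f : (forall t, 0 <= f t) -> mI f -> mI (fun t => Num.sqrt (f t)).
Proof.
move=> f0 mf; apply: (mI_eq _ (mI_powR 2^-1 mf)) => t _.
by rewrite powR12_sqrt.
Qed.

Lemma mI_inv f : (forall t, 0 <= f t) -> mI f -> mI (fun t => (f t)^-1).
Proof.
move=> f0 mf; apply: (mI_eq _ (mI_powR (-1) mf)) => t _.
by rewrite powR_inv1.
Qed.

Lemma mI_continuous f : continuous f -> mI f.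
Proof.
move=> cf; apply: measurable_funS (continuous_measurable_fun cf) => //.
Qed.

Lemma intg_le_ae f g : mI f -> intg g -> aeI (fun t => `|f t| <= g t) -> intg f.
Proof.
move=> mf ig fg; apply/integrableP; split; first exact/measurable_EFinP.
have /integrableP[mg goo] := ig; apply: le_lt_trans goo.
apply: ae_ge0_le_integral => //.
- exact: measurable_Iu.
- by apply: measurableT_comp => //; exact/measurable_EFinP.
- by apply: measurableT_comp => //.
- move: fg; rewrite aeIE; apply: filterS => t h It /=; rewrite lee_fin.
  exact: le_trans (h It) (ler_norm _).
Qed.

Lemma intg_le f g :
  mI f -> intg g -> (forall t, Iu t -> `|f t| <= g t) -> intg f.
Proof. by move=> mf ig h; apply: intg_le_ae mf ig _; exact: aeI_all. Qed.

Lemma intg_cst c : intg (fun=> c).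
Proof.
apply/integrableP; split; first exact/measurable_EFinP/measurable_cst.
under eq_integral do rewrite /=.
rewrite integral_cst; last exact: measurable_Iu.
by rewrite lebesgue_Iu mule1 ltry.
Qed.

Lemma intgD f g : intg f -> intg g -> intg (fun t => f t + g t).
Proof. by move=> hf hg; exact: (integrableD measurable_Iu hf hg). Qed.

Lemma intgZ c f : intg f -> intg (fun t => c * f t).
Proof. by move=> hf; exact: (integrableZl measurable_Iu c hf). Qed.

Lemma intgN f : intg f -> intg (fun t => - f t).
Proof.
by move=> hf; have := intgZ (-1) hf; under eq_fun do rewrite mulN1r.
Qed.

Lemma intgB f g : intg f -> intg g -> intg (fun t => f t - g t).
Proof. by move=> hf hg; exact: intgD hf (intgN hg). Qed.

Lemma intg_norm f : intg f -> intg (fun t => `|f t|).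
Proof. by move=> hf; exact: integrable_norm hf. Qed.

Lemma RID f g : intg f -> intg g -> RI (fun t => f t + g t) = RI f + RI g.
Proof. by move=> hf hg; exact: (RintegralD measurable_Iu hf hg). Qed.

Lemma RIB f g : intg f -> intg g -> RI (fun t => f t - g t) = RI f - RI g.
Proof. by move=> hf hg; exact: (RintegralB measurable_Iu hf hg). Qed.

Lemma RIZ c f : intg f -> RI (fun t => c * f t) = c * RI f.
Proof. by move=> hf; exact: (RintegralZl c measurable_Iu hf). Qed.

Lemma RIN f : intg f -> RI (fun t => - f t) = - RI f.
Proof.
by move=> hf; rewrite -mulN1r -RIZ//; under [in RHS]eq_fun do rewrite mulN1r.
Qed.

Lemma RI_eq f g : (forall t, Iu t -> f t = g t) -> RI f = RI g.
Proof. by move=> h; apply: eq_Rintegral => t; rewrite inE; exact: h. Qed.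

Lemma RI_cst c : RI (fun=> c) = c.
Proof.
rewrite /RI (Rintegral_cst _ measurable_Iu).
by rewrite lebesgue_Iu /= mulr1.
Qed.

Lemma RI_ge0 f : (forall t, Iu t -> 0 <= f t) -> 0 <= RI f.
Proof. by move=> f0; apply: Rintegral_ge0 => t; exact: f0. Qed.

Lemma RI_ae f g : mI f -> mI g -> aeI (fun t => f t = g t) -> RI f = RI g.
Proof.
move=> mf mg fg; congr fine; apply: ae_eq_integral.
- exact: measurable_Iu.
- exact/measurable_EFinP.
- exact/measurable_EFinP.
- by move: fg; rewrite aeIE; apply: filterS => t h It /=; rewrite h.
Qed.

Lemma RI_le_ae f g : intg f -> intg g -> aeI (fun t => f t <= g t) ->
  RI f <= RI g.
Proof.
move=> hf hg fg.
(* [g] is replaced by [max f g], which agrees with it almost everywhere and dominates [f]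
   everywhere, so that the pointwise comparison applies. *)
have mm : mI (fun t => Num.max (f t) (g t)).
  by apply: measurable_maxr; exact: intg_mI.
have im : intg (fun t => Num.max (f t) (g t)).
  apply: (intg_le mm (intgD (intg_norm hf) (intg_norm hg))) => t _.
  by rewrite maxEle; case: ifP => _; rewrite ?lerDr ?lerDl.
rewrite (_ : RI g = RI (fun t => Num.max (f t) (g t))).
  apply: (le_Rintegral measurable_Iu hf im) => t _.
  by rewrite le_max lexx.
apply: RI_ae => //; first exact: intg_mI.
by apply: aeIS fg _ => t _ h; rewrite (max_idPr h).
Qed.

Lemma RI_le f g : intg f -> intg g -> (forall t, Iu t -> f t <= g t) ->
  RI f <= RI g.
Proof. by move=> hf hg h; apply: RI_le_ae hf hg _; exact: aeI_all. Qed.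

Lemma EFin_RI f : intg f -> (RI f)%:E = (\int[leb]_(t in Iu) (f t)%:E)%E.
Proof.
by move=> hf; rewrite fineK//; exact: (integrable_fin_num measurable_Iu hf).
Qed.

Lemma RI_eq0 f : intg f -> (forall t, Iu t -> 0 <= f t) -> RI f = 0 ->
  aeI (fun t => f t = 0).
Proof.
move=> hf f0 h.
have : (\int[leb]_(t in Iu) `|(f t)%:E| = 0)%E.
  under eq_integral => t; first by rewrite inE => It; rewrite gee0_abs ?lee_fin ?f0//; over.
  by rewrite -EFin_RI// h.
have mf : measurable_fun Iu (fun t => (f t)%:E).
  by apply/measurable_EFinP; exact: intg_mI.
move/(ae_eq_integral_abs leb measurable_Iu mf).
by rewrite aeIE; apply: filterS => t ht It; have [] := ht It.
Qed.

Lemma RI_fatou (f_ : nat -> R -> R) f B :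
  (forall n, intg (f_ n)) -> (forall n t, Iu t -> 0 <= f_ n t) -> mI f ->
  aeI (fun t => f_ n t @[n --> \oo] --> f t) ->
  (forall n, RI (f_ n) <= B) -> intg f /\ RI f <= B.
Proof.
move=> if_ f0 mf fcv fB.
have mf_ n : measurable_fun Iu (EFin \o f_ n).
  by apply/measurable_EFinP; exact: intg_mI.
have f0' n t : Iu t -> (0 <= (EFin \o f_ n) t)%E by move=> It; rewrite lee_fin f0.
have fat := fatou leb measurable_Iu mf_ f0'.
have le1 : (\int[leb]_(t in Iu) `|(f t)%:E| <= B%:E)%E.
  have -> : (\int[leb]_(t in Iu) `|(f t)%:E| =
     \int[leb]_(t in Iu) limn_einf (fun n => (EFin \o f_ n) t))%E.
    apply: ae_eq_integral.
    - exact: measurable_Iu.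
    - by apply: measurableT_comp => //; exact/measurable_EFinP.
    - rewrite (_ : (fun t => _) = (fun t => - limn_esup (fun n => - (EFin \o f_ n) t))%E).
        apply: measurableT_comp => //.
        apply: measurable_fun_limn_esup => n.
        exact: (measurableT_comp (@oppe_measurable R setT) (mf_ n)).
      apply/funext => t; rewrite -limn_einfN /comp.
      by congr limn_einf; apply/funext => n /=; rewrite opprK.
    - move: fcv; rewrite aeIE; apply: filterS => t h It.
      have hc : (fun n => (EFin \o f_ n) t) @ \oo --> (f t)%:E.
        by apply: cvg_EFin; [exact: nearW | exact: h].
      have ft0 : 0 <= f t.
        apply: (cvgr_to_ge (h It)).
        by apply: nearW => n; exact: f0.
      by rewrite (cvg_limn_einf_sup hc).1 gee0_abs ?lee_fin.
  apply: le_trans fat _; rewrite limn_einf_lim; apply: lime_le.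
    exact: is_cvg_einfs.
  apply: nearW => n; apply: (@le_trans _ _ (RI (f_ n))%:E); last by rewrite lee_fin.
  by rewrite EFin_RI//; apply: ereal_inf_lbound; exists n => /=.
have iff : intg f.
  apply/integrableP; split; first exact/measurable_EFinP.
  by apply: le_lt_trans le1 _; rewrite ltry.
split => //; apply: (@le_trans _ _ (RI (fun t => `|f t|))).
  by apply: RI_le (intg_norm iff) _ => // t _; exact: ler_norm.
by rewrite -lee_fin EFin_RI//; exact: intg_norm.
Qed.

End RealIntegral.

(** * Complex-valued integrals *)

Section ComplexNumbers.
Variable R : realType.
Local Notation C := R[i].
Implicit Types (z w : C) (x y : R).

Lemma cabs_ge0 z : 0 <= cabs z.
Proof. by case: z => a b; rewrite /cabs /= sqrtr_ge0. Qed.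

Lemma cabs_sqr z : cabs z ^+ 2 = complex.Re z ^+ 2 + complex.Im z ^+ 2.
Proof. by case: z => a b; rewrite /cabs /= sqr_sqrtr// addr_ge0 ?sqr_ge0. Qed.

Lemma cabsM z w : cabs (z * w) = cabs z * cabs w.
Proof. exact: Normc.normcM. Qed.

Lemma cabsD z w : cabs (z + w) <= cabs z + cabs w.
Proof. exact: (le_normcD z w). Qed.

Lemma cabsN z : cabs (- z) = cabs z.
Proof. exact: (normcN z). Qed.

Lemma cabs_distC z w : cabs (z - w) = cabs (w - z).
Proof. by rewrite -cabsN opprB. Qed.

Lemma cabs0 : cabs (0 : C) = 0.
Proof. exact: Normc.normc0. Qed.

Lemma cabs1 : cabs (1 : C) = 1.
Proof. exact: Normc.normc1. Qed.

Lemma cabs_eq0 z : (cabs z == 0) = (z == 0).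
Proof.
by apply/eqP/eqP => [/(@Normc.eq0_normc R)//|->]; exact: cabs0.
Qed.

Lemma cabs_gt0 z : (0 < cabs z) = (z != 0).
Proof. by rewrite lt_def cabs_ge0 andbT cabs_eq0. Qed.

Lemma cabsV z : cabs z^-1 = (cabs z)^-1.
Proof. exact: Normc.normcV. Qed.

Lemma cabsX z n : cabs (z ^+ n) = cabs z ^+ n.
Proof.
by elim: n => [|n IH]; rewrite ?expr0 ?cabs1// !exprS cabsM IH.
Qed.

Lemma cabs_real x : cabs x%:C%C = `|x|.
Proof. by rewrite /cabs /= expr0n addr0 sqrtr_sqr. Qed.

Lemma cabs_conj z : cabs z^*%C = cabs z.
Proof. by case: z => a b; rewrite /cabs /= sqrrN. Qed.

Lemma normRe_le z : `|complex.Re z| <= cabs z.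
Proof.
by case: z => a b; rewrite /cabs /= -sqrtr_sqr ler_wsqrtr// lerDl sqr_ge0.
Qed.

Lemma normIm_le z : `|complex.Im z| <= cabs z.
Proof.
by case: z => a b; rewrite /cabs /= -sqrtr_sqr ler_wsqrtr// lerDr sqr_ge0.
Qed.

Lemma Re_le_cabs z : complex.Re z <= cabs z.
Proof. exact: le_trans (ler_norm _) (normRe_le z). Qed.

Lemma cabs_le_ReIm z : cabs z <= `|complex.Re z| + `|complex.Im z|.
Proof.
case: z => a b; rewrite /cabs /= -[leRHS]ger0_norm ?addr_ge0// -sqrtr_sqr.
rewrite ler_wsqrtr// sqrrD !real_normK ?num_real// lerD2r lerDl.
by rewrite mulrn_wge0// mulr_ge0.
Qed.

Lemma mulcC z : z * z^*%C = (cabs z ^+ 2)%:C%C.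
Proof.
rewrite cabs_sqr; case: z => a b /=; apply/eqP; rewrite eq_complex /=.
by apply/andP; split; apply/eqP; ring.
Qed.

Lemma ReM z w :
  complex.Re (z * w) = complex.Re z * complex.Re w - complex.Im z * complex.Im w.
Proof. by case: z => a b; case: w. Qed.

Lemma ImM z w :
  complex.Im (z * w) = complex.Re z * complex.Im w + complex.Im z * complex.Re w.
Proof. by case: z => a b; case: w. Qed.

Lemma ReD z w : complex.Re (z + w) = complex.Re z + complex.Re w.
Proof. by case: z => a b; case: w. Qed.

Lemma ImD z w : complex.Im (z + w) = complex.Im z + complex.Im w.
Proof. by case: z => a b; case: w. Qed.

Lemma ReN z : complex.Re (- z) = - complex.Re z.
Proof. by case: z. Qed.

Lemma ImN z : complex.Im (- z) = - complex.Im z.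
Proof. by case: z. Qed.

Lemma ReJ z : complex.Re z^*%C = complex.Re z.
Proof. by case: z. Qed.

Lemma ImJ z : complex.Im z^*%C = - complex.Im z.
Proof. by case: z. Qed.

Lemma complex_ext z w :
  complex.Re z = complex.Re w -> complex.Im z = complex.Im w -> z = w.
Proof. by case: z => a b; case: w => c d /= -> ->. Qed.

Lemma conjM z w : (z * w)^*%C = z^*%C * w^*%C.
Proof. exact: rmorphM. Qed.

Lemma conjN z : (- z)^*%C = - z^*%C.
Proof. exact: rmorphN. Qed.

Lemma conjB z w : (z - w)^*%C = z^*%C - w^*%C.
Proof. exact: rmorphB. Qed.

Lemma conj_sum (J : Type) (r : seq J) (F : J -> C) :
  (\sum_(j <- r) F j)^*%C = \sum_(j <- r) (F j)^*%C.
Proof. exact: rmorph_sum. Qed.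

Lemma cabs_expi x : cabs (expi x) = 1.
Proof. by rewrite /cabs /expi /= cos2Dsin2 sqrtr1. Qed.

Lemma expi0 : expi (0 : R) = 1.
Proof. by rewrite /expi cos0 sin0. Qed.

Lemma expiD x y : expi (x + y) = expi x * expi y.
Proof.
apply: complex_ext; rewrite ?ReM ?ImM /= ?cosD ?sinD //.
by rewrite addrC.
Qed.

Lemma expiN x : expi (- x) = (expi x)^*%C.
Proof. by rewrite /expi cosN sinN. Qed.

End ComplexNumbers.

Section ComplexIntegral.
Variable R : realType.
Local Notation C := R[i].
Local Notation Iu := (@Iu R).
Implicit Types (f g : R -> C) (c : C).

Definition cmeas f : Prop :=
  mI (fun t => complex.Re (f t)) /\ mI (fun t => complex.Im (f t)).

Lemma cmeas_cst c : cmeas (fun=> c).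
Proof. by split; exact: mI_cst. Qed.

Lemma cmeasD f g : cmeas f -> cmeas g -> cmeas (fun t => f t + g t).
Proof.
move=> [f1 f2] [g1 g2]; split.
  by under eq_fun do rewrite ReD; exact: mI_D.
by under eq_fun do rewrite ImD; exact: mI_D.
Qed.

Lemma cmeasN f : cmeas f -> cmeas (fun t => - f t).
Proof.
move=> [f1 f2]; split.
  by under eq_fun do rewrite ReN; exact: mI_N.
by under eq_fun do rewrite ImN; exact: mI_N.
Qed.

Lemma cmeasB f g : cmeas f -> cmeas g -> cmeas (fun t => f t - g t).
Proof. by move=> mf mg; exact: cmeasD mf (cmeasN mg). Qed.

Lemma cmeasM f g : cmeas f -> cmeas g -> cmeas (fun t => f t * g t).
Proof.
move=> [f1 f2] [g1 g2]; split.
  by under eq_fun do rewrite ReM; apply: mI_B; exact: mI_M.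
by under eq_fun do rewrite ImM; apply: mI_D; exact: mI_M.
Qed.

Lemma cmeasJ f : cmeas f -> cmeas (fun t => (f t)^*%C).
Proof.
move=> [f1 f2]; split.
  by under eq_fun do rewrite ReJ.
by under eq_fun do rewrite ImJ; exact: mI_N.
Qed.

Lemma cmeas_real (h : R -> R) : mI h -> cmeas (fun t => (h t)%:C%C).
Proof. by move=> mh; split => //=; exact: mI_cst. Qed.

Lemma mI_cabs f : cmeas f -> mI (fun t => cabs (f t)).
Proof.
move=> [f1 f2].
rewrite (_ : (fun t => cabs (f t)) =
  fun t => Num.sqrt (complex.Re (f t) ^+ 2 + complex.Im (f t) ^+ 2)).
  apply: mI_sqrt => [t|]; first by rewrite addr_ge0 ?sqr_ge0.
  by apply: mI_D; exact: mI_X.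
by apply/funext => t; rewrite -cabs_sqr sqrtr_sqr ger0_norm ?cabs_ge0.
Qed.

Lemma cmeasV f : cmeas f -> cmeas (fun t => (f t)^-1).
Proof.
move=> mf.
rewrite (_ : (fun t => (f t)^-1) =
  fun t => (f t)^*%C * ((cabs (f t) ^+ 2)^-1)%:C%C).
  apply: cmeasM; first exact: cmeasJ.
  apply: cmeas_real; apply: mI_inv => [t|]; first exact: sqr_ge0.
  by apply: mI_X; exact: mI_cabs.
apply/funext => t; have [->|f0] := eqVneq (f t) 0.
  by rewrite invr0 cabs0 conjc0 mul0r.
apply: (mulfI f0); rewrite divff// mulrA mulcC -rmorphM divff//.
by rewrite sqrf_eq0 cabs_eq0.
Qed.

Lemma cmeasX f n : cmeas f -> cmeas (fun t => f t ^+ n).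
Proof.
move=> mf; elim: n => [|n IH]; first exact: cmeas_cst.
by under eq_fun do rewrite exprS; exact: cmeasM.
Qed.

Lemma isL1P f : isL1 f <-> cmeas f /\ intg (fun t => cabs (f t)).
Proof.
split=> [[m1 m2 foo]|[[m1 m2] /integrableP[mf foo]]].
  have mf : cmeas f by [].
  split => //; apply/integrableP; split.
    by apply/measurable_EFinP; exact: mI_cabs.
  move: foo; apply: le_lt_trans; apply: ge0_le_integral => //.
  - exact: measurable_Iu.
  - apply: measurableT_comp => //.
    by apply/measurable_EFinP; exact: mI_cabs.
  - by apply/measurable_EFinP; exact: mI_cabs.
  - by move=> t _ /=; rewrite ger0_norm// cabs_ge0.
split => //; move: foo; apply: le_lt_trans; apply: ge0_le_integral => //.
- exact: measurable_Iu.
- by move=> t _; rewrite lee_fin cabs_ge0.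
- apply: measurableT_comp => //.
- by move=> t _ /=; rewrite ger0_norm// cabs_ge0.
Qed.

Lemma L1_cmeas f : isL1 f -> cmeas f.
Proof. by move/isL1P => []. Qed.

Lemma L1_intg f : isL1 f -> intg (fun t => cabs (f t)).
Proof. by move/isL1P => []. Qed.

Lemma L1_le_ae f (h : R -> R) : cmeas f -> intg h ->
  aeI (fun t => cabs (f t) <= h t) -> isL1 f.
Proof.
move=> mf ih H; apply/isL1P; split => //.
apply: (intg_le_ae (mI_cabs mf) ih); apply: aeIS H _ => t _.
by rewrite ger0_norm ?cabs_ge0.
Qed.

Lemma L1_le f (h : R -> R) : cmeas f -> intg h ->
  (forall t, Iu t -> cabs (f t) <= h t) -> isL1 f.
Proof. by move=> mf ih H; apply: L1_le_ae mf ih _; exact: aeI_all. Qed.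

Lemma L1_bound f M : cmeas f -> aeI (fun t => cabs (f t) <= M) -> isL1 f.
Proof. by move=> mf; exact: L1_le_ae mf (intg_cst M). Qed.

Lemma L1_ae f g : isL1 f -> cmeas g -> aeI (fun t => g t = f t) -> isL1 g.
Proof.
move=> Lf mg h; apply: L1_le_ae mg (L1_intg Lf) _.
by apply: aeIS h _ => t _ ->.
Qed.

Lemma L1_cst c : isL1 (fun=> c).
Proof. by apply: (@L1_bound _ (cabs c)) (cmeas_cst c) _; exact: aeI_all. Qed.

Lemma L1D f g : isL1 f -> isL1 g -> isL1 (fun t => f t + g t).
Proof.
move=> Lf Lg; apply: L1_le (intgD (L1_intg Lf) (L1_intg Lg)) _.
  by apply: cmeasD; exact: L1_cmeas.
by move=> t _; exact: cabsD.
Qed.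

Lemma L1N f : isL1 f -> isL1 (fun t => - f t).
Proof.
move=> Lf; apply: L1_le (L1_intg Lf) _; first exact/cmeasN/L1_cmeas.
by move=> t _; rewrite cabsN.
Qed.

Lemma L1B f g : isL1 f -> isL1 g -> isL1 (fun t => f t - g t).
Proof. by move=> Lf Lg; exact: L1D Lf (L1N Lg). Qed.

Lemma L1J f : isL1 f -> isL1 (fun t => (f t)^*%C).
Proof.
move=> Lf; apply: L1_le (L1_intg Lf) _; first exact/cmeasJ/L1_cmeas.
by move=> t _; rewrite cabs_conj.
Qed.

Lemma L1M_bound_ae f g M : isL1 f -> cmeas g ->
  aeI (fun t => cabs (g t) <= M) -> isL1 (fun t => g t * f t).
Proof.
move=> Lf mg gM; apply: L1_le_ae (intgZ M (L1_intg Lf)) _.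
  exact: cmeasM mg (L1_cmeas Lf).
by apply: aeIS gM _ => t _ h; rewrite cabsM ler_wpM2r ?cabs_ge0.
Qed.

Lemma L1M_bound f g M : isL1 f -> cmeas g ->
  (forall t, Iu t -> cabs (g t) <= M) -> isL1 (fun t => g t * f t).
Proof. by move=> Lf mg h; apply: L1M_bound_ae Lf mg (aeI_all h). Qed.

Lemma L1Z c f : isL1 f -> isL1 (fun t => c * f t).
Proof.
by move=> Lf; apply: (L1M_bound Lf (cmeas_cst c)) => t _; exact: lexx.
Qed.

Lemma L1_intgRe f : isL1 f -> intg (fun t => complex.Re (f t)).
Proof.
move=> Lf; apply: intg_le (L1_intg Lf) _; first by have [] := L1_cmeas Lf.
by move=> t _; exact: normRe_le.
Qed.

Lemma L1_intgIm f : isL1 f -> intg (fun t => complex.Im (f t)).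
Proof.
move=> Lf; apply: intg_le (L1_intg Lf) _; first by have [] := L1_cmeas Lf.
by move=> t _; exact: normIm_le.
Qed.

Lemma cintE f :
  cint f = Complex (RI (fun t => complex.Re (f t))) (RI (fun t => complex.Im (f t))).
Proof. by []. Qed.

Lemma L1normE f : L1norm f = RI (fun t => cabs (f t)).
Proof. by []. Qed.

Lemma cint_eq f g : (forall t, Iu t -> f t = g t) -> cint f = cint g.
Proof.
by move=> h; rewrite !cintE; congr Complex; apply: RI_eq => t It; rewrite h.
Qed.

Lemma cint_ae f g : cmeas f -> cmeas g -> aeI (fun t => f t = g t) ->
  cint f = cint g.
Proof.
move=> [f1 f2] [g1 g2] h; rewrite !cintE.
by congr Complex; apply: RI_ae => //; apply: aeIS h _ => t _ ->.
Qed.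

Lemma cintD f g : isL1 f -> isL1 g -> cint (fun t => f t + g t) = cint f + cint g.
Proof.
move=> Lf Lg; rewrite !cintE; apply: complex_ext; rewrite ?ReD ?ImD /=.
  by rewrite -RID; [|exact: L1_intgRe..]; apply: RI_eq => t _; rewrite ReD.
by rewrite -RID; [|exact: L1_intgIm..]; apply: RI_eq => t _; rewrite ImD.
Qed.

Lemma cintZ c f : isL1 f -> cint (fun t => c * f t) = c * cint f.
Proof.
move=> Lf; have iR := L1_intgRe Lf; have iI := L1_intgIm Lf.
rewrite !cintE; apply: complex_ext; rewrite ?ReM ?ImM /=.
  rewrite -!RIZ// -RIB; [|exact: intgZ..].
  by apply: RI_eq => t _; rewrite ReM.
rewrite -!RIZ// -RID; [|exact: intgZ..].
by apply: RI_eq => t _; rewrite ImM.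
Qed.

Lemma cintN f : isL1 f -> cint (fun t => - f t) = - cint f.
Proof.
by move=> Lf; rewrite -mulN1r -cintZ//; apply: cint_eq => t _; rewrite mulN1r.
Qed.

Lemma cintB f g : isL1 f -> isL1 g -> cint (fun t => f t - g t) = cint f - cint g.
Proof. by move=> Lf Lg; rewrite -cintN// -cintD//; exact: L1N. Qed.

Lemma cintJ f : isL1 f -> cint (fun t => (f t)^*%C) = (cint f)^*%C.
Proof.
move=> Lf; rewrite !cintE; apply: complex_ext; rewrite ?ReJ ?ImJ /=.
  by apply: RI_eq => t _; rewrite ReJ.
by rewrite -RIN; [apply: RI_eq => t _; rewrite ImJ|exact: L1_intgIm].
Qed.

Lemma cint_real (h : R -> R) : cint (fun t => (h t)%:C%C) = (RI h)%:C%C.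
Proof. by rewrite cintE; apply: complex_ext => //=; rewrite RI_cst. Qed.

Lemma cint_cst c : cint (fun=> c) = c.
Proof. by rewrite cintE; apply: complex_ext => /=; rewrite RI_cst. Qed.

Lemma L1_sum (J : Type) (r : seq J) (F : J -> R -> C) :
  (forall j, isL1 (F j)) -> isL1 (fun t => \sum_(j <- r) F j t).
Proof.
move=> LF; elim: r => [|j r IH].
  by under eq_fun do rewrite big_nil; exact: L1_cst.
by under eq_fun do rewrite big_cons; exact: L1D.
Qed.

Lemma cint_sum (J : Type) (r : seq J) (F : J -> R -> C) :
  (forall j, isL1 (F j)) ->
  cint (fun t => \sum_(j <- r) F j t) = \sum_(j <- r) cint (F j).
Proof.
move=> LF; elim: r => [|j r IH].
  by under eq_fun do rewrite big_nil; rewrite cint_cst big_nil.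
under eq_fun do rewrite big_cons; rewrite cintD//; last exact: L1_sum.
by rewrite IH big_cons.
Qed.

(** Multiplying by the conjugate of the integral makes the integral real and nonnegative; the real
    part is then compared pointwise with the modulus. *)
Lemma cabs_cint_le f : isL1 f -> cabs (cint f) <= L1norm f.
Proof.
move=> Lf; set c := cint f; have [c0|c0] := eqVneq c 0.
  by rewrite c0 cabs0; apply: RI_ge0 => t _; exact: cabs_ge0.
have cp : 0 < cabs c by rewrite cabs_gt0.
rewrite -(ler_pM2l cp) -expr2.
have -> : cabs c ^+ 2 = complex.Re (cint (fun t => c^*%C * f t)).
  by rewrite cintZ// mulrC mulcC.
rewrite L1normE -RIZ; last exact: L1_intg.
change (RI (fun t => complex.Re (c^*%C * f t)) <= RI (fun t => cabs c * cabs (f t))).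
apply: RI_le.
- exact/L1_intgRe/L1Z.
- exact/intgZ/L1_intg.
- by move=> t _; apply: le_trans (Re_le_cabs _) _; rewrite cabsM cabs_conj.
Qed.

Lemma L1norm_ge0 f : 0 <= L1norm f.
Proof. by rewrite L1normE; apply: RI_ge0 => t _; exact: cabs_ge0. Qed.

Lemma L1norm_ae f g : cmeas f -> cmeas g -> aeI (fun t => f t = g t) ->
  L1norm f = L1norm g.
Proof.
move=> mf mg h; rewrite !L1normE; apply: RI_ae; [exact: mI_cabs..|].
by apply: aeIS h _ => t _ ->.
Qed.

Lemma L1normD f g : isL1 f -> isL1 g ->
  L1norm (fun t => f t + g t) <= L1norm f + L1norm g.
Proof.
move=> Lf Lg; rewrite !L1normE -RID; [|exact: L1_intg..].
apply: RI_le; [exact/L1_intg/L1D|apply: intgD; exact: L1_intg|].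
by move=> t _; exact: cabsD.
Qed.

Lemma L1normM_bound_ae f g M : isL1 f -> cmeas g ->
  aeI (fun t => cabs (g t) <= M) -> L1norm (fun t => g t * f t) <= M * L1norm f.
Proof.
move=> Lf mg gM; rewrite !L1normE -RIZ; last exact: L1_intg.
apply: RI_le_ae; [exact/L1_intg/(L1M_bound_ae Lf mg gM)|exact/intgZ/L1_intg|].
by apply: aeIS gM _ => t _ h; rewrite cabsM ler_wpM2r ?cabs_ge0.
Qed.

Lemma L1normM_unimodular f g : cmeas f -> cmeas g ->
  aeI (fun t => cabs (g t) = 1) -> L1norm (fun t => g t * f t) = L1norm f.
Proof.
move=> mf mg h; rewrite !L1normE; apply: RI_ae.
- exact: mI_cabs (cmeasM mg mf).
- exact: mI_cabs.
- by apply: aeIS h _ => t _ g1; rewrite cabsM g1 mul1r.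
Qed.

End ComplexIntegral.

(** * Exponentials and Fejér approximation *)

(** A free ultrafilter makes all bounded sequences converge at once, so countably many Fourier
    coefficients and norms have simultaneous limits without a diagonal extraction. Refining [\oo]
    keeps every eventual property. *)
Lemma ultra_limit (R : realType) : exists2 U : set_system nat, ProperFilter U &
  (forall A : set nat, (\forall n \near \oo, A n) -> U A) /\
  (forall v : nat -> R, (exists B : R, forall n, `|v n| <= B) ->
     exists l : R, v n @[n --> U] --> l).
Proof.
have [U [UU evU]] := @ultraFilterLemma nat \oo _.
have PU : ProperFilter U by exact: ultra_proper.
exists U => //; split => [A|v [B vB]]; first exact: evU.
have [] := @segment_compact R (- B) B (fmap v U).
  by apply: nearW => n /=; rewrite in_itv /= -ler_norml.
move=> l [_ cl]; exists l => N Nl.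
have [//|h] := in_ultra_setVsetC (v @^-1` N) UU.
have [y [yN Ny]] := cl (~` N) N h Nl.
by case: yN.
Qed.

Section Exponentials.
Variable R : realType.
Local Notation C := R[i].
Local Notation Iu := (@Iu R).
Implicit Types (f g : R -> C) (c : C) (k l : int) (t x : R).

(** The character ζ^k of the circle; the subspace called E in the theorem is [inE]. *)
Definition E k t : C := expi (2 * pi * k%:~R * t).

Lemma E0 t : E 0 t = 1.
Proof. by rewrite /E mulr0 mul0r expi0. Qed.

Lemma ED k l t : E (k + l) t = E k t * E l t.
Proof. by rewrite /E rmorphD /= mulrDr mulrDl expiD. Qed.

Lemma EN k t : E (- k) t = (E k t)^*%C.
Proof. by rewrite /E rmorphN /= mulrN mulNr expiN. Qed.

Lemma cabsE k t : cabs (E k t) = 1.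
Proof. exact: cabs_expi. Qed.

Lemma EK k t : E (- k) t * E k t = 1.
Proof. by rewrite -ED addNr E0. Qed.

Lemma E_neq0 k t : E k t != 0.
Proof. by rewrite -cabs_gt0 cabsE. Qed.

Lemma EX (n : nat) t : E n%:Z t = E 1 t ^+ n.
Proof.
elim: n => [|n IH]; first by rewrite E0.
by rewrite -addn1 PoszD ED IH exprD expr1.
Qed.

Lemma E_sub k x t : E k (x - t) = E k x * E (- k) t.
Proof. by rewrite EN /E -expiN -expiD -mulrBr. Qed.

Lemma E_at1 k : E k 1 = 1.
Proof.
have E11 : E 1 1 = 1.
  apply: complex_ext => /=.
    by rewrite mulr1 mulr1 mulrC mulr_natr cos2pi.
  by rewrite mulr1 mulr1 mulrC mulr_natr sin2pi.
by case: k => n; rewrite ?NegzE ?EN EX E11 expr1n// conjc1.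
Qed.

Lemma continuous_linear_trig (h : R -> R) (a : R) :
  continuous h -> continuous (fun t => h (a * t)).
Proof.
move=> ch t; apply: (@continuous_comp _ _ _ (fun t => a * t) h).
  by apply: cvgMr; exact: cvg_id.
exact: ch.
Qed.

Lemma continuous_ReE k : continuous (fun t => complex.Re (E k t)).
Proof. exact: continuous_linear_trig (@continuous_cos R). Qed.

Lemma continuous_ImE k : continuous (fun t => complex.Im (E k t)).
Proof. exact: continuous_linear_trig (@continuous_sin R). Qed.

Lemma cmeasE k : cmeas (E k).
Proof.
by split; apply: mI_continuous; [exact: continuous_ReE|exact: continuous_ImE].
Qed.

Lemma L1E k : isL1 (E k).
Proof.
by apply: (@L1_bound _ _ 1) (cmeasE k) _; apply: aeI_all => t _; rewrite cabsE.
Qed.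

Lemma L1_EM k f : isL1 f -> isL1 (fun t => E k t * f t).
Proof.
by move=> Lf; apply: (@L1M_bound _ _ _ 1 Lf (cmeasE k)) => t _; rewrite cabsE.
Qed.

Lemma RI_FTC (F f : R -> R) : continuous f ->
  (forall x, is_derive x 1 F (f x)) -> RI f = F 1 - F 0.
Proof.
move=> cf dF.
have cF : continuous F.
  move=> x; apply: differentiable_continuous; apply/derivable1_diffP.
  by have := dF x; case.
have := @continuous_FTC2 R f F 0 1 ltr01 _ _ _.
rewrite /RI /Rintegral => ->//.
- exact: continuous_subspaceT.
- split.
  + by move=> x _; have := dF x; case.
  + by apply: cvg_at_right_filter; exact: cF.
  + by apply: cvg_at_left_filter; exact: cF.
- by move=> x _; rewrite derive1E; have := dF x; case.
Qed.

Lemma cint_E k : cint (E k) = (k == 0)%:R.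
Proof.
have [->|k0] := eqVneq k 0.
  by rewrite (cint_eq (g := fun=> 1)) ?cint_cst// => t _; rewrite E0.
set a : R := 2 * pi * k%:~R.
have a0 : a != 0.
  by rewrite !mulf_neq0// ?intr_eq0// ?gt_eqF// ?pi_gt0.
have [ca sa] : cos a = 1 /\ sin a = 0.
  by have := E_at1 k; rewrite /E mulr1 -/a => -[].
have dl x : is_derive x 1 (fun t => a * t) a.
  have := @is_deriveZ _ _ _ (@id R) a x 1 1 (is_derive_id _ _).
  by rewrite scaler1.
have HR : RI (fun t => cos (a * t)) = a^-1 * sin (a * 1) - a^-1 * sin (a * 0).
  apply: (@RI_FTC (fun t => a^-1 * sin (a * t))); first exact: continuous_ReE.
  move=> x.
  have H := @is_derive1_comp _ sin (fun t => a * t) x _ _ (is_derive_sin _) (dl x).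
  have -> : cos (a * x) = a^-1 *: (cos (a * x) * a).
    by rewrite /GRing.scale /= mulrCA mulVf// mulr1.
  exact: (@is_deriveZ _ _ _ _ a^-1 x 1 _ H).
have HI : RI (fun t => sin (a * t)) = (- a^-1) * cos (a * 1) - (- a^-1) * cos (a * 0).
  apply: (@RI_FTC (fun t => (- a^-1) * cos (a * t))); first exact: continuous_ImE.
  move=> x.
  have H := @is_derive1_comp _ cos (fun t => a * t) x _ _ (is_derive_cos _) (dl x).
  have -> : sin (a * x) = - a^-1 *: (- sin (a * x) * a).
    by rewrite /GRing.scale /= mulNr mulNr mulrN opprK mulrCA mulVf// mulr1.
  exact: (@is_deriveZ _ _ _ _ (- a^-1) x 1 _ H).
rewrite cintE; apply: complex_ext => /=.
  by rewrite HR mulr1 mulr0 sin0 sa mulr0 subr0.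
by rewrite HI mulr1 mulr0 cos0 ca subrr.
Qed.

Lemma fhatE f k : fhat f k = cint (fun t => E (- k) t * f t).
Proof. by apply: cint_eq => t _; rewrite EN /E -expiN. Qed.

Lemma fhat_eq f g k : (forall t, f t = g t) -> fhat f k = fhat g k.
Proof. by move=> /funext ->. Qed.

Lemma fhat_ae f g k : cmeas f -> cmeas g -> aeI (fun t => f t = g t) ->
  fhat f k = fhat g k.
Proof.
move=> mf mg h; rewrite !fhatE; apply: cint_ae; [exact: cmeasM (cmeasE _) _..|].
by apply: aeIS h _ => t _ ->.
Qed.

Lemma fhatD f g k : isL1 f -> isL1 g ->
  fhat (fun t => f t + g t) k = fhat f k + fhat g k.
Proof.
move=> Lf Lg; rewrite !fhatE -cintD; [|exact: L1_EM..].
by apply: cint_eq => t _; rewrite mulrDr.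
Qed.

Lemma fhatZ c f k : isL1 f -> fhat (fun t => c * f t) k = c * fhat f k.
Proof.
move=> Lf; rewrite !fhatE -cintZ; last exact: L1_EM.
by apply: cint_eq => t _; rewrite mulrCA.
Qed.

Lemma fhatB f g k : isL1 f -> isL1 g ->
  fhat (fun t => f t - g t) k = fhat f k - fhat g k.
Proof.
move=> Lf Lg; rewrite !fhatE -cintB; [|exact: L1_EM..].
by apply: cint_eq => t _; rewrite mulrBr.
Qed.

Lemma fhat_sum (J : Type) (r : seq J) (F : J -> R -> C) k :
  (forall j, isL1 (F j)) ->
  fhat (fun t => \sum_(j <- r) F j t) k = \sum_(j <- r) fhat (F j) k.
Proof.
move=> LF; rewrite fhatE; under eq_bigr do rewrite fhatE.
rewrite -cint_sum; last by move=> j; exact: L1_EM.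
by apply: cint_eq => t _; rewrite mulr_sumr.
Qed.

Lemma fhatJ f k : isL1 f -> fhat (fun t => (f t)^*%C) k = (fhat f (- k))^*%C.
Proof.
move=> Lf; rewrite !fhatE opprK -cintJ; last exact: L1_EM.
by apply: cint_eq => t _; rewrite conjM EN.
Qed.

Lemma fhatEM f k l : fhat (fun t => E l t * f t) k = fhat f (k - l).
Proof.
by rewrite !fhatE; apply: cint_eq => t _; rewrite mulrA -ED opprB addrC.
Qed.

Lemma cabs_fhat_le f k : isL1 f -> cabs (fhat f k) <= L1norm f.
Proof.
move=> Lf; rewrite fhatE; apply: le_trans (cabs_cint_le (L1_EM _ Lf)) _.
rewrite le_eqVlt; apply/orP; left; apply/eqP.
by rewrite !L1normE; apply: RI_eq => t _; rewrite cabsM cabsE mul1r.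
Qed.

Lemma L1_ZEM c k f : isL1 f -> isL1 (fun t => c * E k t * f t).
Proof.
by move=> Lf; under eq_fun do rewrite -mulrA; apply: L1Z; exact: L1_EM.
Qed.

Lemma cint_ZEM c k f : isL1 f ->
  cint (fun t => c * E k t * f t) = c * fhat f (- k).
Proof.
move=> Lf; rewrite fhatE opprK -cintZ; last exact: L1_EM.
by apply: cint_eq => t _; rewrite mulrA.
Qed.

Lemma fhat_E k l : fhat (E l) k = (k == l)%:R.
Proof.
rewrite fhatE (cint_eq (g := E (l - k))) ?cint_E ?subr_eq0 ?[l == k]eq_sym//.
by move=> t _; rewrite -ED addrC.
Qed.

Definition trig (T : R -> C) : Prop :=
  exists s : seq (C * int), T = fun t => \sum_(p <- s) p.1 * E p.2 t.

Lemma trig_monomial c k : trig (fun t => c * E k t).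
Proof. by exists [:: (c, k)]; apply/funext => t; rewrite big_seq1. Qed.

Lemma trig_sum (J : Type) (r : seq J) (F : J -> R -> C) :
  (forall j, trig (F j)) -> trig (fun t => \sum_(j <- r) F j t).
Proof.
move=> tF; elim: r => [|j r [s IH]].
  by exists [::]; apply/funext => t; rewrite !big_nil.
have [s' Fj] := tF j; exists (s' ++ s); apply/funext => t.
by rewrite big_cons big_cat Fj -(congr1 (fun h => h t) IH).
Qed.

Lemma L1_trig T : trig T -> isL1 T.
Proof.
by move=> [s ->]; apply: L1_sum => p; apply: L1Z; exact: L1E.
Qed.

Lemma cint_trigM T f : isL1 f -> (forall k, fhat f k = 0) -> trig T ->
  cint (fun t => T t * f t) = 0.
Proof.
move=> Lf f0 [s ->].
under cint_eq do rewrite mulr_suml.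
rewrite cint_sum => [|p]; last exact: L1_ZEM.
by rewrite big1// => p _; rewrite cint_ZEM// f0 mulr0.
Qed.

Lemma cmeas_isCT f : isCT f -> cmeas f.
Proof. by move=> [c1 c2 _]; split; exact: mI_continuous. Qed.

Lemma sin_pi_eq0 (y : R) : `|y| <= 1 -> sin (pi * y) = 0 ->
  [\/ y = 0, y = 1 | y = -1].
Proof.
wlog y0 : y / 0 <= y => [H|] y1 sy.
  have [y0|y0] := leP 0 y; first exact: H.
  have [| | |e|e|e] := H (- y); rewrite ?oppr_ge0 ?normrN ?mulrN ?sinN ?sy ?oppr0//.
  - exact: ltW.
  - by constructor 1; rewrite -[y]opprK e oppr0.
  - by constructor 3; rewrite -e opprK.
  - by move: y0; rewrite -[y]opprK e opprK ltNge ler01.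
rewrite (ger0_norm y0) in y1.
move: y0; rewrite le_eqVlt => /predU1P[<-|y0]; first by constructor 1.
move: y1; rewrite le_eqVlt => /predU1P[->|y1]; first by constructor 2.
have := @sin_gt0_pi R (pi * y); rewrite sy ltxx => H.
suff : false by []; apply: H.
by rewrite mulr_gt0 ?pi_gt0//= -[ltRHS]mulr1 ltr_pM2l// pi_gt0.
Qed.

(* If no [M] works, points violating the inequality for [M = n] accumulate at a
   pair [(x, t)] with [cos (2 pi (x - t)) = 1], i.e. at equal points of the circle. *)
Lemma korovkin_bound (phi : R -> R) (e : R) : continuous phi ->
  (forall t, phi (t + 1) = phi t) -> 0 < e ->
  exists M : R, forall x t, Iu x -> Iu t ->
    `|phi x - phi t| <= e + M * (1 - cos (2 * pi * (x - t))).
Proof.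
move=> cphi per e0; apply: contrapT => /forallNP H.
pose P n (p : R * R) := [/\ Iu p.1, Iu p.2 &
  e + n%:R * (1 - cos (2 * pi * (p.1 - p.2))) < `|phi p.1 - phi p.2|].
have PH n : exists p, P n p.
  have /existsNP[x /existsNP[t /not_implyP[Ix /not_implyP[It /negP]]]] := H n%:R.
  by rewrite -ltNge => h; exists (x, t).
have [u Hu] := boolp.choice PH.
have [U PU [evU limU]] := ultra_limit R.
have bI (v : nat -> R) : (forall n, Iu (v n)) -> exists B : R, forall n, `|v n| <= B.
  move=> Iv; exists 1 => n.
  have := Iv n; rewrite /Defs.Iu /= in_itv /= => /andP[v0 v1].
  by rewrite ger0_norm.
have limI (v : nat -> R) (l : R) : (forall n, Iu (v n)) -> v @ U --> l -> 0 <= l <= 1.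
  move=> Iv vl; apply/andP; split.
    apply: (cvgr_to_ge vl); apply: nearW => n.
    by have := Iv n; rewrite /Defs.Iu /= in_itv /= => /andP[].
  apply: (cvgr_to_le vl); apply: nearW => n.
  by have := Iv n; rewrite /Defs.Iu /= in_itv /= => /andP[].
have I1 n : Iu (u n).1 by case: (Hu n).
have I2 n : Iu (u n).2 by case: (Hu n).
have [x cx] := limU _ (bI _ I1).
have [t ct] := limU _ (bI _ I2).
have /andP[x0 x1] := limI _ _ I1 cx.
have /andP[t0 t1] := limI _ _ I2 ct.
have cphid : `|phi (u n).1 - phi (u n).2| @[n --> U] --> `|phi x - phi t|.
  apply: cvg_norm; apply: cvgB.
    exact: (cvg_comp _ _ cx (cphi x)).
  exact: (cvg_comp _ _ ct (cphi t)).
pose c := 1 - cos (2 * pi * (x - t)).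
have ccos : 1 - cos (2 * pi * ((u n).1 - (u n).2)) @[n --> U] --> c.
  apply: cvgB; first exact: cvg_cst.
  have h : 2 * pi * ((u n).1 - (u n).2) @[n --> U] --> 2 * pi * (x - t).
    by apply: cvgMr; exact: cvgB.
  exact: (cvg_comp _ _ h (@continuous_cos R _)).
have c0 : 0 <= c by rewrite subr_ge0 cos_le1.
have key (m : nat) : e + m%:R * c <= `|phi x - phi t|.
  have cl : e + m%:R * (1 - cos (2 * pi * ((u n).1 - (u n).2))) @[n --> U] -->
            e + m%:R * c.
    by apply: cvgD; [exact: cvg_cst|exact: cvgMr].
  apply: (ler_cvg_to cl cphid); apply: evU.
  exists m => // n /= mn; have [_ _ /ltW] := Hu n; apply: le_trans.
  by rewrite lerD2l ler_wpM2r ?ler_nat// subr_ge0 cos_le1.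
(* [key] holds for every [m], so a positive [c] would push its left side beyond the fixed right
   side. *)
have cz : c = 0.
  apply/eqP; rewrite eq_le c0 andbT leNgt; apply/negP => cp.
  have := key (Num.truncn (`|phi x - phi t| / c)).+1; apply/negP; rewrite -ltNge.
  rewrite (@lt_trans _ _ ((Num.truncn (`|phi x - phi t| / c)).+1%:R * c))//; last first.
    by rewrite ltrDr.
  by rewrite -ltr_pdivrMr// truncnS_gt.
have s0 : sin (pi * (x - t)) = 0.
  apply/eqP; rewrite -sqrf_eq0 sin2cos2.
  have := cz; rewrite /c -mulrA mulr_natl cos_mulr2n => h.
  by apply/eqP; lra.
have xt1 : `|x - t| <= 1 by rewrite ler_norml; apply/andP; split; lra.
(* Either [x] and [t] coincide or they are the endpoints 0 and 1, which periodicity identifies. *)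
have eqphi : phi x = phi t.
  have [h|h|h] := sin_pi_eq0 xt1 s0.
  - by congr phi; lra.
  - by rewrite (_ : x = t + 1) ?per//; lra.
  - by rewrite (_ : t = x + 1) ?per//; lra.
have := key 0; rewrite mul0r addr0 eqphi subrr normr0.
by apply/negP; rewrite -ltNge.
Qed.

Lemma cabs_one_sub_expi (y : R) : cabs (1 - expi y) ^+ 2 = 2 * (1 - cos y).
Proof.
rewrite cabs_sqr /= -[RHS](_ : 1 - 2 * cos y + (cos y ^+ 2 + sin y ^+ 2) = _).
  by rewrite add0r sqrrN; ring.
by rewrite cos2Dsin2; ring.
Qed.

(** Korovkin's argument for the Fejér kernel [K]: it is nonnegative with mean 1, so the error at [x]
    is the mean of [phi x - phi t] against [K]. [korovkin_bound] reduces its estimate to the single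
    test function 1 - cos, against which [K] integrates to at most 2 / N. *)
Lemma fejer phi : isCT phi -> forall e : R, 0 < e ->
  exists2 T, trig T & forall x, Iu x -> cabs (phi x - T x) <= e.
Proof.
move=> ctphi e e0; have [c1 c2 per] := ctphi.
have mphi := cmeas_isCT ctphi.
(* The real and imaginary parts take a quarter of [e] each, which leaves half of [e] for the
   concentration of the kernel. *)
have e40 : 0 < e / 4 by rewrite divr_gt0.
have [M1 HM1] := korovkin_bound c1 (fun t => congr1 _ (per t)) e40.
have [M2 HM2] := korovkin_bound c2 (fun t => congr1 _ (per t)) e40.
pose M := `|M1| + `|M2|.
have HM x t : Iu x -> Iu t ->
    cabs (phi x - phi t) <= e / 2 + M * (1 - cos (2 * pi * (x - t))).
  move=> Ix It; apply: le_trans (cabs_le_ReIm _) _; rewrite ReD ImD ReN ImN.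
  have := lerD (HM1 x t Ix It) (HM2 x t Ix It).
  move=> h; apply: le_trans h _.
  have c0 : 0 <= 1 - cos (2 * pi * (x - t)) by rewrite subr_ge0 cos_le1.
  have := ler_wpM2r c0 (ler_norm M1); have := ler_wpM2r c0 (ler_norm M2).
  by rewrite /M; lra.
have M0 : 0 <= M by rewrite addr_ge0.
(* Large enough for the kernel's share of the error, M (2 / N), to be at most e / 2. *)
pose N := (Num.truncn (4 * M / e)).+1.
have N0 : 0 < N%:R :> R by rewrite ltr0n.
have MN : M * (2 / N%:R) <= e / 2.
  have : 4 * M / e < N%:R by exact: truncnS_gt.
  rewrite ltr_pdivrMr// => h.
  by rewrite mulrA ler_pdivrMr//; lra.
pose D t := \sum_(j < N) E j%:Z t.
pose K x t : R := cabs (D (x - t)) ^+ 2 / N%:R.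
have K0 x t : 0 <= K x t by rewrite divr_ge0 ?sqr_ge0 ?ltW.
have KE x t : (K x t)%:C%C = \sum_(j < N) \sum_(l < N)
    (N%:R^-1 * E (j%:Z - l%:Z) x) * E (l%:Z - j%:Z) t.
  have -> : (K x t)%:C%C = N%:R^-1 * (D (x - t) * (D (x - t))^*%C).
    by rewrite mulcC /K rmorphM /= mulrC fmorphV rmorph_nat.
  rewrite /D conj_sum mulr_suml mulr_sumr; apply: eq_bigr => j _.
  rewrite !mulr_sumr; apply: eq_bigr => l _.
  by rewrite -EN -ED E_sub opprB mulrA.
have LK x : isL1 (fun t => (K x t)%:C%C).
  under eq_fun do rewrite KE.
  by apply: L1_sum => j; apply: L1_sum => l; apply: L1Z; exact: L1E.
have iK x : intg (K x) by exact: L1_intgRe (LK x).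
have K1 x : RI (K x) = 1.
  apply: (@complexI R); rewrite -cint_real.
  under cint_eq do rewrite KE.
  rewrite cint_sum; last by move=> j; apply: L1_sum => l; apply: L1Z; exact: L1E.
  rewrite (eq_bigr (fun=> N%:R^-1)) => [|j _].
    by rewrite sumr_const card_ord -(mulr_natr (N%:R^-1)) mulVf// pnatr_eq0.
  rewrite cint_sum => [|l]; last exact/L1Z/L1E.
  rewrite (bigD1 j) //= big1 => [|l lj].
    by rewrite cintZ ?cint_E ?subrr ?eqxx ?E0 ?mulr1 ?addr0//; exact: L1E.
  rewrite cintZ ?cint_E; last exact: L1E.
  by rewrite subr_eq0 eqz_nat val_eqE (negbTE lj) mulr0.
(* The geometric sum telescopes, (1 - ζ) D = 1 - ζ^N, and 2 (1 - cos) is |1 - ζ|^2. The product is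
   therefore |1 - ζ^N|^2 / (2 N), with numerator at most 4. *)
have Kcos x t : K x t * (1 - cos (2 * pi * (x - t))) <= 2 / N%:R.
  have -> : K x t * (1 - cos (2 * pi * (x - t))) =
      cabs (1 - E 1 (x - t) ^+ N) ^+ 2 / (2 * N%:R).
    have -> : 1 - E 1 (x - t) ^+ N = (1 - E 1 (x - t)) * D (x - t).
      rewrite -opprB subrX1 -mulNr opprB; congr (_ * _).
      by apply: eq_bigr => j _; rewrite EX.
    rewrite cabsM exprMn {1}/E cabs_one_sub_expi mulr1 /K; field.
    by rewrite gt_eqF.
  rewrite ler_pdivrMr ?mulr_gt0//.
  have -> : 2 / N%:R * (2 * N%:R) = 2 ^+ 2 :> R by field; rewrite gt_eqF.
  rewrite ler_pXn2r ?nnegrE ?cabs_ge0//.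
  apply: le_trans (cabsD _ _) _.
  by rewrite cabsN cabsX cabsE cabs1 expr1n; lra.
(* The convolution of [phi] with [K], read off from the expansion [KE]. *)
pose T x := \sum_(j < N) \sum_(l < N)
  (N%:R^-1 * fhat phi (j%:Z - l%:Z)) * E (j%:Z - l%:Z) x.
exists T.
  by apply: trig_sum => j; apply: trig_sum => l; exact: trig_monomial.
move=> x Ix.
have bphi t : Iu t -> cabs (phi t) <= cabs (phi x) + (e / 2 + M * 2).
  move=> It; have -> : phi t = phi x - (phi x - phi t) by rewrite opprB addrC subrK.
  apply: le_trans (cabsD _ _) _; rewrite cabsN lerD2l.
  apply: le_trans (HM x t Ix It) _; rewrite lerD2l ler_wpM2l//.
  by have := cos_geN1 (2 * pi * (x - t)); lra.
have Lphi : isL1 phi by apply: L1_bound mphi (aeI_all bphi).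
have -> : phi x - T x = cint (fun t => (K x t)%:C%C * (phi x - phi t)).
  have LKp : isL1 (fun t => (K x t)%:C%C * phi t).
    apply: (L1_le (h := fun t => (cabs (phi x) + (e / 2 + M * 2)) * K x t)).
    - by apply: cmeasM mphi; exact: L1_cmeas.
    - exact: intgZ.
    - move=> t It; rewrite cabsM cabs_real ger0_norm// mulrC.
      by rewrite ler_wpM2r// bphi.
  under cint_eq do rewrite mulrBr.
  rewrite cintB//; last first.
    by under eq_fun do rewrite mulrC; exact: L1Z.
  rewrite (cint_eq (g := fun t => phi x * (K x t)%:C%C)); last first.
    by move=> t _; rewrite mulrC.
  rewrite cintZ// cint_real K1 mulr1; congr (_ - _).
  under [RHS]cint_eq => t _.
    rewrite KE mulr_suml; under eq_bigr do rewrite mulr_suml; over.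
  rewrite cint_sum => [|j]; last by apply: L1_sum => l; exact: L1_ZEM.
  apply: eq_bigr => j _; rewrite cint_sum => [|l]; last exact: L1_ZEM.
  by apply: eq_bigr => l _; rewrite cint_ZEM// opprB mulrAC.
have LKd : isL1 (fun t => (K x t)%:C%C * (phi x - phi t)).
  apply: (L1_le (h := fun t => (e / 2 + M * 2) * K x t)).
  - by apply: cmeasM; [exact: L1_cmeas|exact: cmeasB (cmeas_cst _) mphi].
  - exact: intgZ.
  - move=> t It; rewrite cabsM cabs_real ger0_norm// mulrC ler_wpM2r//.
    apply: le_trans (HM x t Ix It) _; rewrite lerD2l ler_wpM2l//.
    by have := cos_geN1 (2 * pi * (x - t)); lra.
apply: le_trans (cabs_cint_le LKd) _; rewrite L1normE.
apply: (@le_trans _ _ (RI (fun t => e / 2 * K x t + M * (2 / N%:R)))).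
  apply: RI_le; [exact: L1_intg|apply: intgD; [exact: intgZ|exact: intg_cst]|].
  move=> t It; rewrite cabsM cabs_real ger0_norm//.
  apply: le_trans (ler_wpM2l (K0 x t) (HM x t Ix It)) _.
  rewrite mulrDr [K x t * (e / 2)]mulrC lerD2l mulrCA ler_wpM2l//.
rewrite RID; [|exact: intgZ|exact: intg_cst].
by rewrite RIZ// K1 RI_cst; lra.
Qed.

End Exponentials.

(** * Injectivity of Fourier coefficients on L^1 *)

Section FourierUniqueness.
Variable R : realType.
Local Notation C := R[i].
Local Notation Iu := (@Iu R).
Implicit Types (f g : R -> C).

Lemma RI_dominated0 (f_ : nat -> R -> R) (f h : R -> R) :
  (forall n, mI (f_ n)) -> mI f -> intg h ->
  (forall t, Iu t -> f_ n t @[n --> \oo] --> f t) ->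
  (forall n t, Iu t -> `|f_ n t| <= h t) ->
  (forall n, RI (f_ n) = 0) -> RI f = 0.
Proof.
move=> mf_ mf ih cvf le0 f0.
have [] := @dominated_convergence _ _ _ (@leb R) Iu (@measurable_Iu R)
  (fun n => EFin \o f_ n) (EFin \o f) (EFin \o h).
- by move=> n; apply/measurable_EFinP; exact: mf_.
- exact/measurable_EFinP.
- apply: aeW => t It; apply: cvg_EFin; first exact: nearW.
  exact: cvf.
- exact: ih.
- by apply: aeW => t n It /=; rewrite lee_fin; exact: le0.
move=> if_ _.
have -> : [sequence (\int[@leb R]_(x in Iu) (EFin \o f_ n) x)%E]_n = fun=> 0%E.
  apply/funext => n /=; rewrite -[RHS](congr1 EFin (f0 n)) EFin_RI//.
  by apply: intg_le ih _ => //; exact: le0.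
move=> H; have : (RI f)%:E = 0%E.
  rewrite EFin_RI//; apply: cvg_unique H (cvg_cst _).
  exact: ereal_hausdorff.
by case.
Qed.

(** Periodic continuous functions recover the indicator of []0, x[], so the integrals of [g] over
    initial segments vanish; differentiating the primitive almost everywhere gives [g = 0]. *)
Lemma RI_periodic_inj (g : R -> R) : intg g ->
  (forall psi : R -> R, continuous psi -> (forall t, psi (t + 1) = psi t) ->
     RI (fun t => psi t * g t) = 0) ->
  aeI (fun t => g t = 0).
Proof.
move=> ig H.
have K (x : R) : 0 < x < 1 -> RI (fun t => (t <= x)%R%:R * g t) = 0.
  move=> /andP[x0 x1].
  (* Within the unit interval this is positive exactly on []0, x[], and it is 1-periodic because
     both sines change sign under t -> t + 1. Truncating n y between 0 and 1 gives continuous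
     periodic functions that tend to the indicator. *)
  pose y t : R := sin (pi * t) * sin (pi * (x - t)).
  pose psi n t : R := Num.min 1 (n%:R * Num.max 0 (y t)).
  have cy : continuous y.
    move=> t; apply: cvgM.
      exact: (continuous_linear_trig (@continuous_sin R)).
    apply: (@continuous_comp _ _ _ (fun t => pi * (x - t)) sin).
      by apply: cvgMr; apply: cvgB; [exact: cvg_cst|exact: cvg_id].
    exact: continuous_sin.
  have cpsi n : continuous (psi n).
    rewrite /psi; under eq_fun do rewrite minr_absE maxr_absE sub0r normrN add0r.
    have cz : continuous (fun t => n%:R * ((y t + `|y t|) / 2)).
      move=> t; apply: cvgMr; apply: cvgMl; apply: cvgD; first exact: cy.
      by apply: cvg_norm; exact: cy.
    move=> t; apply: cvgMl; apply: cvgB.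
      by apply: cvgD; [exact: cvg_cst|exact: cz].
    by apply: cvg_norm; apply: cvgB; [exact: cvg_cst|exact: cz].
  have ppsi n t : psi n (t + 1) = psi n t.
    rewrite /psi /y mulrDr mulr1 sinDpi.
    have -> : pi * (x - (t + 1)) = pi * (x - t) - pi by ring.
    have -> : sin (pi * (x - t) - pi) = - sin (pi * (x - t)).
      by rewrite -[in RHS](subrK pi (pi * (x - t))) sinDpi opprK.
    by rewrite mulrNN.
  have b1 n t : 0 <= psi n t <= 1.
    by rewrite /psi le_min ler01 mulr_ge0//= ?le_max ?lexx// ge_min lexx.
  have ypos t : 0 < t < x -> 0 < y t.
    move=> /andP[t0 tx]; apply: mulr_gt0; apply: sin_gt0_pi; apply/andP; split.
    - by rewrite mulr_gt0 ?pi_gt0.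
    - by rewrite -[ltRHS]mulr1 ltr_pM2l ?pi_gt0//; lra.
    - by rewrite mulr_gt0 ?pi_gt0//; lra.
    - by rewrite -[ltRHS]mulr1 ltr_pM2l ?pi_gt0//; lra.
  have yneg t : Iu t -> x <= t -> y t <= 0.
    rewrite /Defs.Iu /= in_itv /= => /andP[t0 t1] tx.
    have s1 : 0 <= sin (pi * t).
      apply: sin_ge0_pi; rewrite mulr_ge0 ?pi_ge0//=.
      by rewrite -[leRHS]mulr1 ler_pM2l ?pi_gt0.
    have s2 : 0 <= sin (pi * (t - x)).
      apply: sin_ge0_pi; rewrite mulr_ge0 ?pi_ge0 ?subr_ge0//=.
      by rewrite -[leRHS]mulr1 ler_pM2l ?pi_gt0//; lra.
    by rewrite /y -opprB mulrN sinN mulrN oppr_le0 mulr_ge0.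
  have mind (P : R -> R) : (P = fun t => (t <= x)%R%:R) \/
      (P = fun t => (0 < t < x)%R%:R) -> mI P.
    case=> ->.
      rewrite (_ : (fun _ => _) = \1_(`]-oo, x]%classic)).
        by apply: measurable_indic; exact: measurable_itv.
      by apply/funext => t; rewrite indicE mem_setE in_itv.
    rewrite (_ : (fun _ => _) = \1_(`]0, x[%classic)).
      by apply: measurable_indic; exact: measurable_itv.
    by apply/funext => t; rewrite indicE mem_setE in_itv.
  have mg := intg_mI ig.
  transitivity (RI (fun t => (0 < t < x)%R%:R * g t)).
    apply: RI_ae.
    - by apply: mI_M => //; apply: mind; left.
    - by apply: mI_M => //; apply: mind; right.
    - exists [set 0; x]; split.
      + exact: measurableU (measurable_set1 _) (measurable_set1 _).
      + apply/eqP; rewrite eq_le; apply/andP; split => //.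
        apply: le_trans (measureU2 (@leb R) (measurable_set1 _) (measurable_set1 _)) _.
        by rewrite [X in (X + _)%E]lebesgue_measure_set1
          [X in (_ + X)%E]lebesgue_measure_set1 adde0.
      + move=> t /= /not_implyP[]; rewrite /Defs.Iu /= in_itv /= => /andP[t0 t1] ne.
        have [->|tn0] := eqVneq t 0; first by left.
        have [->|tnx] := eqVneq t x; first by right.
        by case: ne; rewrite le_eqVlt (negbTE tnx) /= [0 < t]lt_def tn0 t0.
  apply: (@RI_dominated0 (fun n t => psi n t * g t) _ (fun t => `|g t|)).
  - by move=> n; apply: mI_M => //; apply: mI_continuous.
  - by apply: mI_M => //; apply: mind; right.
  - exact: intg_norm.
  - move=> t It; apply: cvgMl.
    have [ht|ht] := boolP (0 < t < x).
      apply: cvg_near_cst.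
      exists (Num.truncn (y t)^-1).+1 => // n /= hn.
      rewrite /psi (max_idPr (ltW (ypos t ht))); apply/eqP; rewrite min_l//.
      rewrite -ler_pdivrMr ?ypos// div1r; apply: le_trans (ltW (truncnS_gt _)) _.
      by rewrite ler_nat.
    apply: cvg_near_cst; apply: nearW => n.
    rewrite /psi (max_idPl _) ?mulr0 ?min_r//.
    have [xt|tx] := leP x t; first exact: yneg.
    have -> : t = 0; last by rewrite /y mulr0 sin0 mul0r.
    move: It ht; rewrite /Defs.Iu /= in_itv /= tx andbT -leNgt => /andP[t0 _] t0'.
    by apply/eqP; rewrite eq_le t0 t0'.
  - move=> n t It; rewrite normrM ler_piMl// ger0_norm; by have /andP[] := b1 n t.
  - by move=> n; exact: H.
(* Extended by zero, [g] has a primitive on the whole line; it vanishes on the open unit interval,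
   while its derivative there is [g] almost everywhere. *)
pose h : R -> R := g \_ Iu.
have lh : locally_integrable [set: R] h.
  exact: (integrable_locally (@measurable_Iu R) ig).
have iT : (@lebesgue_measure R).-integrable setT (EFin \o h).
  have := (@integrable_mkcond _ (measurableTypeR R) R (@leb R) Iu (EFin \o g)
    (@measurable_Iu R)).1 ig.
  apply: eq_integrable => // t _ /=; rewrite /h /patch /=.
  by case: ifP.
have ih y : (@lebesgue_measure R).-integrable `]-oo, y] (EFin \o h).
  by apply: integrableS iT => //; exact: measurable_itv.
have := @FTC1Ny R h ih lh; set F := fun x => _ => HF.
have F0 x : 0 < x < 1 -> F x = 0.
  move=> x01; rewrite -(K x x01) /F /RI [RHS]Rintegral_mkcond Rintegral_mkcond.
  apply: eq_Rintegral => t _; rewrite /h /patch !mem_setE in_itv /=.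
  by case: (t <= x); rewrite ?mul1r ?mul0r//; case: ifP.
have endpts : aeI (fun t : R => 0 < t < 1).
  exists [set 0; 1]; split.
  - exact: measurableU (measurable_set1 _) (measurable_set1 _).
  - apply/eqP; rewrite eq_le; apply/andP; split => //.
    apply: le_trans (measureU2 (@leb R) (measurable_set1 _) (measurable_set1 _)) _.
    by rewrite [X in (X + _)%E]lebesgue_measure_set1
      [X in (_ + X)%E]lebesgue_measure_set1 adde0.
  - move=> t /= /not_implyP[]; rewrite /Defs.Iu /= in_itv /= => /andP[t0 t1] ne.
    have [->|tn0] := eqVneq t 0; first by left.
    have [->|tnx] := eqVneq t 1; first by right.
    by case: ne; rewrite lt_def tn0 t0 lt_neqAle tnx t1.
have HF' : aeI (fun t => derivable F t 1 /\ F^`()%classic t = h t).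
  by rewrite aeIE; case: HF => N [mN N0 sub]; exists N; split => // t /= ht;
    apply: sub => /= ht'; exact: ht.
apply: aeIS2 HF' endpts _ => t It [dF eF] t01.
have -> : g t = h t by rewrite /h /patch mem_set.
rewrite -eF derive1E (@near_eq_derive _ _ _ F (cst 0)) ?derive_cst//.
have tin : t \in `]0, 1[ by rewrite in_itv.
apply: filterS (near_in_itvoo tin) => s; rewrite in_itv /= => s01.
exact: F0.
Qed.

Lemma cint_isCT f phi : isL1 f -> (forall k, fhat f k = 0) -> isCT phi ->
  cint (fun t => phi t * f t) = 0.
Proof.
move=> Lf f0 ct; apply/eqP; rewrite -cabs_eq0; apply/eqP/le_anti.
rewrite cabs_ge0 andbT; apply/ler_addgt0Pl => e e0; rewrite addr0.
have n0 : 0 < L1norm f + 1 by rewrite ltr_wpDl// L1norm_ge0.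
have [T tT hT] := fejer ct (divr_gt0 e0 n0).
have mphi := cmeas_isCT ct; have mT := L1_cmeas (L1_trig tT).
have md := cmeasB mphi mT.
have bd := @L1M_bound _ _ _ _ Lf md hT.
have LT : isL1 (fun t => T t * f t).
  have [s ->] := tT; under eq_fun do rewrite mulr_suml.
  by apply: L1_sum => p; exact: L1_ZEM.
have -> : cint (fun t => phi t * f t) = cint (fun t => (phi t - T t) * f t).
  rewrite -[RHS]addr0 -(cint_trigM Lf f0 tT) -cintD//.
  by apply: cint_eq => t _; rewrite mulrBl subrK.
apply: le_trans (cabs_cint_le bd) _.
apply: le_trans (L1normM_bound_ae Lf md (aeI_all hT)) _.
rewrite mulrAC ler_pdivrMr// ler_pM2l// lerDl ler01//.
Qed.

(** Real test functions separate real and imaginary parts, which reduces the claim to real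
    integrands. *)
Lemma fhat_inj f : isL1 f -> (forall k, fhat f k = 0) -> aeI (fun t => f t = 0).
Proof.
move=> Lf f0.
have key (psi : R -> R) : continuous psi -> (forall t, psi (t + 1) = psi t) ->
    cint (fun t => (psi t)%:C%C * f t) = 0.
  move=> cpsi ppsi; apply: cint_isCT => //; split => //=.
  - by move=> t; exact: cvg_cst.
  - by move=> t; rewrite ppsi.
have HR := @RI_periodic_inj (fun t => complex.Re (f t)) (L1_intgRe Lf).
have HI := @RI_periodic_inj (fun t => complex.Im (f t)) (L1_intgIm Lf).
apply: aeIS2 (HR _) (HI _) _.
- move=> psi cpsi ppsi; have /(congr1 (@complex.Re R)) := key psi cpsi ppsi.
  rewrite cintE /= => <-; apply: RI_eq => t _.
  by rewrite ReM /= mul0r subr0.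
- move=> psi cpsi ppsi; have /(congr1 (@complex.Im R)) := key psi cpsi ppsi.
  rewrite cintE /= => <-; apply: RI_eq => t _.
  by rewrite ImM /= mul0r addr0.
- by move=> t _ hr hi; exact: complex_ext.
Qed.

Lemma fhat_ae_eq f g : isL1 f -> isL1 g -> (forall k, fhat f k = fhat g k) ->
  aeI (fun t => f t = g t).
Proof.
move=> Lf Lg h; have := fhat_inj (L1B Lf Lg).
move=> H; apply: aeIS (H _) _ => [k|t _ /eqP]; last by rewrite subr_eq0 => /eqP.
by rewrite fhatB// h subrr.
Qed.

End FourierUniqueness.

(** * Square-integrable functions *)

Section L2.
Variable R : realType.
Local Notation C := R[i].
Local Notation Iu := (@Iu R).
Implicit Types (f g : R -> C) (c : C).

Definition isL2 f : Prop := cmeas f /\ intg (fun t => cabs (f t) ^+ 2).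
Definition n2 f : R := RI (fun t => cabs (f t) ^+ 2).

Lemma n2_ge0 f : 0 <= n2 f.
Proof. by apply: RI_ge0 => t _; exact: sqr_ge0. Qed.

Lemma L2_cmeas f : isL2 f -> cmeas f. Proof. by case. Qed.

Lemma L2_intg f : isL2 f -> intg (fun t => cabs (f t) ^+ 2). Proof. by case. Qed.

Lemma L2_le_ae f (h : R -> R) : cmeas f -> intg h ->
  aeI (fun t => cabs (f t) ^+ 2 <= h t) -> isL2 f.
Proof.
move=> mf ih H; split => //; apply: intg_le_ae ih _; first by apply: mI_X; exact: mI_cabs.
by apply: aeIS H _ => t _; rewrite ger0_norm ?sqr_ge0.
Qed.

Lemma L2_le f (h : R -> R) : cmeas f -> intg h ->
  (forall t, Iu t -> cabs (f t) ^+ 2 <= h t) -> isL2 f.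
Proof. by move=> mf ih H; apply: L2_le_ae mf ih (aeI_all H). Qed.

Lemma L2M_L1 f g : isL2 f -> isL2 g -> isL1 (fun t => f t * g t).
Proof.
move=> [mf i_f] [mg i_g]; apply: L1_le (intgD i_f i_g) _; first exact: cmeasM.
move=> t _; rewrite cabsM.
have := sqr_ge0 (cabs (f t) - cabs (g t)); have := cabs_ge0 (f t).
by have := cabs_ge0 (g t); nra.
Qed.

Lemma L2_bound_ae f M : cmeas f -> aeI (fun t => cabs (f t) <= M) -> isL2 f.
Proof.
move=> mf H; apply: L2_le_ae mf (intg_cst (M ^+ 2)) _.
apply: aeIS H _ => t _ h; rewrite ler_pXn2r ?nnegrE ?cabs_ge0//.
exact: le_trans (cabs_ge0 _) h.
Qed.

Lemma L2_cst c : isL2 (fun=> c).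
Proof. by apply: L2_bound_ae (cmeas_cst c) (aeI_all (fun t _ => lexx _)). Qed.

Lemma L2_L1 f : isL2 f -> isL1 f.
Proof.
by move=> Lf; have := L2M_L1 Lf (L2_cst 1); under eq_fun do rewrite mulr1.
Qed.

Lemma L2D f g : isL2 f -> isL2 g -> isL2 (fun t => f t + g t).
Proof.
move=> [mf i_f] [mg i_g]; apply: L2_le (intgZ 2 (intgD i_f i_g)) _.
  exact: cmeasD.
move=> t _; have h := cabsD (f t) (g t).
have := sqr_ge0 (cabs (f t) - cabs (g t)); have := cabs_ge0 (f t + g t); nra.
Qed.

Lemma L2M_bound_ae f g M : isL2 f -> cmeas g -> aeI (fun t => cabs (g t) <= M) ->
  isL2 (fun t => g t * f t).
Proof.
move=> [mf i_f] mg H; apply: L2_le_ae (intgZ (M ^+ 2) i_f) _.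
  exact: cmeasM.
apply: aeIS H _ => t _ h; rewrite cabsM exprMn ler_wpM2r ?sqr_ge0//.
rewrite ler_pXn2r ?nnegrE ?cabs_ge0//.
exact: le_trans (cabs_ge0 _) h.
Qed.

Lemma L2Z c f : isL2 f -> isL2 (fun t => c * f t).
Proof.
move=> Lf; apply: L2M_bound_ae Lf (cmeas_cst c) _.
exact: (aeI_all (fun t _ => lexx _)).
Qed.

Lemma L2N f : isL2 f -> isL2 (fun t => - f t).
Proof. by move=> Lf; have := L2Z (-1) Lf; under eq_fun do rewrite mulN1r. Qed.

Lemma L2B f g : isL2 f -> isL2 g -> isL2 (fun t => f t - g t).
Proof. by move=> Lf Lg; exact: L2D Lf (L2N Lg). Qed.

Lemma L2J f : isL2 f -> isL2 (fun t => (f t)^*%C).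
Proof.
move=> [mf i_f]; split; first exact: cmeasJ.
by under eq_fun do rewrite cabs_conj.
Qed.

Lemma L2_EM k f : isL2 f -> isL2 (fun t => E k t * f t).
Proof.
move=> Lf; apply: (@L2M_bound_ae _ _ 1 Lf (cmeasE _ k)).
by apply: aeI_all => t _; rewrite cabsE.
Qed.

Lemma L2E k : isL2 (@E R k).
Proof.
apply: (@L2_bound_ae _ 1) (cmeasE _ k) _.
by apply: aeI_all => t _; rewrite cabsE.
Qed.

Lemma n2_ae f g : cmeas f -> cmeas g -> aeI (fun t => f t = g t) -> n2 f = n2 g.
Proof.
move=> mf mg h; apply: RI_ae; [by apply: mI_X; exact: mI_cabs..|].
by apply: aeIS h _ => t _ ->.
Qed.

Lemma n2_distC f g : n2 (fun t => f t - g t) = n2 (fun t => g t - f t).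
Proof. by apply: RI_eq => t _; rewrite cabs_distC. Qed.

Lemma n2_cint f : (n2 f)%:C%C = cint (fun t => f t * (f t)^*%C).
Proof. by rewrite -cint_real; apply: cint_eq => t _; rewrite mulcC. Qed.

Lemma n2Z c f : isL2 f -> n2 (fun t => c * f t) = cabs c ^+ 2 * n2 f.
Proof.
move=> Lf; rewrite -RIZ; last exact: L2_intg.
by apply: RI_eq => t _; rewrite cabsM exprMn.
Qed.

Lemma n2_le f g : isL2 f -> isL2 g ->
  (forall t, Iu t -> cabs (f t) <= cabs (g t)) -> n2 f <= n2 g.
Proof.
move=> Lf Lg H; apply: RI_le; [exact: L2_intg..|move=> t It].
by rewrite ler_pXn2r ?nnegrE ?cabs_ge0// H.
Qed.

Lemma n2_eq0 f : isL2 f -> n2 f = 0 -> aeI (fun t => f t = 0).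
Proof.
move=> [_ i_f] h; have H := RI_eq0 i_f (fun t _ => sqr_ge0 _) h.
by apply: aeIS H _ => t _ /eqP; rewrite sqrf_eq0 cabs_eq0 => /eqP.
Qed.

Lemma cabs_sqrD (z w : C) :
  cabs (z + w) ^+ 2 = cabs z ^+ 2 + cabs w ^+ 2 + 2 * complex.Re (z * w^*%C).
Proof.
by rewrite !cabs_sqr; case: z => a b; case: w => c d /=; ring.
Qed.

Lemma n2D f g : isL2 f -> isL2 g ->
  n2 (fun t => f t + g t) =
  n2 f + n2 g + 2 * complex.Re (cint (fun t => f t * (g t)^*%C)).
Proof.
move=> Lf Lg; have iR := L1_intgRe (L2M_L1 Lf (L2J Lg)).
rewrite cintE /= -RIZ// -RID; [|exact: L2_intg..].
rewrite -RID; [|by apply: intgD; exact: L2_intg|exact: intgZ].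
by apply: RI_eq => t _; rewrite cabs_sqrD.
Qed.

Lemma parallelogram f g : isL2 f -> isL2 g ->
  n2 (fun t => f t + g t) + n2 (fun t => f t - g t) = 2 * n2 f + 2 * n2 g.
Proof.
move=> Lf Lg; have i1 := L2_intg (L2D Lf Lg); have i2 := L2_intg (L2B Lf Lg).
have i3 := L2_intg Lf; have i4 := L2_intg Lg.
rewrite -(RID i1 i2) -(RIZ 2 i3) -(RIZ 2 i4) -(RID (intgZ 2 i3) (intgZ 2 i4)).
apply: RI_eq => t _.
by rewrite !cabs_sqr ReD ImD ReD ImD ReN ImN; ring.
Qed.

Lemma n2D_le f g : isL2 f -> isL2 g ->
  n2 (fun t => f t + g t) <= 2 * n2 f + 2 * n2 g.
Proof. by move=> Lf Lg; rewrite -parallelogram// lerDl n2_ge0. Qed.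

(** Cauchy-Schwarz comes from the weighted inequality 2 x y <= s x^2 + y^2 / s. The optimal weight
    is sqrt B / sqrt A; when A or B is zero, a suitable weight contradicts I > 0. *)
Lemma amgm_sqrt (I A B : R) : 0 <= I -> 0 <= A -> 0 <= B ->
  (forall s, 0 < s -> 2 * I <= s * A + B / s) -> I <= Num.sqrt A * Num.sqrt B.
Proof.
move=> I0 A0 B0 H.
have [->|In0] := eqVneq I 0; first by rewrite mulr_ge0 ?sqrtr_ge0.
have Ip : 0 < I by rewrite lt_def In0.
have [A00|An0] := eqVneq A 0.
  have := H ((B + 1) / I); rewrite A00 mulr0 add0r divr_gt0 ?ltr_wpDl// => /(_ isT).
  rewrite ler_pdivlMr ?divr_gt0 ?ltr_wpDl//.
  have -> : 2 * I * ((B + 1) / I) = 2 * (B + 1) by field.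
  by move=> h; exfalso; lra.
have Ap : 0 < A by rewrite lt_def An0.
have [B00|Bn0] := eqVneq B 0.
  have := H (I / A); rewrite B00 mul0r addr0 divr_gt0// => /(_ isT).
  by rewrite divfK// => h; exfalso; lra.
have Bp : 0 < B by rewrite lt_def Bn0.
have sA : 0 < Num.sqrt A by rewrite sqrtr_gt0.
have sB : 0 < Num.sqrt B by rewrite sqrtr_gt0.
have := H (Num.sqrt B / Num.sqrt A) (divr_gt0 sB sA).
have hA : A = Num.sqrt A ^+ 2 by rewrite sqr_sqrtr.
have hB : B = Num.sqrt B ^+ 2 by rewrite sqr_sqrtr.
move: (Num.sqrt A) (Num.sqrt B) sA sB hA hB => a b a0 b0 -> ->.
have -> : b / a * a ^+ 2 + b ^+ 2 / (b / a) = 2 * (a * b).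
  by field; rewrite !gt_eqF.
by rewrite ler_pM2l.
Qed.

Lemma cauchy_schwarz f g : isL2 f -> isL2 g ->
  L1norm (fun t => f t * g t) <= Num.sqrt (n2 f) * Num.sqrt (n2 g).
Proof.
move=> Lf Lg; apply: amgm_sqrt; [exact: L1norm_ge0|exact: n2_ge0..|].
move=> s s0; rewrite L1normE -RIZ; last exact/L1_intg/L2M_L1.
rewrite -RIZ; last exact: L2_intg.
rewrite mulrC -RIZ; last exact: L2_intg.
rewrite -RID; [|exact: intgZ (L2_intg _)..].
apply: RI_le; [exact: intgZ (L1_intg (L2M_L1 _ _))
  |apply: intgD; exact: intgZ (L2_intg _)|].
move=> t _; rewrite cabsM -subr_ge0.
have -> : s * cabs (f t) ^+ 2 + s^-1 * cabs (g t) ^+ 2 - 2 * (cabs (f t) * cabs (g t))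
  = (s * cabs (f t) - cabs (g t)) ^+ 2 / s by field; rewrite gt_eqF.
by rewrite divr_ge0 ?sqr_ge0 ?ltW.
Qed.

Lemma cabs_dot_le f g : isL2 f -> isL2 g ->
  cabs (cint (fun t => f t * (g t)^*%C)) ^+ 2 <= n2 f * n2 g.
Proof.
move=> Lf Lg; have LJ := L2J Lg.
have := le_trans (cabs_cint_le (L2M_L1 Lf LJ)) (cauchy_schwarz Lf LJ).
have -> : n2 (fun t => (g t)^*%C) = n2 g by apply: RI_eq => t _; rewrite cabs_conj.
rewrite -sqrtrM ?n2_ge0// => h.
by rewrite -[leRHS]sqr_sqrtr ?mulr_ge0 ?n2_ge0// ler_pXn2r ?nnegrE ?cabs_ge0 ?sqrtr_ge0.
Qed.

Lemma L2_complete_real (u : nat -> R -> R) : (forall n, mI (u n)) ->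
  (forall n m, intg (fun t => (u n t - u m t) ^+ 2)) ->
  (forall e : R, 0 < e -> exists N, forall n m, (N <= n)%N -> (N <= m)%N ->
     RI (fun t => (u n t - u m t) ^+ 2) <= e) ->
  exists2 v, mI v & forall e : R, 0 < e -> exists N, forall n, (N <= n)%N ->
    intg (fun t => (u n t - v t) ^+ 2) /\ RI (fun t => (u n t - v t) ^+ 2) <= e.
Proof.
move=> mu iu cau.
have HN k : exists N, forall n m, (N <= n)%N -> (N <= m)%N ->
    RI (fun t => (u n t - u m t) ^+ 2) <= (4 ^+ k)^-1.
  by apply: cau; rewrite invr_gt0 exprn_gt0.
have [N0 hN0] := boolp.choice HN.
(* Summing the thresholds makes them nondecreasing while still dominating each [N0 k]. *)
pose N k := (\sum_(i < k.+1) N0 i)%N.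
have N0N k : (N0 k <= N k)%N by rewrite /N big_ord_recr /= leq_addl.
have NS k : (N k <= N k.+1)%N by rewrite /N [in X in (_ <= X)%N]big_ord_recr leq_addr.
have Nmono k l : (k <= l)%N -> (N k <= N l)%N.
  by move=> kl; apply: (@homo_leq _ N leq) => //; exact: leq_trans.
pose w k := u (N k).
pose d k t := `|w k.+1 t - w k t|.
have md k : mI (d k) by apply: mI_norm; apply: mI_B; exact: mu.
have p2 k : 0 < 2 ^+ k :> R by rewrite exprn_gt0.
have p4 k : 4 ^+ k = 2 ^+ k * 2 ^+ k :> R by rewrite -exprMn; congr (_ ^+ _); ring.
(* This is x <= c x^2 + 1 / c with c = 2^k. As the square has integral at most 4^-k, the integral of
   [d k] is at most 2 * 2^-k, which is summable. *)
have dle k t : d k t <= (2 ^+ k * (w k.+1 t - w k t) ^+ 2 + (2 ^+ k)^-1).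
  rewrite /d -[X in _ * X + _]real_normK ?num_real// -/(d k t) -subr_ge0.
  have -> : 2 ^+ k * d k t ^+ 2 + (2 ^+ k)^-1 - d k t =
    ((2 ^+ k * d k t - 1) ^+ 2 + 2 ^+ k * d k t) / 2 ^+ k.
    by field; rewrite gt_eqF.
  apply: divr_ge0; last exact: ltW.
  by apply: addr_ge0; [exact: sqr_ge0|apply: mulr_ge0; [exact: ltW|exact: normr_ge0]].
have id k : intg (d k).
  apply: intg_le (md k) (intgD (intgZ (2 ^+ k) (iu (N k.+1) (N k))) (intg_cst (2 ^+ k)^-1)) _.
  by move=> t _; rewrite ger0_norm ?normr_ge0//; exact: dle.
have RId k : RI (d k) <= 2 * (2 ^+ k)^-1.
  apply: (@le_trans _ _ (RI (fun t => 2 ^+ k * (w k.+1 t - w k t) ^+ 2 + (2 ^+ k)^-1))).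
    apply: RI_le => //; first exact: (intgD (intgZ _ (iu _ _)) (intg_cst _)).
  rewrite RID; [|exact: (intgZ _ (iu _ _))|exact: intg_cst].
  rewrite RIZ ?RI_cst; last exact: iu.
  have := hN0 k (N k.+1) (N k) (leq_trans (N0N k) (NS k)) (N0N k).
  move=> /(ler_wpM2l (ltW (p2 k))); rewrite p4 invfM mulrA divff ?gt_eqF// mul1r.
  by lra.
have dfin : aeI (fun t => cvgn (series (fun k => d k t))).
  pose f t := (\sum_(k <oo) (d k t)%:E)%E.
  have mEd k : measurable_fun Iu (fun t => (d k t)%:E).
    by apply/measurable_EFinP; exact: md.
  have d0 k t : Iu t -> (0 <= (d k t)%:E)%E by move=> _; rewrite lee_fin normr_ge0.
  have f0 t : (0 <= f t)%E.
    by apply: nneseries_ge0 => k _ _; rewrite lee_fin normr_ge0.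
  have intf : (\int[@leb R]_(t in Iu) f t < +oo)%E.
    rewrite /f (integral_nneseries (@leb R) (@measurable_Iu R) mEd d0).
    apply: (@le_lt_trans _ _ 4%:E); last exact: ltry.
    apply: lime_le.
      by apply: is_cvg_nneseries => k _ _; apply: integral_ge0 => t; exact: d0.
    apply: nearW => n; rewrite (eq_bigr (fun k => (RI (d k))%:E)); last first.
      by move=> k _; rewrite EFin_RI.
    rewrite sumEFin lee_fin.
    apply: (@le_trans _ _ (\sum_(0 <= k < n) (2 * (2 ^+ k)^-1))).
      by apply: ler_sum => k _; exact: RId.
    suff -> : \sum_(0 <= k < n) (2 * (2 ^+ k)^-1) = 4 - 4 * (2 ^+ n)^-1 :> R.
      by rewrite gerBl mulr_ge0// invr_ge0 ltW.
    elim: n => [|n IH]; first by rewrite big_geq// expr0 invr1 mulr1 subrr.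
    by rewrite big_nat_recr//= IH exprS; field; rewrite gt_eqF.
  have : (@leb R).-integrable Iu f.
    apply/integrableP; split.
      have -> : f = fun t => (\sum_(k <oo | k \in xpredT) (d k t)%:E)%E.
        by apply/funext => t; apply: eq_eseriesl.
      by apply: ge0_emeasurable_sum => [k t It _|k _]; [exact: d0|exact: mEd].
    have -> : (\int[@leb R]_(t in Iu) `|f t| = \int[@leb R]_(t in Iu) f t)%E.
      by apply: eq_integral => t _; rewrite gee0_abs.
    exact: intf.
  move=> /(integrable_ae (@measurable_Iu R)) H; rewrite aeIE.
  apply: filterS H => t H It.
  have ft := H It.
  apply: nondecreasing_is_cvgn.
    by apply: nondecreasing_series => k _ _; exact: normr_ge0.
  exists (fine (f t)) => _ [n _ <-].
  rewrite -lee_fin fineK// /series /= -sumEFin.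
  by apply: nneseries_lim_ge => k _ _; exact: d0.
(* A finite part of a limsup is measurable without removing an exceptional set; where the
   telescoping series converges it is the limit. *)
pose v t := fine (limn_esup (fun k => (w k t)%:E)).
have mv : mI v.
  apply: (measurableT_comp (@fine_measurable R setT measurableT)).
  by apply: measurable_fun_limn_esup => k; apply/measurable_EFinP; exact: mu.
have wv : aeI (fun t => w k t @[k --> \oo] --> v t).
  apply: aeIS dfin _ => t _ /= cd.
  have cw : cvgn (w ^~ t).
    have ct : cvgn (series (telescope (w ^~ t))) by exact: normed_cvg.
    move/cvg_ex: ct => [l hl]; apply/cvg_ex; exists (w 0%N t + l).
    have -> : w ^~ t = (fun k => w 0%N t + series (telescope (w^~ t)) k).
      by apply/funext => k; rewrite {1}(eq_sum_telescope (w ^~ t) k).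
    by apply: cvgD; [exact: cvg_cst|exact: hl].
  move/cvg_ex: cw => [l wl].
  have wlE : (w k t)%:E @[k --> \oo] --> l%:E.
    by apply: cvg_EFin; [exact: nearW|exact: wl].
  by rewrite /v (cvg_limn_einf_sup wlE).2.
exists v => // e e0.
have [k ke] : exists k, (4 ^+ k)^-1 <= e.
  exists (Num.truncn e^-1).+1; set k := _.+1.
  rewrite invf_ple ?posrE ?exprn_gt0//; apply: le_trans (ltW (truncnS_gt _)) _.
  by rewrite -/k -natrX ler_nat ltnW// ltn_expl.
exists (N k) => n nN.
suff [] : intg (fun t => (u n t - v t) ^+ 2) /\
          RI (fun t => (u n t - v t) ^+ 2) <= (4 ^+ k)^-1.
  by move=> h1 h2; split => //; exact: le_trans ke.
(* Fatou in the second index turns the Cauchy estimate into an estimate for the distance to the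
   limit. *)
apply: (@RI_fatou _ (fun j t => (u n t - w (j + k)%N t) ^+ 2)).
- by move=> j; exact: iu.
- by move=> j t _; exact: sqr_ge0.
- by apply: mI_X; exact: mI_B.
- apply: aeIS wv _ => t _ h.
  have h' : w (j + k)%N t @[j --> \oo] --> v t by rewrite (cvg_shiftn k (w ^~ t)).
  have hB : u n t - w (j + k)%N t @[j --> \oo] --> u n t - v t.
    by apply: cvgB h'; exact: cvg_cst.
  by under eq_fun do rewrite expr2; rewrite expr2; exact: cvgM.
- move=> j; apply: hN0; first exact: leq_trans (N0N k) nN.
  by apply: leq_trans (N0N k) _; apply: Nmono; rewrite leq_addl.
Qed.

Lemma L2_complete (u : nat -> R -> C) : (forall n, isL2 (u n)) ->
  (forall e : R, 0 < e -> exists N, forall n m, (N <= n)%N -> (N <= m)%N ->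
     n2 (fun t => u n t - u m t) <= e) ->
  exists2 v, isL2 v & forall e : R, 0 < e -> exists N, forall n, (N <= n)%N ->
    n2 (fun t => u n t - v t) <= e.
Proof.
move=> Lu cau.
have Lnm n m := L2B (Lu n) (Lu m).
have mR n : mI (fun t => complex.Re (u n t)) by have [[]] := Lu n.
have mIm n : mI (fun t => complex.Im (u n t)) by have [[]] := Lu n.
have leR z : complex.Re z ^+ 2 <= cabs z ^+ 2 :> R by rewrite cabs_sqr lerDl sqr_ge0.
have leI z : complex.Im z ^+ 2 <= cabs z ^+ 2 :> R by rewrite cabs_sqr lerDr sqr_ge0.
have iR n m : intg (fun t => (complex.Re (u n t) - complex.Re (u m t)) ^+ 2).
  apply: intg_le (L2_intg (Lnm n m)) _; first by apply: mI_X; exact: mI_B.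
  by move=> t _; rewrite ger0_norm ?sqr_ge0// -ReN -ReD.
have iI n m : intg (fun t => (complex.Im (u n t) - complex.Im (u m t)) ^+ 2).
  apply: intg_le (L2_intg (Lnm n m)) _; first by apply: mI_X; exact: mI_B.
  by move=> t _; rewrite ger0_norm ?sqr_ge0// -ImN -ImD.
have [|v1 mv1 cv1] := @L2_complete_real (fun n t => complex.Re (u n t)) mR iR.
  move=> e e0; have [N hN] := cau e e0; exists N => n m nN mN.
  apply: le_trans (hN n m nN mN); apply: RI_le => //; first exact: L2_intg.
  by move=> t _; rewrite -ReN -ReD.
have [|v2 mv2 cv2] := @L2_complete_real (fun n t => complex.Im (u n t)) mIm iI.
  move=> e e0; have [N hN] := cau e e0; exists N => n m nN mN.
  apply: le_trans (hN n m nN mN); apply: RI_le => //; first exact: L2_intg.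
  by move=> t _; rewrite -ImN -ImD.
pose v t := Complex (v1 t) (v2 t).
have mv : cmeas v by [].
have sq n t : cabs (u n t - v t) ^+ 2 =
    (complex.Re (u n t) - v1 t) ^+ 2 + (complex.Im (u n t) - v2 t) ^+ 2.
  by rewrite cabs_sqr ReD ImD ReN ImN.
have key (e : R) : 0 < e -> exists N, forall n, (N <= n)%N ->
    isL2 (fun t => u n t - v t) /\ n2 (fun t => u n t - v t) <= e.
  move=> e0; have e20 : 0 < e / 2 by rewrite divr_gt0.
  have [N1 h1] := cv1 _ e20; have [N2 h2] := cv2 _ e20.
  exists (maxn N1 N2) => n; rewrite geq_max => /andP[n1 n2_].
  have [i1 r1] := h1 n n1; have [i2 r2] := h2 n n2_.
  split.
    split; first exact: cmeasB (L2_cmeas (Lu n)) mv.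
    by under eq_fun do rewrite sq; exact: intgD.
  by rewrite /n2; under RI_eq do rewrite sq; rewrite RID//; lra.
exists v; last first.
  by move=> e e0; have [N h] := key e e0; exists N => n /h[].
have [N h] := key 1 ltr01; have [Ld _] := h N (leqnn N).
have := L2B (Lu N) Ld; under eq_fun do rewrite opprB addrC subrK.
by [].
Qed.

End L2.

(** * H^2: Fourier series, density of polynomials and products *)

Section HardyTwo.
Variable R : realType.
Local Notation C := R[i].
Implicit Types (f g : R -> C) (c : nat -> C) (p q : {poly C}).

Lemma L1norm_le_n2 f : isL2 f -> L1norm f <= Num.sqrt (n2 f).
Proof.
move=> Lf; have := cauchy_schwarz Lf (L2_cst 1).
rewrite (_ : n2 (fun=> 1) = 1) ?sqrtr1 ?mulr1; last first.
  by rewrite /n2 cabs1 expr1n RI_cst.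
by under eq_fun do rewrite mulr1.
Qed.

Lemma eq_of_cabs_le (z w : C) : (forall e, 0 < e -> cabs (z - w) <= e) -> z = w.
Proof.
move=> H; apply/eqP; rewrite -subr_eq0 -cabs_eq0; apply/eqP/le_anti.
by rewrite cabs_ge0 andbT; apply/ler_addgt0Pl => e e0; rewrite addr0 H.
Qed.

Lemma fhat_lim f k (a : C) : isL1 f ->
  (forall e, 0 < e -> exists2 h, isL1 h &
     L1norm (fun t => f t - h t) <= e /\ fhat h k = a) -> fhat f k = a.
Proof.
move=> Lf H; apply: eq_of_cabs_le => e e0; have [h Lh [he <-]] := H e e0.
rewrite -fhatB//; apply: le_trans he; apply: cabs_fhat_le; exact: L1B.
Qed.

Lemma H1_L1 f : isH1 f -> isL1 f. Proof. by case. Qed.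

Lemma H1_closed f : isL1 f ->
  (forall e, 0 < e -> exists2 h, isH1 h & L1norm (fun t => f t - h t) <= e) ->
  isH1 f.
Proof.
move=> Lf H; split => // k k0; apply: fhat_lim => // e e0.
by have [h [Lh h0] he] := H e e0; exists h => //; split => //; exact: h0.
Qed.

Lemma H1D f g : isH1 f -> isH1 g -> isH1 (fun t => f t + g t).
Proof.
move=> [Lf f0] [Lg g0]; split; first exact: L1D.
by move=> k k0; rewrite fhatD// f0// g0// addr0.
Qed.

Lemma H1Z (a : C) f : isH1 f -> isH1 (fun t => a * f t).
Proof.
move=> [Lf f0]; split; first exact: L1Z.
by move=> k k0; rewrite fhatZ// f0// mulr0.
Qed.

Lemma H1B f g : isH1 f -> isH1 g -> isH1 (fun t => f t - g t).
Proof.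
move=> Hf Hg; have := H1D Hf (H1Z (-1) Hg).
by under eq_fun do rewrite mulN1r.
Qed.

Lemma H1_ae f g : isH1 f -> cmeas g -> aeI (fun t => g t = f t) -> isH1 g.
Proof.
move=> [Lf f0] mg h; split; first exact: L1_ae Lf mg h.
by move=> k k0; rewrite (fhat_ae k mg (L1_cmeas Lf) h) f0.
Qed.

Lemma H1_EM (n : nat) f : isH1 f -> isH1 (fun t => E n t * f t).
Proof.
move=> [Lf f0]; split; first exact: L1_EM.
move=> k k0; rewrite fhatEM f0// subr_lt0; exact: lt_le_trans k0 _.
Qed.

Definition pe p (t : R) : C := p.[E 1 t].

Lemma pe_poly c n t : pe (\poly_(j < n) c j) t = \sum_(0 <= j < n) c j * E j t.
Proof.
by rewrite /pe horner_poly big_mkord; apply: eq_bigr => j _; rewrite EX.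
Qed.

Lemma pe_bounded p : exists M, forall t, cabs (pe p t) <= M.
Proof.
elim/poly_ind: p => [|p a [M hM]].
  by exists 0 => t; rewrite /pe horner0 cabs0.
exists (M + cabs a) => t; rewrite /pe hornerMXaddC.
by apply: le_trans (cabsD _ _) _; rewrite cabsM cabsE mulr1 lerD2r; exact: hM.
Qed.

Lemma cmeas_pe p : cmeas (pe p).
Proof.
elim/poly_ind: p => [|p a IH].
  have -> : pe 0 = fun=> 0 by apply/funext => t; rewrite /pe horner0.
  exact: cmeas_cst.
have -> : pe (p * 'X + a%:P) = fun t => pe p t * E 1 t + a.
  by apply/funext => t; rewrite /pe hornerMXaddC.
by apply: cmeasD (cmeas_cst _); apply: cmeasM IH (cmeasE _ _).
Qed.

Lemma L2_pe p : isL2 (pe p).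
Proof.
by have [M hM] := pe_bounded p; apply: L2_bound_ae (cmeas_pe p) (aeI_all (fun t _ => hM t)).
Qed.

Lemma L1_peM p f : isL1 f -> isL1 (fun t => pe p t * f t).
Proof.
move=> Lf; have [M hM] := pe_bounded p.
exact: L1M_bound Lf (cmeas_pe p) (fun t _ => hM t).
Qed.

Lemma L2_peM p f : isL2 f -> isL2 (fun t => pe p t * f t).
Proof.
move=> Lf; have [M hM] := pe_bounded p.
exact: L2M_bound_ae Lf (cmeas_pe p) (aeI_all (fun t _ => hM t)).
Qed.

Lemma H1_peM p f : isH1 f ->
  isH1 (fun t => pe p t * f t) /\ fhat (fun t => pe p t * f t) 0 = p.[0] * fhat f 0.
Proof.
move=> Hf; elim/poly_ind: p => [|p a [IH _]].
  have -> : (fun t => pe 0 t * f t) = fun t => 0 * f t.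
    by apply/funext => t; rewrite /pe horner0.
  by split; [exact: H1Z|rewrite fhatZ ?horner0//; exact: H1_L1].
have -> : (fun t => pe (p * 'X + a%:P) t * f t) =
    fun t => E 1 t * (pe p t * f t) + a * f t.
  by apply/funext => t; rewrite /pe hornerMXaddC mulrDl [_ * E 1 t]mulrC mulrA.
split; first by apply: H1D (H1Z _ Hf); exact: (H1_EM 1).
rewrite fhatD; [|exact/L1_EM/H1_L1|exact/L1Z/H1_L1].
rewrite fhatEM (IH.2 _ _)// add0r fhatZ; last exact: H1_L1.
by rewrite hornerMXaddC mulr0 add0r.
Qed.

Definition isH2 f : Prop := isL2 f /\ forall k : int, k < 0 -> fhat f k = 0.

Lemma H2_H1 f : isH2 f -> isH1 f.
Proof. by move=> [/L2_L1]. Qed.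

Lemma H2_L2 f : isH2 f -> isL2 f. Proof. by case. Qed.

Lemma fhat_sumE c n m k : fhat (fun t => \sum_(n <= j < m) c j * E j t) k =
  \sum_(n <= j < m) c j * (k == j%:Z)%:R.
Proof.
rewrite fhat_sum => [|j]; last exact/L1Z/L1E.
by apply: eq_bigr => j _; rewrite fhatZ ?fhat_E//; exact: L1E.
Qed.

Lemma fhat_sumE_nat c n (k : nat) :
  fhat (fun t => \sum_(0 <= j < n) c j * E j t) k = (k < n)%N%:R * c k.
Proof.
rewrite fhat_sumE; elim: n => [|n IH]; first by rewrite big_geq// mul0r.
rewrite big_nat_recr//= IH eqz_nat.
have [->|kn] := eqVneq k n; first by rewrite ltnn ltnSn mul0r add0r mulr1 mul1r.
by rewrite mulr0 addr0 [in RHS]ltnS [in RHS]leq_eqVlt (negbTE kn).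
Qed.

Lemma fhat_sumE_neg c n (k : int) : k < 0 ->
  fhat (fun t => \sum_(0 <= j < n) c j * E j t) k = 0.
Proof.
move=> k0; rewrite fhat_sumE big1// => j _.
by case: eqP => [e|]; rewrite ?mulr0//; move: k0; rewrite e.
Qed.

Lemma L2_sumE c n m : isL2 (fun t => \sum_(n <= j < m) c j * E j t).
Proof.
elim: m => [|m IH]; first by under eq_fun do rewrite big_geq//; exact: L2_cst.
have [nm|mn] := leqP n m; last by under eq_fun do rewrite big_geq//; exact: L2_cst.
under eq_fun do rewrite big_nat_recr//=.
by apply: L2D => //; apply: L2Z; exact: L2E.
Qed.

Lemma n2_addZE f (a : C) (k : int) : isL2 f ->
  n2 (fun t => f t + a * E k t) = n2 f + cabs a ^+ 2 + 2 * complex.Re (a^*%C * fhat f k).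
Proof.
move=> Lf; have LE : isL2 (fun t => a * E k t) by apply: L2Z; exact: L2E.
rewrite n2D//; congr (_ + _ + 2 * complex.Re _).
  rewrite /n2 (RI_eq (g := fun=> cabs a ^+ 2)) ?RI_cst// => t _.
  by rewrite cabsM cabsE mulr1.
rewrite fhatE -cintZ; last exact/L1_EM/L2_L1.
by apply: cint_eq => t _; rewrite conjM EN; ring.
Qed.

Lemma n2_sumE c n m : n2 (fun t => \sum_(n <= j < m) c j * E j t) =
  \sum_(n <= j < m) cabs (c j) ^+ 2.
Proof.
have n20 : @n2 R (fun=> 0) = 0 by rewrite /n2 cabs0 expr0n RI_cst.
elim: m => [|m IH]; first by under eq_fun do rewrite big_geq//; rewrite big_geq.
have [nm|mn] := leqP n m; last first.
  by under eq_fun do rewrite big_geq//; rewrite big_geq.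
under eq_fun do rewrite big_nat_recr//=.
rewrite n2_addZE; last exact: L2_sumE.
rewrite IH big_nat_recr// fhat_sumE.
have -> : \sum_(n <= j < m) c j * (m%:Z == j%:Z)%:R = 0.
  rewrite big_nat_cond big1// => j /andP[/andP[_ jm] _].
  by rewrite eqz_nat gtn_eqF// mulr0.
by rewrite !mulr0 addr0.
Qed.

Lemma bessel f n : isL2 f ->
  n2 (fun t => f t - \sum_(0 <= j < n) fhat f j * E j t) =
  n2 f - \sum_(0 <= j < n) cabs (fhat f j) ^+ 2.
Proof.
move=> Lf; elim: n => [|n IH].
  by rewrite big_geq// subr0; under eq_fun do rewrite big_geq// subr0.
have Lr : isL2 (fun t => f t - \sum_(0 <= j < n) fhat f j * E j t).
  by apply: L2B => //; exact: L2_sumE.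
have -> : (fun t => f t - \sum_(0 <= j < n.+1) fhat f j * E j t) = fun t =>
    (f t - \sum_(0 <= j < n) fhat f j * E j t) + (- fhat f n) * E n t.
  by apply/funext => t; rewrite big_nat_recr//=; ring.
rewrite n2_addZE// IH fhatB; [|exact: L2_L1|exact/L2_L1/L2_sumE].
rewrite fhat_sumE_nat ltnn mul0r subr0 cabsN big_nat_recr//.
have -> : (- fhat f n)^*%C * fhat f n = - (cabs (fhat f n) ^+ 2)%:C%C.
  by rewrite -mulcC rmorphN mulNr mulrC.
by rewrite ReN /=; ring.
Qed.

(** Serves twice: with [c] the coefficients of a given function it yields density of polynomials,
    and with [c] a limit of coefficients it yields weak compactness. *)
Lemma riesz_fischer c B : (forall n, \sum_(0 <= j < n) cabs (c j) ^+ 2 <= B) ->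
  exists g, [/\ isH2 g, forall j : nat, fhat g j = c j, n2 g <= B &
    forall e : R, 0 < e -> exists n,
      n2 (fun t => g t - \sum_(0 <= j < n) c j * E j t) <= e].
Proof.
move=> hB; pose S n t := \sum_(0 <= j < n) c j * E j t.
pose s n := \sum_(0 <= j < n) cabs (c j) ^+ 2.
have snd : nondecreasing_seq s.
  by apply/nondecreasing_seqP => n; rewrite /s big_nat_recr//= lerDl sqr_ge0.
have scvg : cvgn s.
  by apply: nondecreasing_is_cvgn => //; exists B => _ [n _ <-]; exact: hB.
have cauchyS m n N : (N <= n)%N -> (n <= m)%N ->
    n2 (fun t => S m t - S n t) <= limn s - s N.
  move=> Nn nm.
  have -> : (fun t => S m t - S n t) = fun t => \sum_(n <= j < m) c j * E j t.
    by apply/funext => t; rewrite /S (big_cat_nat (leq0n n) nm)/= addrAC subrr add0r.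
  rewrite n2_sumE.
  have -> : \sum_(n <= j < m) cabs (c j) ^+ 2 = s m - s n.
    by rewrite /s (big_cat_nat (leq0n n) nm)/= addrAC subrr add0r.
  by rewrite lerB//; [exact: nondecreasing_cvgn_le|exact: snd].
have [|g Lg hg] := @L2_complete R S (fun n => L2_sumE _ _ _).
  move=> e e0; have /cvgrPdist_le /(_ e e0) [N _ hN] := scvg.
  exists N => n m Nn Nm.
  have sN : limn s - s N <= e by apply: le_trans (ler_norm _) _; exact: (hN N (leqnn N)).
  apply: le_trans sN.
  have [nm|mn] := leqP n m; last by apply: cauchyS => //; exact: ltnW.
  by rewrite n2_distC; exact: cauchyS.
have appr (e : R) : 0 < e -> exists N, forall n, (N <= n)%N ->
    L1norm (fun t => g t - S n t) <= e.
  move=> e0; have [N hN] := hg _ (exprn_gt0 2 e0); exists N => n Nn.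
  apply: le_trans (L1norm_le_n2 (L2B Lg (L2_sumE _ _ _))) _.
  by rewrite n2_distC -(ger0_norm (ltW e0)) -sqrtr_sqr ler_wsqrtr// hN.
have LS n : isL1 (S n) by apply: L2_L1; exact: L2_sumE.
have gj (j : nat) : fhat g j = c j.
  apply: fhat_lim; [exact: L2_L1|move=> e e0].
  have [N hN] := appr e e0; exists (S (maxn N j.+1)) => //; split.
    by apply: hN; rewrite leq_maxl.
  by rewrite fhat_sumE_nat leq_max leqnn orbT mul1r.
have gneg (k : int) : k < 0 -> fhat g k = 0.
  move=> k0; apply: fhat_lim; [exact: L2_L1|move=> e e0].
  have [N hN] := appr e e0; exists (S N) => //; split; first exact: hN.
  exact: fhat_sumE_neg.
exists g; split => //.
  apply/ler_addgt0Pl => e e0; have [N hN] := hg e e0.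
  have := bessel N Lg; have := hN N (leqnn N); rewrite n2_distC.
  under eq_bigr do rewrite gj.
  have -> : n2 (fun t => g t - S N t) =
      n2 (fun t => g t - \sum_(0 <= j < N) fhat g j * E j t).
    by apply: RI_eq => t _; congr (cabs (_ - _) ^+ 2); apply: eq_bigr => j _; rewrite gj.
  by move=> h1 h2; have := hB N; lra.
by move=> e e0; have [N hN] := hg e e0; exists N; rewrite n2_distC; exact: hN.
Qed.

(** The series built from the coefficients of [f] converges in L^2, and by uniqueness of Fourier
    coefficients its sum is [f]. *)
Lemma H2_approx f : isH2 f -> forall e : R, 0 < e ->
  exists p, n2 (fun t => f t - pe p t) <= e.
Proof.
move=> [Lf f0] e e0.
have [n|g [[Lg g0] gj _ ga]] := @riesz_fischer (fun j => fhat f j) (n2 f).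
  by have := bessel n Lf; have := n2_ge0 (fun t => f t - \sum_(0 <= j < n) fhat f j * E j t); lra.
have fg : aeI (fun t => f t = g t).
  apply: fhat_ae_eq; [exact: L2_L1..|case=> n; first by rewrite gj].
  by rewrite f0// g0.
have [n hn] := ga e e0; exists (\poly_(j < n) fhat f j).
apply: le_trans hn; rewrite le_eqVlt; apply/orP; left; apply/eqP.
apply: n2_ae; [exact: L2_cmeas (L2B Lf (L2_pe _))
  |exact: L2_cmeas (L2B Lg (L2_sumE _ _ _))|].
by apply: aeIS fg _ => t _ ->; rewrite pe_poly.
Qed.

(** The claim holds when [f] is a polynomial; Cauchy-Schwarz makes the product continuous in [f],
    and H^1 is closed in L^1. *)
Lemma H2M_H1 f g : isH2 f -> isH2 g -> isH1 (fun t => f t * g t).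
Proof.
move=> Hf Hg; have Lf := H2_L2 Hf; have Lg := H2_L2 Hg.
apply: H1_closed; first exact: L2M_L1.
move=> e e0; have g0 := n2_ge0 g.
have d0 : 0 < e ^+ 2 / (n2 g + 1) by rewrite divr_gt0 ?exprn_gt0// ltr_wpDl.
have [p hp] := H2_approx Hf d0.
exists (fun t => pe p t * g t); first exact: (H1_peM p (H2_H1 Hg)).1.
under eq_fun do rewrite -mulrBl.
apply: le_trans (cauchy_schwarz (L2B Lf (L2_pe p)) Lg) _.
rewrite -sqrtrM ?n2_ge0// -(ger0_norm (ltW e0)) -sqrtr_sqr ler_wsqrtr//.
apply: le_trans (ler_wpM2r g0 hp) _.
by rewrite mulrAC ler_pdivrMr ?ltr_wpDl// ler_pM2l ?exprn_gt0// lerDl.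
Qed.

(* Subtracting the Taylor polynomial of degree [n] leaves a multiple of
   [zeta^(n+1)], whose product with [g] does not contribute to the [n]-th coefficient. *)
Lemma fhat_conv_tail f g (n : nat) : isL1 f -> isL1 g -> isL1 (fun t => f t * g t) ->
  fhat (fun t => E (- n.+1%:Z) t *
    (f t - \sum_(0 <= j < n.+1) fhat f j * E j t) * g t) (-1) = 0 ->
  fhat (fun t => f t * g t) n =
  \sum_(0 <= j < n.+1) fhat f j * fhat g (n%:Z - j%:Z).
Proof.
move=> Lf Lg Lfg; set S := fun t => _.
have LSg : isL1 (fun t => \sum_(0 <= j < n.+1) fhat f j * E j t * g t).
  by apply: L1_sum => j; exact: L1_ZEM.
have -> : fhat (fun t => E (- n.+1%:Z) t *
    (f t - \sum_(0 <= j < n.+1) fhat f j * E j t) * g t) (-1) =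
    fhat (fun t => f t * g t - \sum_(0 <= j < n.+1) fhat f j * E j t * g t) n.
  have -> : n%:Z = -1 - (- n.+1%:Z) :> int by rewrite opprK -addn1 PoszD; ring.
  rewrite -fhatEM; apply: fhat_eq => t.
  by rewrite -mulrA mulrBl mulr_suml.
rewrite fhatB// => /eqP; rewrite subr_eq0 => /eqP ->.
rewrite fhat_sum => [|j]; last exact: L1_ZEM.
apply: eq_bigr => j _; rewrite -fhatEM -fhatZ; last exact: L1_EM.
by apply: fhat_eq => t; rewrite mulrA.
Qed.

Lemma fhat_tail_neg f (n : nat) (k : int) : isH1 f -> k < 0 ->
  fhat (fun t => E (- n.+1%:Z) t *
    (f t - \sum_(0 <= j < n.+1) fhat f j * E j t)) k = 0.
Proof.
move=> [Lf f0] k0; rewrite fhatEM opprK fhatB//; last exact/L2_L1/L2_sumE.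
have [kn|kn] := ltP (k + n.+1%:Z) 0; first by rewrite f0// fhat_sumE_neg// subrr.
have [m e] : exists m : nat, k + n.+1%:Z = m by case: (k + _) kn => // m; exists m.
rewrite e fhat_sumE_nat (_ : (m < n.+1)%N) ?mul1r ?subrr//.
by rewrite -ltz_nat -e gtrDr.
Qed.

Lemma fhat_convH2 f g (n : nat) : isH2 f -> isH2 g ->
  fhat (fun t => f t * g t) n = \sum_(0 <= j < n.+1) fhat f j * fhat g (n%:Z - j%:Z).
Proof.
move=> Hf Hg; apply: fhat_conv_tail.
- exact/H1_L1/H2_H1.
- exact/H1_L1/H2_H1.
- exact: H1_L1 (H2M_H1 Hf Hg).
- apply: (H2M_H1 _ Hg).2 => //; split.
    by apply/L2_EM/L2B; [exact: H2_L2|exact: L2_sumE].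
  by move=> k; apply: fhat_tail_neg; exact: H2_H1.
Qed.

Lemma H2_EM (n : nat) f : isH2 f -> isH2 (fun t => E n t * f t).
Proof. by move=> Hf; split; [exact/L2_EM/H2_L2|exact: (H1_EM n (H2_H1 Hf)).2]. Qed.

Lemma H2Z (a : C) f : isH2 f -> isH2 (fun t => a * f t).
Proof. by move=> Hf; split; [exact/L2Z/H2_L2|exact: (H1Z a (H2_H1 Hf)).2]. Qed.

Lemma H2_cst (a : C) : isH2 (fun=> a).
Proof.
split; first exact: L2_cst.
move=> k k0; have := fhat_sumE_neg (fun=> a) 1 k0.
by under eq_fun do rewrite big_nat1 E0 mulr1.
Qed.

End HardyTwo.

(** * Szegő's extremal problem *)

Section Szego.
Variable R : realType.
Local Notation C := R[i].
Implicit Types (p q r : {poly C}).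

Variable F : R -> C.
Hypothesis HF : isH1 F.
Hypothesis F0 : fhat F 0 != 0.

(** The weight is split as F = [sig] s = [kap] s^2, with [kap] the phase of F; since 0^-1 = 0, both
    [sig] and [kap] vanish where F does. [W] embeds polynomials into L^2 so that [n2 (W p)] is the
    norm of p with weight |F|, and p^2 F is [kap] times the square of [W p]. *)
Let s t : R := Num.sqrt (cabs (F t)).
Let sig t : C := F t * ((s t)^-1)%:C%C.
Let kap t : C := sig t * ((s t)^-1)%:C%C.
Let W p t : C := pe p t * (s t)%:C%C.

Let s_ge0 t : 0 <= s t. Proof. exact: sqrtr_ge0. Qed.

Let s_sqr t : s t ^+ 2 = cabs (F t).
Proof. by rewrite sqr_sqrtr ?cabs_ge0. Qed.

Let s_eq0 t : s t = 0 -> F t = 0.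
Proof.
by move=> h; apply/eqP; rewrite -cabs_eq0 -s_sqr h expr0n.
Qed.

Let sigs t : sig t * (s t)%:C%C = F t.
Proof.
rewrite /sig -mulrA -rmorphM /=; have [/s_eq0 ->|s0] := eqVneq (s t) 0.
  by rewrite mul0r.
by rewrite mulVf// mulr1.
Qed.

Let kaps t : kap t * (s t)%:C%C = sig t.
Proof.
rewrite /kap -mulrA -rmorphM /=; have [/s_eq0 e|s0] := eqVneq (s t) 0.
  by rewrite /sig e !mul0r.
by rewrite mulVf// mulr1.
Qed.

Let cabs_sig t : cabs (sig t) = s t.
Proof.
rewrite /sig cabsM cabs_real -s_sqr ger0_norm ?invr_ge0//.
have [->|s0] := eqVneq (s t) 0; first by rewrite invr0 mulr0.
by rewrite expr2 -mulrA divff// mulr1.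
Qed.

Let cabs_kap t : cabs (kap t) = (s t != 0)%:R.
Proof.
rewrite /kap cabsM cabs_sig cabs_real ger0_norm ?invr_ge0//.
have [->|s0] := eqVneq (s t) 0; first by rewrite mul0r.
by rewrite divff.
Qed.

Let mF : cmeas F. Proof. exact/L1_cmeas/H1_L1. Qed.

Let ms : mI s.
Proof. by apply: mI_sqrt => [t|]; [exact: cabs_ge0|exact: mI_cabs]. Qed.

Let msV : cmeas (fun t => ((s t)^-1)%:C%C).
Proof. by apply: cmeas_real; exact: mI_inv. Qed.

Let mkap : cmeas kap. Proof. exact: (cmeasM (cmeasM mF msV) msV). Qed.

Let L2s : isL2 (fun t => (s t)%:C%C).
Proof.
apply: L2_le (L1_intg (H1_L1 HF)) _; first exact: cmeas_real.
by move=> t _; rewrite cabs_real real_normK ?num_real// s_sqr.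
Qed.

Let L2sig : isL2 sig.
Proof.
apply: L2_le (L1_intg (H1_L1 HF)) _; first exact: (cmeasM mF msV).
by move=> t _; rewrite cabs_sig s_sqr.
Qed.

Let LW p : isL2 (W p). Proof. exact: L2_peM. Qed.

Let WD p q t : W (p + q) t = W p t + W q t.
Proof. by rewrite /W /pe hornerD mulrDl. Qed.

Let WB p q t : W (p - q) t = W p t - W q t.
Proof. by rewrite /W /pe hornerD hornerN mulrBl. Qed.

Let WZ (c : C) p t : W (c *: p) t = c * W p t.
Proof. by rewrite /W /pe hornerZ mulrA. Qed.

Let WX m p t : W ('X^m * p) t = E m t * W p t.
Proof. by rewrite /W /pe hornerM hornerXn EX mulrA. Qed.

(** When p(0) = 1 the function p^2 F has the same mean as F, and its L^1 norm is the weighted norm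
    of p. This keeps the infimum away from zero. *)
Let cabs_F0_le p : p.[0] = 1 -> cabs (fhat F 0) <= n2 (W p).
Proof.
move=> p0; have [H h] := H1_peM (p * p) HF.
have -> : fhat F 0 = fhat (fun t => pe (p * p) t * F t) 0.
  by rewrite h hornerM p0 !mul1r.
apply: le_trans (cabs_fhat_le _ (H1_L1 H)) _.
rewrite le_eqVlt; apply/orP; left; apply/eqP; rewrite L1normE.
apply: RI_eq => t _; rewrite /W /pe hornerM !cabsM cabs_real exprMn.
by rewrite real_normK ?num_real// s_sqr.
Qed.

Let JS : set R := [set n2 (W p) | p in [set p | p.[0] = 1]].
Let A := inf JS.

Let JS_has_inf : has_inf JS.
Proof.
split; first by exists (n2 (W 1)); exists 1 => //=; rewrite hornerC.
by exists (cabs (fhat F 0)) => _ [p /= p0 <-]; exact: cabs_F0_le.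
Qed.

Let A_gt0 : 0 < A.
Proof.
apply: (@lt_le_trans _ _ (cabs (fhat F 0))); first by rewrite cabs_gt0.
apply: lb_le_inf; first exact: JS_has_inf.1.
by move=> _ [p /= p0 <-]; exact: cabs_F0_le.
Qed.

Let A_le p : p.[0] = 1 -> A <= n2 (W p).
Proof. by move=> p0; apply: ge_inf; [exact: JS_has_inf.2|exists p]. Qed.

Let minimizing : exists (P : nat -> {poly C}) (d : nat -> R),
  [/\ forall n, (P n).[0] = 1, forall n, n2 (W (P n)) <= A + d n,
      forall n, d n <= 1 &
      forall e : R, 0 < e -> exists N, forall n, (N <= n)%N -> d n <= e].
Proof.
have H n : exists p, p.[0] = 1 /\ n2 (W p) <= A + n.+1%:R^-1.
  have n0 : 0 < n.+1%:R^-1 :> R by rewrite invr_gt0 ltr0n.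
  have [_ [p /= p0 <-] h] := inf_adherent n0 JS_has_inf.
  by exists p; split => //; exact: ltW.
have [P hP] := boolp.choice H.
exists P, (fun n => n.+1%:R^-1); split => [n|n|n|e e0].
- by have [] := hP n.
- by have [] := hP n.
- by rewrite invf_le1 ?ltr0n// ler1n.
- exists (Num.truncn e^-1).+1 => n Nn.
  rewrite invf_ple ?posrE ?ltr0n//; apply: le_trans (ltW (truncnS_gt _)) _.
  by rewrite ler_nat (leq_trans Nn).
Qed.

(** The midpoint of [p] and [q] is admissible, so the parallelogram law makes minimizing sequences
    Cauchy. *)
Let dist_minimizers p q : p.[0] = 1 -> q.[0] = 1 ->
  n2 (fun t => W p t - W q t) <= 2 * (n2 (W p) - A) + 2 * (n2 (W q) - A).
Proof.
move=> p0 q0; have := parallelogram (LW p) (LW q).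
have -> : n2 (fun t => W p t + W q t) = 4 * n2 (W (2^-1 *: (p + q))).
  have -> : n2 (fun t => W p t + W q t) =
      n2 (fun t => 2 * W (2^-1 *: (p + q)) t).
    by apply: RI_eq => t _; rewrite WZ WD mulrA divff ?mul1r// pnatr_eq0.
  rewrite n2Z//; congr (_ * _).
  by rewrite (_ : 2 = (2 : R)%:C%C) ?cabs_real ?rmorph_nat// ger0_norm//; ring.
have : A <= n2 (W (2^-1 *: (p + q))).
  apply: A_le; rewrite hornerZ hornerD p0 q0.
  by rewrite -[1 + 1]/(2%:R) mulVf// pnatr_eq0.
by lra.
Qed.

(** Let V be the L^2 limit of p_n s along a minimizing sequence. Then a is the limit of p_n F, U the
    limit of p_n^2 F, and b = s conj(V); the constant [A] of the conclusion is the square norm of V.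
    Minimality makes V orthogonal to r s whenever r(0) = 0. With r a power of z this puts b in H^2;
    with r = z^m p_n and m > 0 it makes |V|^2 constant, whence the pointwise identities. *)
Lemma szego_factorization : exists (A : R) (a b U : R -> C),
  [/\ 0 < A, isH2 a, isH2 b & isH1 U] /\
  [/\ fhat b 0 = A%:C%C,
      forall e : R, 0 < e -> exists2 p, p.[0] = 1 &
        L1norm (fun t => U t - pe (p * p) t * F t) <= e &
      aeI (fun t => F t != 0 /\
        [/\ cabs (a t) ^+ 2 = A * cabs (F t), cabs (b t) ^+ 2 = A * cabs (F t),
            a t * b t = A%:C%C * F t, cabs (U t) = A & U t * b t = A%:C%C * a t])].
Proof.
have [P [d [P0 PA d1 invn]]] := minimizing.
have [|V LV hV] := @L2_complete R (fun n => W (P n)) (fun n => LW _).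
  move=> e e0; have [N hN] := invn (e / 4) (divr_gt0 e0 (ltr0n _ 4)).
  exists N => n m Nn Nm; apply: le_trans (dist_minimizers (P0 n) (P0 m)) _.
  by have := PA n; have := PA m; have := hN n Nn; have := hN m Nm; lra.
have LVP n : isL2 (fun t => V t - W (P n) t) by exact: L2B.
pose B := n2 V.
have appr (e : R) : 0 < e -> exists n,
    n2 (fun t => V t - W (P n) t) <= e /\ d n <= e.
  move=> e0; have [N hN] := hV e e0; have [M hM] := invn e e0.
  exists (maxn N M); rewrite n2_distC hN ?leq_maxl//; split => //.
  by apply: hM; exact: leq_maxr.
have B0 : 0 < B.
  (* An approximation within A / 4 gives A <= 2 B + A / 2, which excludes B = 0. *)
  have A4 : 0 < A / 4 by rewrite divr_gt0.
  have [n [hn _]] := appr _ A4; have := A_le (P0 n).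
  have := n2D_le (LVP n) LV; rewrite -/B.
  have -> : n2 (fun t => V t - W (P n) t + V t) = n2 (fun t => V t + (V t - W (P n) t)).
    by apply: RI_eq => t _; rewrite addrC.
  have := n2D_le LV (L2N (LVP n)).
  have -> : n2 (fun t => V t + - (V t - W (P n) t)) = n2 (W (P n)).
    by apply: RI_eq => t _; rewrite opprB addrC subrK.
  have -> : n2 (fun t => - (V t - W (P n) t)) = n2 (fun t => V t - W (P n) t).
    by apply: RI_eq => t _; rewrite cabsN.
  by rewrite -/B; lra.
have small (x : C) (K : R) : 0 <= K ->
    (forall e : R, 0 < e -> cabs x ^+ 2 <= K * e) -> x = 0.
  move=> K0 H; apply/eqP; rewrite -cabs_eq0 -sqrf_eq0; apply/eqP/le_anti.
  rewrite sqr_ge0 andbT; apply/ler_addgt0Pl => e e0; rewrite addr0.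
  have K1 : 0 < K + 1 by rewrite ltr_wpDl.
  apply: le_trans (H (e / (K + 1)) (divr_gt0 e0 K1)) _.
  by rewrite mulrA ler_pdivrMr// mulrC ler_pM2l// lerDl.
have orth r : r.[0] = 0 -> cint (fun t => V t * (W r t)^*%C) = 0.
  move=> r0; pose K := n2 (W r) + 1.
  have K0 : 0 < K by rewrite ltr_wpDl ?n2_ge0.
  apply: (small _ (4 * K)); first by rewrite mulr_ge0// ltW.
  move=> e e0; have [n [hn ne]] := appr e e0.
  pose x := cint (fun t => W (P n) t * (W r t)^*%C).
  have hx : cabs x ^+ 2 <= d n * K.
    (* Adding c r to [P n] lowers the weighted norm by at least |x|^2 / K, which near-minimality
       bounds by [d n]. The added 1 keeps [K] invertible. *)
    pose c : C := - (K^-1)%:C%C * x.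
    have : A <= n2 (fun t => W (P n) t + c * W r t).
      have -> : n2 (fun t => W (P n) t + c * W r t) = n2 (W (P n + c *: r)).
        by apply: RI_eq => t _; rewrite WD WZ.
      by apply: A_le; rewrite hornerD hornerZ P0 r0 mulr0 addr0.
    rewrite n2D//; last exact: L2Z.
    rewrite n2Z// /c cabsM cabsN cabs_real ger0_norm ?invr_ge0 ?(ltW K0)// exprMn.
    have -> : cint (fun t => W (P n) t * (- (K^-1)%:C%C * x * W r t)^*%C) =
        - (K^-1 * cabs x ^+ 2)%:C%C.
      rewrite (cint_eq (g := fun t => (- (K^-1)%:C%C * x)^*%C *
        (W (P n) t * (W r t)^*%C))); last first.
        by move=> t _; rewrite conjM mulrCA.
      rewrite cintZ; last exact: L2M_L1 (LW _) (L2J (LW _)).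
      rewrite -/x conjM conjN conjc_real mulNr mulNr.
      by rewrite -mulrA [x^*%C * x]mulrC mulcC -rmorphM.
    rewrite ReN /= => h.
    have Kx : K^-1 * cabs x ^+ 2 <= d n.
      have : K^-1 ^+ 2 * cabs x ^+ 2 * n2 (W r) <= K^-1 * cabs x ^+ 2.
        have -> : K^-1 ^+ 2 * cabs x ^+ 2 * n2 (W r) =
           K^-1 * cabs x ^+ 2 * (n2 (W r) / K) by field; rewrite gt_eqF.
        apply: ler_piMr; last by rewrite ler_pdivrMr// mul1r lerDl.
        by apply: mulr_ge0; [rewrite invr_ge0; exact: ltW|exact: sqr_ge0].
      by have := PA n; lra.
    by rewrite -ler_pdivrMr// mulrC.
  have -> : cint (fun t => V t * (W r t)^*%C) =
      cint (fun t => (V t - W (P n) t) * (W r t)^*%C) + x.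
    rewrite /x -cintD; [|exact: L2M_L1 (LVP n) (L2J (LW _))|exact: L2M_L1 (LW _) (L2J (LW _))].
    by apply: cint_eq => t _; rewrite -mulrDl subrK.
  have h1 := cabs_dot_le (LVP n) (LW r).
  set y := cint _ in h1 *.
  have h2 : cabs (y + x) ^+ 2 <= 2 * cabs y ^+ 2 + 2 * cabs x ^+ 2.
    have := cabsD y x; have := sqr_ge0 (cabs y - cabs x).
    by have := cabs_ge0 (y + x); nra.
  have h3 : n2 (fun t => V t - W (P n) t) * n2 (W r) <= K * e.
    rewrite mulrC; apply: ler_pM => //; rewrite ?n2_ge0//.
    by rewrite lerDl.
  have h4 : d n * K <= K * e by rewrite mulrC ler_pM2l.
  by lra.
have dotV f : isL2 f -> (forall n, cint (fun t => f t * (W (P n) t)^*%C) = 0) ->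
    cint (fun t => f t * (V t)^*%C) = 0.
  move=> Lf H; apply: (small _ (n2 f)); first exact: n2_ge0.
  move=> e e0; have [n [hn _]] := appr e e0.
  have -> : cint (fun t => f t * (V t)^*%C) =
      cint (fun t => f t * (V t - W (P n) t)^*%C).
    rewrite -[LHS]subr0 -(H n) -cintB; [|exact: L2M_L1 Lf (L2J _)..].
    by apply: cint_eq => t _; rewrite conjB mulrBr.
  by apply: le_trans (cabs_dot_le Lf (LVP n)) _; rewrite ler_wpM2l ?n2_ge0.
have V2 : aeI (fun t => cabs (V t) ^+ 2 = B).
  have Lh : isL1 (fun t => (cabs (V t) ^+ 2)%:C%C).
    by have := L2M_L1 LV (L2J LV); under eq_fun do rewrite mulcC.
  (* The coefficient of index m + 1 is the inner product of V with ζ^(m+1) V, the limit of z^(m+1)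
     p_n s, and the polynomial z^(m+1) p_n vanishes at 0. *)
  have hpos (m : nat) : fhat (fun t => (cabs (V t) ^+ 2)%:C%C) m.+1 = 0.
    have H := dotV (fun t => E (- m.+1%:Z) t * V t) (L2_EM _ LV) _.
    rewrite fhatE -H => [|n].
      by apply: cint_eq => t _; rewrite -mulcC mulrA.
    rewrite -(orth ('X^(m.+1) * P n)); last first.
      by rewrite hornerM hornerXn expr0n mul0r.
    by apply: cint_eq => t _; rewrite WX [(E _ _ * _)^*%C]conjM -EN mulrA [V t * _]mulrC.
  have H : aeI (fun t => (cabs (V t) ^+ 2)%:C%C = B%:C%C).
    apply: fhat_ae_eq => //; first exact: L1_cst.
    have fc (k : int) : fhat (fun=> B%:C%C) k = (k == 0)%:R * B%:C%C.
      rewrite -fhat_E mulrC -fhatZ; last exact: L1E.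
      by apply: fhat_eq => t; rewrite E0 mulr1.
    have hneg (m : nat) : fhat (fun t => (cabs (V t) ^+ 2)%:C%C) (- m.+1%:Z) = 0.
      have := fhatJ (- m.+1%:Z) Lh; rewrite opprK hpos conjc0 => <-.
      by apply: fhat_eq => t; rewrite conjc_real.
    case=> [[|m]|m]; rewrite fc ?NegzE.
    - rewrite eqxx mul1r /B n2_cint fhatE; apply: cint_eq => t _.
      by rewrite oppr0 E0 mul1r mulcC.
    - by rewrite hpos mul0r.
    - by rewrite hneg mul0r.
  by apply: aeIS H _ => t _ [].
have F0ae : aeI (fun t => s t != 0).
  (* The indicator of the zero set of F. Every [W (P n)] vanishes there, hence so does V almost
     everywhere, against |V|^2 = B > 0. *)
  pose w t : C := (1 - cabs (kap t))%:C%C.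
  have mw : cmeas w by apply: cmeas_real; apply: mI_B (mI_cst _) (mI_cabs _).
  have w1 t : cabs (w t) <= 1.
    by rewrite /w cabs_real cabs_kap; case: (s t != 0); rewrite ?subrr ?subr0 ?normr0 ?normr1.
  have Lw f : isL2 f -> isL2 (fun t => w t * f t).
    by move=> Lf; exact: L2M_bound_ae Lf mw (aeI_all (fun t _ => w1 t)).
  have n0 : n2 (fun t => w t * V t) = 0.
    apply/le_anti; rewrite n2_ge0 andbT; apply/ler_addgt0Pl => e e0; rewrite addr0.
    have [n [hn _]] := appr e e0; apply: le_trans hn.
    have -> : n2 (fun t => w t * V t) = n2 (fun t => w t * (V t - W (P n) t)).
      apply: RI_eq => t _; rewrite mulrBr; suff -> : w t * W (P n) t = 0 by rewrite subr0.
      rewrite /w cabs_kap /W; have [->|_] := eqVneq (s t) 0; first by rewrite mulr0 mulr0.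
      by rewrite subrr mul0r.
    apply: n2_le => //; first exact: Lw.
    by move=> t _; rewrite cabsM ler_piMl ?cabs_ge0.
  apply: aeIS2 (n2_eq0 (Lw _ LV) n0) V2 _ => t _ /eqP.
  rewrite mulf_eq0 => /orP[|/eqP ->]; last first.
    by rewrite cabs0 expr0n => h; move: B0; rewrite -h ltxx.
  move=> /eqP h _; apply/negP => /eqP s0; move: h.
  by rewrite /w cabs_kap s0 eqxx subr0 => -[] /eqP; rewrite oner_eq0.
pose a t := sig t * V t.
pose b t := (s t)%:C%C * (V t)^*%C.
pose U t := kap t * V t ^+ 2.
exists B, a, b, U.
have ma : cmeas a by apply: cmeasM; exact: L2_cmeas.
have mb : cmeas b by apply: cmeasM; [exact: L2_cmeas|exact/cmeasJ/L2_cmeas].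
have mU : cmeas U by apply: cmeasM => //; exact/cmeasX/L2_cmeas.
have a2 : aeI (fun t => cabs (a t) ^+ 2 = B * cabs (F t)).
  by apply: aeIS V2 _ => t _ h; rewrite cabsM cabs_sig exprMn s_sqr h mulrC.
have b2 : aeI (fun t => cabs (b t) ^+ 2 = B * cabs (F t)).
  apply: aeIS V2 _ => t _ h; rewrite cabsM cabs_real cabs_conj exprMn.
  by rewrite real_normK ?num_real// s_sqr h mulrC.
have iBF : intg (fun t => B * cabs (F t)) by exact/intgZ/L1_intg/H1_L1.
have La : isL2 a by apply: L2_le_ae ma iBF _; apply: aeIS a2 _ => t _ ->.
have Lb : isL2 b by apply: L2_le_ae mb iBF _; apply: aeIS b2 _ => t _ ->.
have Ha : isH1 a.
  apply: H1_closed; first exact: L2_L1.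
  move=> e e0; have ns := n2_ge0 sig.
  have d0 : 0 < e ^+ 2 / (n2 sig + 1) by rewrite divr_gt0 ?exprn_gt0// ltr_wpDl.
  have [n [hn _]] := appr _ d0.
  exists (fun t => pe (P n) t * F t); first exact: (H1_peM _ HF).1.
  have -> : L1norm (fun t => a t - pe (P n) t * F t) =
      L1norm (fun t => sig t * (V t - W (P n) t)).
    rewrite !L1normE; apply: RI_eq => t _; rewrite -sigs /a /W; congr cabs; ring.
  apply: le_trans (cauchy_schwarz L2sig (LVP n)) _.
  rewrite -sqrtrM ?n2_ge0// -(ger0_norm (ltW e0)) -sqrtr_sqr ler_wsqrtr//.
  apply: le_trans (ler_wpM2l ns hn) _.
  by rewrite mulrA ler_pdivrMr ?ltr_wpDl// mulrC ler_pM2l ?exprn_gt0// lerDl.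
have bE (m : nat) : fhat b (- m%:Z) = (cint (fun t => V t * (W 'X^m t)^*%C))^*%C.
  rewrite fhatE opprK -cintJ; last exact: L2M_L1 LV (L2J (LW _)).
  by apply: cint_eq => t _; rewrite /b /W /pe hornerXn -EX !conjM !conjcK; ring.
have Hb : isH2 b.
  split=> //; case=> // m _; rewrite NegzE bE orth ?conjc0//.
  by rewrite hornerXn expr0n.
(* Up to conjugation this is the inner product of V with s. As p_n - 1 vanishes at 0, s may be
   replaced by p_n s, which tends to V. *)
have b0 : fhat b 0 = B%:C%C.
  have := bE 0%N; rewrite oppr0 expr0 => ->.
  rewrite -[B%:C%C]conjc_real; congr (_^*)%C.
  apply/eqP; rewrite -subr_eq0; apply/eqP.
  have LVW p : isL1 (fun t => V t * (W p t)^*%C) by exact: L2M_L1 LV (L2J (LW _)).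
  have LVV : isL1 (fun t => V t * (V t)^*%C) by exact: L2M_L1 LV (L2J LV).
  rewrite /B n2_cint -cintB//.
  apply: (small _ B); first exact: ltW.
  move=> e e0; have [n [hn _]] := appr e e0.
  have o := orth (P n - 1).
  have -> : cint (fun t => V t * (W 1 t)^*%C - V t * (V t)^*%C) =
      - cint (fun t => V t * (V t - W (P n) t)^*%C).
    rewrite -[LHS]addr0 -o; last by rewrite hornerD hornerN P0 hornerC subrr.
    rewrite -cintD//; last exact: L1B.
    rewrite -cintN; last exact: L2M_L1 LV (L2J (LVP n)).
    by apply: cint_eq => t _; rewrite WB !conjB; ring.
  by rewrite cabsN; apply: le_trans (cabs_dot_le LV (LVP n)) _; rewrite ler_pM2l.
have k1 t : cabs (kap t) <= 1 by rewrite cabs_kap; case: (s t != 0).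
have LU : isL1 U.
  apply: L1M_bound mkap (fun t _ => k1 t).
  by have := L2M_L1 LV LV; under eq_fun do rewrite -expr2.
(* U - p_n^2 F is [kap] times a difference of two squares, so L^2 convergence of p_n s gives L^1
   convergence here. *)
have approxU (e : R) : 0 < e -> exists2 p, p.[0] = 1 &
    L1norm (fun t => U t - pe (p * p) t * F t) <= e.
  move=> e0; pose K := 2 * B + 2 * (A + 1) + 1.
  have K0 : 0 < K by rewrite /K; have := A_gt0; lra.
  have [n [hn _]] := appr _ (divr_gt0 (exprn_gt0 2 e0) K0).
  exists (P n) => //.
  have LVpP := L2D LV (LW (P n)).
  apply: (@le_trans _ _ (L1norm (fun t => (V t - W (P n) t) * (V t + W (P n) t)))).
    rewrite !L1normE; apply: RI_le.
    - by apply: L1_intg; apply: L1B => //; exact/L1_peM/H1_L1.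
    - exact/L1_intg/L2M_L1.
    - move=> t _; have -> : U t - pe (P n * P n) t * F t =
          kap t * ((V t - W (P n) t) * (V t + W (P n) t)).
        by rewrite -sigs -kaps /U /W /pe hornerM; ring.
      by rewrite cabsM ler_piMl ?cabs_ge0.
  apply: le_trans (cauchy_schwarz (LVP n) LVpP) _.
  rewrite -sqrtrM ?n2_ge0// -(ger0_norm (ltW e0)) -sqrtr_sqr ler_wsqrtr//.
  apply: (@le_trans _ _ (e ^+ 2 / K * K)); last by rewrite divfK// gt_eqF.
  apply: ler_pM; rewrite ?n2_ge0//.
  have := n2D_le LV (LW (P n)); have := PA n; have := d1 n.
  by rewrite /K -/B; lra.
split; split => //.
- by split; [exact: La|exact: Ha.2].
- apply: H1_closed => // e e0; have [p _ hp] := approxU e e0.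
  by exists (fun t => pe (p * p) t * F t) => //; exact: (H1_peM _ HF).1.
- apply: aeIS2 (aeIS2 a2 b2 (fun t _ h1 h2 => conj h1 h2)) (aeIS2 V2 F0ae (fun t _ h1 h2 => conj h1 h2)) _.
  move=> t _ [at2 bt2] [Vt st].
  have VV : V t * (V t)^*%C = B%:C%C by rewrite mulcC Vt.
  split; first by rewrite -cabs_gt0 -s_sqr exprn_gt0// lt_def st s_ge0.
  split => //.
  + by rewrite -sigs /a /b mulrACA VV mulrC.
  + by rewrite /U cabsM cabs_kap st mul1r cabsX Vt.
  + by rewrite /U /a /b -kaps -VV; ring.
Qed.

End Szego.

(** * Factorization, weak compactness and minimal elements of cosets *)

Section Factorization.
Variable R : realType.
Local Notation C := R[i].
Implicit Types (f g th : R -> C).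

(** Szegő's problem needs a nonzero mean; dividing by ζ^m, with m the least index of a nonzero
    coefficient, provides it. *)
Lemma H1_order f : isH1 f -> ~ aeI (fun t => f t = 0) ->
  exists (m : nat) (g : R -> C),
    [/\ isH1 g, fhat g 0 != 0 & forall t, f t = E m t * g t].
Proof.
move=> Hf nz; have [Lf f0] := Hf.
have exm : exists m : nat, fhat f m != 0.
  apply: contrapT => /forallNP H; apply: nz; apply: fhat_inj => //.
  by case=> n; [have /negP := H n; rewrite negbK => /eqP|rewrite f0].
case: (ex_minnP exm) => m fm hm.
exists m, (fun t => E (- m%:Z) t * f t); split.
- split; first exact: L1_EM.
  move=> k k0; rewrite fhatEM opprK.
  have [km|km] := ltP (k + m%:Z) 0; first exact: f0.
  have [j e] : exists j : nat, k + m%:Z = j by case: (k + _) km => // j; exists j.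
  rewrite e; apply/eqP/negPn/negP => /hm; apply/negP; rewrite -ltnNge.
  by rewrite -ltz_nat -e gtrDr.
- by rewrite fhatEM opprK add0r.
- by move=> t; rewrite mulrA [E _ _ * _]mulrC EK mul1r.
Qed.

(** The factors are rescaled by 1 / sqrt A so that both square norms equal the L^1 norm of [f]:
    Cauchy-Schwarz is then sharp, and weak limits of the factors inherit the L^1 bound. *)
Lemma H1_factor f : isH1 f -> exists a b,
  [/\ isH2 a, isH2 b, aeI (fun t => f t = a t * b t), n2 a = L1norm f &
      n2 b = L1norm f].
Proof.
move=> Hf; have mf := L1_cmeas (H1_L1 Hf).
have [fz|nz] := pselect (aeI (fun t => f t = 0)).
  exists (fun=> 0), (fun=> 0).
  have -> : L1norm f = 0.
    rewrite (L1norm_ae mf (cmeas_cst 0) fz) L1normE.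
    by under RI_eq do rewrite cabs0; rewrite RI_cst.
  have -> : @n2 R (fun=> 0) = 0 by rewrite /n2 cabs0 expr0n RI_cst.
  split => //; [exact: H2_cst..|].
  by apply: aeIS fz _ => t _ ->; rewrite mulr0.
have [m [g [Hg g0 fg]]] := H1_order Hf nz.
have [A [a [b [U [[A0 Ha Hb _] [_ _ H]]]]]] := szego_factorization Hg g0.
pose c : C := ((Num.sqrt A)^-1)%:C%C.
have sA : 0 < Num.sqrt A by rewrite sqrtr_gt0.
have cc : c * c * A%:C%C = 1.
  rewrite -!rmorphM /= -invfM -expr2 sqr_sqrtr ?(ltW A0)// mulVf// gt_eqF//.
have cabsc : cabs c ^+ 2 = A^-1.
  by rewrite cabs_real real_normK ?num_real// exprVn sqr_sqrtr// ltW.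
have nf : L1norm f = L1norm g.
  by rewrite !L1normE; apply: RI_eq => t _; rewrite fg cabsM cabsE mul1r.
have n2A h : isH2 h -> aeI (fun t => cabs (h t) ^+ 2 = A * cabs (g t)) ->
    n2 (fun t => c * h t) = L1norm f.
  move=> Hh hh; rewrite n2Z ?cabsc; last exact: H2_L2.
  have -> : n2 h = A * L1norm g.
    rewrite L1normE -RIZ; last exact/L1_intg/H1_L1.
    apply: RI_ae => //; first exact: mI_X (mI_cabs (L2_cmeas (H2_L2 Hh))).
    exact: mI_M (mI_cst _) (mI_cabs (L1_cmeas (H1_L1 Hg))).
  by rewrite mulrA mulVf ?gt_eqF// mul1r nf.
exists (fun t => c * (E m t * a t)), (fun t => c * b t); split.
- exact/H2Z/H2_EM.
- exact: H2Z.
- apply: aeIS H _ => t _ [_ [_ _ ab _ _]].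
  rewrite fg; transitivity (E m t * (c * c * (a t * b t))); last by ring.
  by rewrite ab [c * c * (_ * _)]mulrA cc mul1r.
- apply: n2A; first exact: H2_EM.
  by apply: aeIS H _ => t _ [_ [h _ _ _ _]]; rewrite cabsM cabsE mul1r.
- by apply: n2A => //; apply: aeIS H _ => t _ [_ [_ h _ _ _]].
Qed.

Lemma Hinf_H2 th : isHinf th -> isH2 th.
Proof.
move=> [[m1 m2 [M hM]] neg]; split => //.
by apply: L2_bound_ae hM; split.
Qed.

Lemma HinfM_L2 th f : isHinf th -> isL2 f -> isL2 (fun t => th t * f t).
Proof.
by move=> [[m1 m2 [M hM]] _] Lf; apply: (L2M_bound_ae Lf _ hM); split.
Qed.

(** From f = a b with factors in H^2, the product is (th a) b, again a product of two H^2
    functions. *)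
Lemma HinfM_H1 th f : isHinf th -> isH1 f -> isH1 (fun t => th t * f t).
Proof.
move=> Hth Hf; have [a [b [Ha Hb fab _ _]]] := H1_factor Hf.
have Hta : isH2 (fun t => th t * a t).
  split; first exact: HinfM_L2 (H2_L2 Ha).
  exact: (H2M_H1 (Hinf_H2 Hth) Ha).2.
apply: (H1_ae (H2M_H1 Hta Hb)).
  by apply: cmeasM; [exact/L2_cmeas/H2_L2/Hinf_H2|exact/L1_cmeas/H1_L1].
by apply: aeIS fab _ => t _ ->; rewrite mulrA.
Qed.

Lemma fhat_convHinf th f (n : nat) : isHinf th -> isH1 f ->
  fhat (fun t => th t * f t) n =
  \sum_(0 <= j < n.+1) fhat th j * fhat f (n%:Z - j%:Z).
Proof.
move=> Hth Hf; apply: fhat_conv_tail.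
- exact/H1_L1/H2_H1/Hinf_H2.
- exact: H1_L1.
- exact/H1_L1/HinfM_H1.
- apply: (HinfM_H1 _ Hf).2 => //; split; last first.
    by move=> k; apply: fhat_tail_neg; exact/H2_H1/Hinf_H2.
  have mth : cmeas th by exact/L2_cmeas/H2_L2/Hinf_H2.
  have ms := L2_cmeas (L2_sumE (fun j => fhat th j%:Z) 0 n.+1).
  have [mr1 mr2] := cmeasM (cmeasE R (- n.+1%:Z)) (cmeasB mth ms).
  split => //; have [[_ _ [M hM]] _] := Hth.
  have [K hK] := pe_bounded (\poly_(j < n.+1) fhat th j%:Z).
  exists (M + K); apply: aeIS hM _ => t _ h.
  rewrite cabsM cabsE mul1r; apply: le_trans (cabsD _ _) _; rewrite cabsN.
  by apply: lerD => //; have := hK t; rewrite pe_poly.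
Qed.

End Factorization.

(** * Weak limits along an ultrafilter *)

Section UltraLimits.
Variable R : realType.
Local Notation C := R[i].
Variable U : set_system nat.
Hypothesis PU : ProperFilter U.
Hypothesis limU : forall v : nat -> R, (exists B : R, forall n, `|v n| <= B) ->
  exists l : R, v n @[n --> U] --> l.
Implicit Types (z w : nat -> C) (l : C).

Definition clim z l : Prop :=
  (complex.Re (z n) @[n --> U] --> complex.Re l) /\
  (complex.Im (z n) @[n --> U] --> complex.Im l).

Lemma clim_cst l : clim (fun=> l) l.
Proof. by split; exact: cvg_cst. Qed.

Lemma climD z w l m : clim z l -> clim w m -> clim (fun n => z n + w n) (l + m).
Proof.
move=> [z1 z2] [w1 w2]; split; rewrite ?ReD ?ImD.
  by under eq_fun do rewrite ReD; exact: cvgD.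
by under eq_fun do rewrite ImD; exact: cvgD.
Qed.

Lemma climM z w l m : clim z l -> clim w m -> clim (fun n => z n * w n) (l * m).
Proof.
move=> [z1 z2] [w1 w2]; split; rewrite ?ReM ?ImM.
  by under eq_fun do rewrite ReM; apply: cvgB; exact: cvgM.
by under eq_fun do rewrite ImM; apply: cvgD; exact: cvgM.
Qed.

Lemma clim_sum (J : Type) (r : seq J) (z : J -> nat -> C) (l : J -> C) :
  (forall j, clim (z j) (l j)) ->
  clim (fun n => \sum_(j <- r) z j n) (\sum_(j <- r) l j).
Proof.
move=> H; elim: r => [|j r IH].
  by under eq_fun do rewrite big_nil; rewrite big_nil; exact: clim_cst.
by under eq_fun do rewrite big_cons; rewrite big_cons; exact: climD.
Qed.

Lemma clim_unique z l m : clim z l -> clim z m -> l = m.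
Proof.
move=> [z1 z2] [w1 w2].
by apply: complex_ext; [exact: (cvg_unique _ z1 w1)|exact: (cvg_unique _ z2 w2)].
Qed.

Lemma clim_exists z (B : R) : (forall n, cabs (z n) <= B) -> exists l, clim z l.
Proof.
move=> zB; have [|x hx] := @limU (fun n => complex.Re (z n)).
  by exists B => n; exact: le_trans (normRe_le _) (zB n).
have [|y hy] := @limU (fun n => complex.Im (z n)).
  by exists B => n; exact: le_trans (normIm_le _) (zB n).
by exists (Complex x y).
Qed.

Lemma clim_sqr z l : clim z l -> cabs (z n) ^+ 2 @[n --> U] --> cabs l ^+ 2.
Proof.
move=> [z1 z2]; rewrite cabs_sqr.
under eq_fun do rewrite cabs_sqr !expr2; rewrite !expr2.
by apply: cvgD; exact: cvgM.
Qed.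

Lemma clim_le z l (B : R) : clim z l -> (forall n, cabs (z n) <= B) -> cabs l <= B.
Proof.
move=> zl zB; have B0 : 0 <= B by exact: le_trans (cabs_ge0 _) (zB 0%N).
rewrite -(@ler_pXn2r _ 2) ?nnegrE ?cabs_ge0//.
apply: (cvgr_to_le (clim_sqr zl)); apply: nearW => n.
by rewrite ler_pXn2r ?nnegrE ?cabs_ge0// zB.
Qed.

(** Weak compactness of balls of H^2: Bessel bounds the coefficients, their limits satisfy the
    limiting square-sum bound, and Riesz-Fischer rebuilds a function from them. *)
Lemma H2_clim (a_ : nat -> R -> C) (b_ : nat -> R) (B K : R) :
  (forall n, isH2 (a_ n)) -> (forall n, n2 (a_ n) <= b_ n) ->
  (forall n, b_ n <= K) -> b_ n @[n --> U] --> B ->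
  exists a, [/\ isH2 a, n2 a <= B &
    forall k : int, clim (fun n => fhat (a_ n) k) (fhat a k)].
Proof.
move=> Ha nab bK bB.
have bes n m : \sum_(0 <= j < m) cabs (fhat (a_ n) j) ^+ 2 <= b_ n.
  have La := H2_L2 (Ha n); apply: le_trans (nab n).
  have := bessel m La.
  by have := n2_ge0 (fun t => a_ n t - \sum_(0 <= j < m) fhat (a_ n) j * E j t); lra.
have K0 : 0 <= K := le_trans (n2_ge0 _) (le_trans (nab 0%N) (bK 0%N)).
have bd (j : nat) : exists l, clim (fun n => fhat (a_ n) j) l.
  apply: (@clim_exists _ (K + 1)) => n.
  have h : cabs (fhat (a_ n) j) ^+ 2 <= K.
    apply: le_trans (bK n); apply: le_trans (bes n j.+1).
    by rewrite big_nat_recr//= lerDr; apply: sumr_ge0 => i _; exact: sqr_ge0.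
  by have := cabs_ge0 (fhat (a_ n) j); nra.
have [c hc] := boolp.choice bd.
have [m|a [Ha' aj na _]] := @riesz_fischer R c B.
  have h : (\sum_(0 <= j < m) cabs (fhat (a_ n) j) ^+ 2) @[n --> U] -->
      \sum_(0 <= j < m) cabs (c j) ^+ 2.
    elim: m => [|m IH].
      by under eq_fun do rewrite big_geq//; rewrite big_geq//; exact: cvg_cst.
    under eq_fun do rewrite big_nat_recr//=; rewrite big_nat_recr//=.
    by apply: cvgD => //; exact: clim_sqr.
  by apply: (ler_cvg_to h bB); apply: nearW => n; exact: bes.
exists a; split => //; case=> j; first by rewrite aj; exact: hc.
rewrite Ha'.2//; under eq_fun do rewrite (Ha _).2//.
exact: clim_cst.
Qed.

(** Plays the role of weak-star compactness of balls of H^1. The two H^2 factors have weak limits,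
    and each coefficient of a product of H^2 functions is a finite convolution, so the product of
    the limits has the limiting coefficients. *)
Lemma H1_clim (F_ : nat -> R -> C) (L K : R) :
  (forall n, isH1 (F_ n)) -> (forall n, L1norm (F_ n) <= K) ->
  L1norm (F_ n) @[n --> U] --> L ->
  exists F, [/\ isH1 F, L1norm F <= L &
    forall k : int, clim (fun n => fhat (F_ n) k) (fhat F k)].
Proof.
move=> HF FK FL.
have L0 : 0 <= L by apply: (cvgr_to_ge FL); apply: nearW => n; exact: L1norm_ge0.
have Hab n : exists ab : (R -> C) * (R -> C), [/\ isH2 ab.1, isH2 ab.2,
    aeI (fun t => F_ n t = ab.1 t * ab.2 t), n2 ab.1 = L1norm (F_ n) &
    n2 ab.2 = L1norm (F_ n)].
  by have [a [b h]] := H1_factor (HF n); exists (a, b).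
have [ab hab] := boolp.choice Hab.
have [|n|//|//|a [Ha na ca]] := @H2_clim (fun n => (ab n).1) (fun n => L1norm (F_ n)) L K.
- by move=> n; case: (hab n).
- by case: (hab n) => _ _ _ ->.
have [|n|//|//|b [Hb nb cb]] := @H2_clim (fun n => (ab n).2) (fun n => L1norm (F_ n)) L K.
- by move=> n; case: (hab n).
- by case: (hab n) => _ _ _ _ ->.
exists (fun t => a t * b t); split.
- exact: H2M_H1.
- apply: le_trans (cauchy_schwarz (H2_L2 Ha) (H2_L2 Hb)) _.
  rewrite -[leRHS](sqr_sqrtr L0) expr2.
  by apply: ler_pM; rewrite ?sqrtr_ge0// ler_wsqrtr.
- case=> k; last first.
    rewrite (H2M_H1 Ha Hb).2//.
    under eq_fun do rewrite (HF _).2//.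
    exact: clim_cst.
  rewrite fhat_convH2//.
  have e n : fhat (F_ n) k =
      \sum_(0 <= j < k.+1) fhat (ab n).1 j * fhat (ab n).2 (k%:Z - j%:Z).
    have [h1 h2 h3 _ _] := hab n; rewrite -fhat_convH2//.
    apply: fhat_ae h3; [exact/L1_cmeas/H1_L1|exact/L1_cmeas/H1_L1/H2M_H1].
  under eq_fun do rewrite e.
  by apply: clim_sum => j; apply: climM; [exact: ca|exact: cb].
Qed.

End UltraLimits.

(** * Existence of minimal representatives *)

Section Minimizers.
Variable R : realType.
Local Notation C := R[i].
Implicit Types (f g th : R -> C) (Phi : set (R -> C)).

Lemma H1Phi0 Phi : H1Phi Phi (fun=> 0).
Proof.
split; first exact/H2_H1/H2_cst.
move=> phi _; rewrite (cint_eq (g := fun=> 0)) ?cint_cst// => t _.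
by rewrite mul0r.
Qed.

Lemma qnorm_has_inf th Phi f :
  has_inf [set L1norm (fun t => f t + th t * g t) | g in H1Phi Phi].
Proof.
split; last by exists 0 => _ [g _ <-]; exact: L1norm_ge0.
by exists (L1norm (fun t => f t + th t * 0)); exists (fun=> 0) => //; exact: H1Phi0.
Qed.

Lemma qnorm_le th Phi f g : H1Phi Phi g ->
  qnorm th Phi f <= L1norm (fun t => f t + th t * g t).
Proof.
by move=> Hg; apply: ge_inf; [exact: (qnorm_has_inf th Phi f).2|exists g].
Qed.

Lemma qnorm_le_L1norm th Phi f : qnorm th Phi f <= L1norm f.
Proof.
apply: le_trans (qnorm_le th f (H1Phi0 Phi)) _.
by under eq_fun do rewrite mulr0 addr0.
Qed.

Lemma minimizer_exists th Phi f : inner th -> (forall phi, Phi phi -> isCT phi) ->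
  isH1 f -> exists2 g, H1Phi Phi g &
    L1norm (fun t => f t + th t * g t) = qnorm th Phi f.
Proof.
move=> [Hth th1] ctPhi Hf; set q := qnorm th Phi f.
have Hseq n : exists g, H1Phi Phi g /\
    L1norm (fun t => f t + th t * g t) <= q + n.+1%:R^-1.
  have n0 : 0 < n.+1%:R^-1 :> R by rewrite invr_gt0 ltr0n.
  have [_ [g Hg <-] h] := inf_adherent n0 (qnorm_has_inf th Phi f).
  by exists g; split => //; exact: ltW.
have [g_ hg] := boolp.choice Hseq.
have Hg n : isH1 (g_ n) by have [[]] := hg n.
pose F_ n t := f t + th t * g_ n t.
have Hthg n : isH1 (fun t => th t * g_ n t) by exact: HinfM_H1.
have HF n : isH1 (F_ n) by exact: H1D.
have FK n : L1norm (F_ n) <= q + 1.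
  have [_ h] := hg n; apply: le_trans h _; rewrite lerD2l.
  by rewrite invf_le1 ?ltr0n// ler1n.
pose K := q + 1 + L1norm f.
have mth : cmeas th by exact/L2_cmeas/H2_L2/Hinf_H2.
(* As |th| = 1, a bound on th g_n = F_n - f is a bound on g_n. *)
have gK n : L1norm (g_ n) <= K.
  have mg : cmeas (g_ n) by exact/L1_cmeas/H1_L1.
  rewrite -(L1normM_unimodular mg mth th1).
  have := L1normD (H1_L1 (HF n)) (L1N (H1_L1 Hf)).
  have -> : L1norm (fun t => F_ n t + - f t) = L1norm (fun t => th t * g_ n t).
    by rewrite !L1normE; apply: RI_eq => t _; rewrite /F_ addrAC subrr add0r.
  have -> : L1norm (fun t => - f t) = L1norm f.
    by rewrite !L1normE; apply: RI_eq => t _; rewrite cabsN.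
  by have := FK n; rewrite /K; lra.
have [U PU [evU limU]] := ultra_limit R.
have [|L FL] := limU (fun n => L1norm (F_ n)).
  by exists (q + 1) => n; rewrite ger0_norm ?L1norm_ge0.
have [|L' gL] := limU (fun n => L1norm (g_ n)).
  by exists K => n; rewrite ger0_norm ?L1norm_ge0.
have Lq : L <= q.
  apply/ler_addgt0Pl => e e0; rewrite addrC; apply: (cvgr_to_le FL); apply: evU.
  exists (Num.truncn e^-1).+1 => // n /= Nn.
  have [_ h] := hg n; apply: le_trans h _; rewrite lerD2l.
  rewrite invf_ple ?posrE ?ltr0n//; apply: le_trans (ltW (truncnS_gt _)) _.
  by rewrite ler_nat (leq_trans Nn).
have [F [HF' FleL cF]] := H1_clim PU limU HF FK FL.
have [g [Hg' _ cg]] := H1_clim PU limU Hg gK gL.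
have Htg := HinfM_H1 Hth Hg'.
(* The limit stays in f + th H^1: each coefficient of th g is a finite convolution, so it is the
   limit of the corresponding coefficients of th g_n. *)
have FE : aeI (fun t => F t = f t + th t * g t).
  apply: fhat_ae_eq; [exact: H1_L1|exact: L1D (H1_L1 Hf) (H1_L1 Htg)|].
  case=> k; last by rewrite HF'.2// (H1D Hf Htg).2.
  apply: (clim_unique PU (cF k)).
  rewrite fhatD; [|exact: H1_L1..].
  under eq_fun do rewrite (fhatD _ (H1_L1 Hf) (H1_L1 (Hthg _))).
  apply: climD; first exact: clim_cst.
  rewrite fhat_convHinf//; under eq_fun do rewrite fhat_convHinf//.
  by apply: clim_sum => j; apply: climM; [exact: clim_cst|exact: cg].
have mg : cmeas g by exact/L1_cmeas/H1_L1.
(* Convergence of coefficients controls only trigonometric polynomials. Uniform approximation of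
   [phi] transfers the orthogonality to the limit, because the norms of g_n stay below [K]. *)
have PhiG : H1Phi Phi g.
  split => // phi Pphi; have ct := ctPhi _ Pphi.
  have mphi := cmeas_isCT ct; have Lg := H1_L1 Hg'.
  rewrite (cint_eq (g := fun t => phi t * g t)); last by move=> t _; rewrite mulrC.
  apply: eq_of_cabs_le => e e0; rewrite subr0.
  have K0 : 0 <= K := le_trans (L1norm_ge0 _) (gK 0%N).
  have D0 : 0 < L1norm g + K + 1 by have := L1norm_ge0 g; lra.
  pose d := e / (L1norm g + K + 1); have d0 : 0 < d by exact: divr_gt0.
  have [T tT hT] := fejer ct d0.
  have mT := L1_cmeas (L1_trig tT); have md := cmeasB mphi mT.
  have LTh h : isL1 h -> isL1 (fun t => T t * h t).
    move=> Lh; have [s ->] := tT; under eq_fun do rewrite mulr_suml.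
    by apply: L1_sum => p; exact: L1_ZEM.
  have Lph h : isL1 h -> isL1 (fun t => (phi t - T t) * h t).
    by move=> Lh; exact: L1M_bound Lh md hT.
  have split_ h : isL1 h -> cint (fun t => phi t * h t) =
      cint (fun t => (phi t - T t) * h t) + cint (fun t => T t * h t).
    move=> Lh; rewrite -cintD; [|exact: Lph|exact: LTh].
    by apply: cint_eq => t _; rewrite mulrBl subrK.
  have bnd h : isL1 h -> cabs (cint (fun t => (phi t - T t) * h t)) <= d * L1norm h.
    move=> Lh; apply: le_trans (cabs_cint_le (Lph _ Lh)) _.
    exact: L1normM_bound_ae Lh md (aeI_all hT).
  have Tn n : cabs (cint (fun t => T t * g_ n t)) <= d * K.
    have := split_ _ (H1_L1 (Hg n)).
    have [[_ h0] _] := hg n.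
    rewrite (cint_eq (g := fun t => g_ n t * phi t)); last by move=> t _; rewrite mulrC.
    rewrite h0// => /esym/eqP; rewrite addr_eq0 => /eqP h1.
    have := bnd _ (H1_L1 (Hg n)); rewrite h1 cabsN => h2.
    by apply: le_trans h2 _; rewrite ler_pM2l.
  have cT : clim U (fun n => cint (fun t => T t * g_ n t)) (cint (fun t => T t * g t)).
    have [s sE] := tT.
    have TE h : isL1 h -> cint (fun t => T t * h t) = \sum_(p <- s) p.1 * fhat h (- p.2).
      move=> Lh; rewrite sE; under cint_eq do rewrite mulr_suml.
      rewrite cint_sum => [|p]; last exact: L1_ZEM.
      by apply: eq_bigr => p _; rewrite cint_ZEM.
    rewrite TE//; under eq_fun do rewrite (TE _ (H1_L1 (Hg _))).
    by apply: clim_sum => p; apply: climM; [exact: clim_cst|exact: cg].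
  rewrite split_//; apply: le_trans (cabsD _ _) _.
  have h1 := bnd _ Lg; have h2 := clim_le PU cT Tn.
  have h3 : d * (L1norm g + K + 1) = e by rewrite /d divfK// gt_eqF.
  by nra.
exists g => //; apply/le_anti; rewrite qnorm_le// andbT.
rewrite -(L1norm_ae _ _ FE); [exact: le_trans FleL Lq|exact/L1_cmeas/H1_L1|].
by apply: cmeasD; [exact/L1_cmeas/H1_L1|exact: cmeasM].
Qed.

End Minimizers.

(** * Poisson extension and Jensen's inequality *)

Section Poisson.
Variable R : realType.
Local Notation C := R[i].
Implicit Types (f g : R -> C) (z : C).

Lemma E1E (t : R) : expi (2 * pi * t) = E 1 t.
Proof. by rewrite /E mulr1. Qed.

(** The Cauchy kernel, for |z| < 1 the sum of the powers of conj(z) ζ; the Poisson kernel is twice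
    its real part minus 1. *)
Let K z t : C := (1 - z^*%C * E 1 t)^-1.

Let cabs_den z t : cabs (1 - z^*%C * E 1 t) = cabs (E 1 t - z).
Proof.
rewrite -[RHS]cabs_conj conjB -EN -[LHS]mul1r -(cabsE (-1) t) -cabsM.
by rewrite mulrBr mulr1 mulrCA EK mulr1.
Qed.

Let den_ge z t : cabs z < 1 -> 1 - cabs z <= cabs (E 1 t - z).
Proof.
move=> z1; rewrite lerBlDr -{1}(cabsE 1 t).
by apply: le_trans (cabsD _ _); rewrite subrK.
Qed.

Let den_gt0 z t : cabs z < 1 -> 0 < cabs (E 1 t - z).
Proof. by move=> z1; apply: lt_le_trans (den_ge t z1); rewrite subr_gt0. Qed.

Let cabsK_le z t : cabs z < 1 -> cabs (K z t) <= (1 - cabs z)^-1.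
Proof.
move=> z1; rewrite cabsV cabs_den lef_pV2 ?posrE ?den_gt0 ?subr_gt0//.
exact: den_ge.
Qed.

Let mK z : cmeas (K z).
Proof.
apply: cmeasV; apply: cmeasB (cmeas_cst _) _.
exact: cmeasM (cmeas_cst _) (cmeasE _ _).
Qed.

Let K_rec z t : cabs z < 1 -> K z t = 1 + z^*%C * (E 1 t * K z t).
Proof.
move=> z1; rewrite /K; set w := z^*%C * E 1 t.
have w0 : 1 - w != 0 by rewrite -cabs_gt0 cabs_den den_gt0.
by rewrite mulrA -/w; field.
Qed.

Let L1K z f : cabs z < 1 -> isL1 f -> isL1 (fun t => K z t * f t).
Proof. by move=> z1 Lf; apply: L1M_bound Lf (mK z) (fun t _ => cabsK_le t z1). Qed.

Lemma geometric_small (r c e : R) : 0 <= r < 1 -> 0 < e -> exists n : nat, r ^+ n * c <= e.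
Proof.
move=> /andP[r0 r1] e0.
have : (r ^+ n * c) @[n --> \oo] --> 0 * c.
  by apply: cvgMl; apply: cvg_expr; rewrite ger0_norm.
rewrite mul0r => /cvgr0Pnorm_le /(_ e e0) [n _ hn]; exists n.
by apply: le_trans (ler_norm _) (hn n (leqnn n)).
Qed.

(** Substituting K = 1 + conj(z) ζ K produces conj(z) times an integral of higher frequency, since
    the summand 1 contributes a coefficient of [f] of negative index. The integrals stay bounded
    while the powers of |z| tend to 0. *)
Let cint_EK z f (m : nat) : cabs z < 1 -> isH1 f ->
  cint (fun t => E m.+1 t * (K z t * f t)) = 0.
Proof.
move=> z1 [Lf f0].
have step n : cint (fun t => E n.+1 t * (K z t * f t)) =
    z^*%C * cint (fun t => E n.+2 t * (K z t * f t)).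
  rewrite -cintZ; last exact/L1_EM/L1K.
  transitivity (cint (fun t => E n.+1 t * f t) +
    cint (fun t => z^*%C * (E n.+2 t * (K z t * f t)))).
    rewrite -cintD; [|exact: L1_EM|exact/L1Z/L1_EM/L1K].
    apply: cint_eq => t _; rewrite {1}(K_rec t z1).
    have -> : E n.+2 t = E n.+1 t * E 1 t by rewrite -ED -PoszD addn1.
    by ring.
  have := f0 (- n.+1%:Z) isT; rewrite fhatE opprK => ->.
  by rewrite add0r.
have it n : cint (fun t => E m.+1 t * (K z t * f t)) =
    z^*%C ^+ n * cint (fun t => E (m.+1 + n)%N t * (K z t * f t)).
  elim: n => [|n IH]; first by rewrite addn0 mul1r.
  by rewrite IH step exprSr -mulrA -addnS.
apply: eq_of_cabs_le => e e0; rewrite subr0.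
have [|n hn] := @geometric_small (cabs z) (L1norm (fun t => K z t * f t)) e _ e0.
  by rewrite cabs_ge0.
rewrite (it n) cabsM cabsX cabs_conj; apply: le_trans hn.
apply: ler_wpM2l; first by rewrite exprn_ge0 ?cabs_ge0.
apply: le_trans (cabs_cint_le (L1_EM _ (L1K z1 Lf))) _.
rewrite !L1normE le_eqVlt; apply/orP; left; apply/eqP.
by apply: RI_eq => t _; rewrite cabsM cabsE mul1r.
Qed.

Lemma poisson_ge0 z t : cabs z < 1 -> 0 <= poisson z t.
Proof.
move=> z1; rewrite divr_ge0 ?sqr_ge0// subr_ge0.
by rewrite -(expr1n _ 2) ler_pXn2r ?nnegrE ?cabs_ge0// ltW.
Qed.

Lemma poisson_bound z : cabs z < 1 ->
  exists2 M : R, 0 < M & forall t, poisson z t <= M.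
Proof.
move=> z1; have d0 : 0 < 1 - cabs z by rewrite subr_gt0.
exists ((1 - cabs z) ^- 2); first by rewrite invr_gt0 exprn_gt0.
move=> t; rewrite /poisson E1E.
apply: (@le_trans _ _ (1 * (cabs (E 1 t - z) ^+ 2)^-1)).
  by rewrite ler_wpM2r ?invr_ge0 ?sqr_ge0// gerBl sqr_ge0.
rewrite mul1r lef_pV2 ?posrE ?exprn_gt0 ?den_gt0//.
by rewrite ler_pXn2r ?nnegrE ?cabs_ge0 ?(ltW d0)// den_ge.
Qed.

Lemma mI_poisson z : mI (poisson z).
Proof.
apply: mI_M (mI_cst _) _; apply: mI_inv => [t|]; first exact: sqr_ge0.
under eq_fun do rewrite E1E.
by apply: mI_X; apply: mI_cabs; exact: cmeasB (cmeasE _ _) (cmeas_cst _).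
Qed.

Lemma poisson0 t : poisson (0 : C) t = 1.
Proof. by rewrite /poisson cabs0 subr0 cabs_expi expr0n subr0 expr1n divr1. Qed.

Lemma intg_poisson z (h : R -> R) : cabs z < 1 -> intg h ->
  intg (fun t => poisson z t * h t).
Proof.
move=> z1 ih; have [M M0 hM] := poisson_bound z1.
apply: intg_le (intgZ M (intg_norm ih)) _.
  exact: mI_M (mI_poisson z) (intg_mI ih).
by move=> t _; rewrite normrM ger0_norm ?poisson_ge0// ler_wpM2r.
Qed.

Lemma L1_poisson z f : cabs z < 1 -> isL1 f ->
  isL1 (fun t => (poisson z t)%:C%C * f t).
Proof.
move=> z1 Lf; have [M M0 hM] := poisson_bound z1.
apply: L1M_bound Lf (cmeas_real (mI_poisson z)) _ => t _.
by rewrite cabs_real ger0_norm ?poisson_ge0//; exact: hM.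
Qed.

Lemma PextZ z f (c : C) : cabs z < 1 -> isL1 f ->
  Pext (fun t => c * f t) z = c * Pext f z.
Proof.
move=> z1 Lf; rewrite /Pext -cintZ; last exact: L1_poisson.
by apply: cint_eq => t _; rewrite mulrCA.
Qed.

Lemma PextD z f g : cabs z < 1 -> isL1 f -> isL1 g ->
  Pext (fun t => f t + g t) z = Pext f z + Pext g z.
Proof.
move=> z1 Lf Lg; rewrite /Pext -cintD; [|exact: L1_poisson..].
by apply: cint_eq => t _; rewrite mulrDr.
Qed.

Lemma PextB z f g : cabs z < 1 -> isL1 f -> isL1 g ->
  Pext (fun t => f t - g t) z = Pext f z - Pext g z.
Proof.
move=> z1 Lf Lg; rewrite /Pext -cintB; [|exact: L1_poisson..].
by apply: cint_eq => t _; rewrite mulrBr.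
Qed.

Lemma Pext_ae z f g : cmeas f -> cmeas g -> aeI (fun t => f t = g t) ->
  Pext f z = Pext g z.
Proof.
move=> mf mg h; have mP := cmeas_real (mI_poisson z).
apply: cint_ae; [exact: cmeasM..|].
by apply: aeIS h _ => t _ ->.
Qed.

Lemma cabs_Pext_le z f : cabs z < 1 -> isL1 f ->
  cabs (Pext f z) <= RI (fun t => poisson z t * cabs (f t)).
Proof.
move=> z1 Lf; apply: le_trans (cabs_cint_le (L1_poisson z1 Lf)) _.
rewrite L1normE le_eqVlt; apply/orP; left; apply/eqP; apply: RI_eq => t _.
by rewrite cabsM cabs_real ger0_norm ?poisson_ge0.
Qed.

Lemma RI_poisson_le z (M : R) (h : R -> R) : cabs z < 1 ->
  (forall t, poisson z t <= M) -> intg h -> (forall t, 0 <= h t) ->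
  RI (fun t => poisson z t * h t) <= M * RI h.
Proof.
move=> z1 hM ih h0; rewrite -RIZ//; apply: RI_le; [exact: intg_poisson|exact: intgZ|].
by move=> t _; rewrite ler_wpM2r.
Qed.

Let poissonK z t : cabs z < 1 ->
  (poisson z t)%:C%C = K z t + (K z t)^*%C - 1.
Proof.
move=> z1; rewrite /K; set w := z^*%C * E 1 t.
have w0 : 1 - w != 0 by rewrite -cabs_gt0 cabs_den den_gt0.
have w0' : 1 - w^*%C != 0.
  by rewrite -[1]conjc1 -conjB conjc_eq0.
have ww : w * w^*%C = (cabs z ^+ 2)%:C%C.
  by rewrite mulcC /w cabsM cabs_conj cabsE mulr1.
rewrite conjc_inv conjB conjc1 /poisson E1E -cabs_den -/w.
rewrite rmorphM /= fmorphV /= -mulcC conjB conjc1 rmorphB /= -ww rmorph1.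
by field; rewrite w0 w0'.
Qed.

Lemma RI_poisson z : cabs z < 1 -> RI (poisson z) = 1.
Proof.
move=> z1; have H1 := H2_H1 (H2_cst (1 : C)).
have LK : isL1 (K z).
  by have := L1K z1 (L1_cst 1); under eq_fun do rewrite mulr1.
have cK : cint (K z) = 1.
  rewrite (cint_eq (g := fun t => 1 + z^*%C * (E 1 t * (K z t * 1)))); last first.
    by move=> t _; rewrite mulr1; exact: K_rec.
  have LEK : isL1 (fun t => E 1 t * (K z t * 1)) by exact/L1_EM/L1K/L1_cst.
  rewrite cintD; [|exact: L1_cst|exact: L1Z].
  by rewrite cintZ// (cint_EK 0 z1 H1) mulr0 addr0 cint_cst.
apply: (@complexI R); rewrite -cint_real.
under cint_eq do rewrite poissonK//.
rewrite cintB; [|exact: L1D (L1J _)|exact: L1_cst].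
rewrite cintD//; last exact: L1J.
by rewrite cintJ// cK cint_cst conjc1 addrK.
Qed.

(** On the circle the Poisson kernel times ζ - z equals (1 - |z|^2) ζ K, so the difference of the
    two sides is an integral killed by [cint_EK]. *)
Lemma Pext_EM z f : cabs z < 1 -> isH1 f -> Pext (fun t => E 1 t * f t) z = z * Pext f z.
Proof.
move=> z1 Hf; have Lf := H1_L1 Hf.
apply/eqP; rewrite -subr_eq0 -PextZ// -PextB; [|by []|exact: L1_EM|exact: L1Z].
apply/eqP.
transitivity (cint (fun t => (1 - cabs z ^+ 2)%:C%C * (E 1 t * (K z t * f t)))).
  apply: cint_eq => t _.
  suff e : (poisson z t)%:C%C * (E 1 t - z) = (1 - cabs z ^+ 2)%:C%C * (E 1 t * K z t).
    by rewrite -mulrBl !mulrA e !mulrA.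
  have d0 : E 1 t - z != 0 by rewrite -cabs_gt0 den_gt0.
  have w0 : 1 - z^*%C * E 1 t != 0 by rewrite -cabs_gt0 cabs_den den_gt0.
  have e1 : (E 1 t - z)^*%C = (1 - z^*%C * E 1 t) / E 1 t.
    rewrite conjB -EN; apply: (mulIf (E_neq0 1 t)).
    by rewrite divfK ?E_neq0// mulrBl EK.
  rewrite /poisson E1E rmorphM /= fmorphV /= -mulcC e1 /K.
  by field; rewrite d0 w0 E_neq0.
by rewrite cintZ ?(cint_EK 0 z1 Hf) ?mulr0//; exact/L1_EM/L1K.
Qed.

Lemma Pext_pe z p f : cabs z < 1 -> isH1 f ->
  Pext (fun t => pe p t * f t) z = p.[z] * Pext f z.
Proof.
move=> z1 Hf; have Lf := H1_L1 Hf; elim/poly_ind: p => [|p a IH].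
  have -> : (fun t => pe 0 t * f t) = fun t => 0 * f t.
    by apply/funext => t; rewrite /pe horner0.
  by rewrite PextZ// horner0.
have -> : (fun t => pe (p * 'X + a%:P) t * f t) =
    fun t => E 1 t * (pe p t * f t) + a * f t.
  by apply/funext => t; rewrite /pe hornerMXaddC mulrDl [_ * E 1 t]mulrC mulrA.
have Hp := (H1_peM p Hf).1.
rewrite PextD; [|by []|exact/L1_EM/H1_L1|exact: L1Z].
by rewrite Pext_EM// IH PextZ// hornerMXaddC; ring.
Qed.

Lemma Pext_cst z (c : C) : cabs z < 1 -> Pext (fun=> c) z = c.
Proof.
move=> z1; rewrite -[c in RHS]mulr1 -(_ : Pext (fun=> 1) z = 1).
  by rewrite -PextZ ?mulr1//; exact: L1_cst.
rewrite /Pext; under cint_eq do rewrite mulr1.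
by rewrite cint_real RI_poisson.
Qed.

Lemma Pext0 f : Pext f 0 = fhat f 0.
Proof.
rewrite fhatE; apply: cint_eq => t _.
by rewrite poisson0 oppr0 E0.
Qed.

(** For a polynomial [f] this is [Pext_pe]; at a fixed z the Poisson kernel is bounded, so both
    sides are continuous in [f] for the L^2 norm. *)
Lemma Pext_H2M z f g : cabs z < 1 -> isH2 f -> isH2 g ->
  Pext (fun t => f t * g t) z = Pext f z * Pext g z.
Proof.
move=> z1 Hf Hg; have Lf := H2_L2 Hf; have Lg := H2_L2 Hg.
have [M M0 hM] := poisson_bound z1.
apply: eq_of_cabs_le => e e0.
pose B := M * Num.sqrt (n2 g) + M * cabs (Pext g z) + 1.
have B0 : 0 < B.
  by rewrite ltr_wpDl// addr_ge0// mulr_ge0 ?cabs_ge0 ?sqrtr_ge0// ltW.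
pose d := e / B; have d0 : 0 < d by exact: divr_gt0.
have [p hp] := H2_approx Hf (exprn_gt0 2 d0).
have Ld := L2B Lf (L2_pe p).
have sd : Num.sqrt (n2 (fun t => f t - pe p t)) <= d.
  by rewrite -[leRHS](ger0_norm (ltW d0)) -sqrtr_sqr ler_wsqrtr.
have bnd h : isL1 h -> cabs (Pext h z) <= M * L1norm h.
  move=> Lh; apply: le_trans (cabs_Pext_le z1 Lh) _.
  by apply: RI_poisson_le => //; [exact: L1_intg|move=> t; exact: cabs_ge0].
have e1 : Pext (fun t => f t * g t) z =
    Pext (fun t => (f t - pe p t) * g t) z + p.[z] * Pext g z.
  rewrite -Pext_pe//; last exact: H2_H1.
  rewrite -PextD; [|by []|exact: L2M_L1|exact: L1_peM (L2_L1 Lg)].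
  by congr Pext; apply/funext => t; rewrite -mulrDl subrK.
have e2 : Pext f z = Pext (fun t => f t - pe p t) z + p.[z].
  have -> : p.[z] = Pext (fun t => pe p t * 1) z.
    by rewrite Pext_pe ?Pext_cst ?mulr1//; exact/H2_H1/H2_cst.
  rewrite -PextD; [|by []|exact: L2_L1|exact/L1_peM/L1_cst].
  by congr Pext; apply/funext => t; rewrite mulr1 subrK.
rewrite e1 e2 mulrDl opprD addrACA subrr addr0.
apply: le_trans (cabsD _ _) _; rewrite cabsN cabsM.
have h1 : cabs (Pext (fun t => (f t - pe p t) * g t) z) <= M * (d * Num.sqrt (n2 g)).
  apply: le_trans (bnd _ (L2M_L1 Ld Lg)) _; rewrite ler_pM2l//.
  apply: le_trans (cauchy_schwarz Ld Lg) _.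
  by rewrite ler_wpM2r ?sqrtr_ge0.
have h2 : cabs (Pext (fun t => f t - pe p t) z) <= M * d.
  apply: le_trans (bnd _ (L2_L1 Ld)) _; rewrite ler_pM2l//.
  exact: le_trans (L1norm_le_n2 Ld) sd.
have h3 := ler_wpM2r (cabs_ge0 (Pext g z)) h2.
have h4 : d * B = e by rewrite /d divfK// gt_eqF.
by rewrite /B in h4; nra.
Qed.

(** The power x^(2^-n); iterating square roots makes the halving of the exponent definitional. *)
Definition rt n (x : R) : R := iter n Num.sqrt x.

Lemma rt_ge0 n x : 0 <= x -> 0 <= rt n x.
Proof. by case: n => // n _; exact: sqrtr_ge0. Qed.

Lemma rtM n x y : 0 <= x -> 0 <= y -> rt n (x * y) = rt n x * rt n y.
Proof.
move=> x0 y0; elim: n => //= n IH.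
by rewrite -!/(rt _ _) IH sqrtrM// rt_ge0.
Qed.

Lemma rtSr n x : rt n (Num.sqrt x) = rt n.+1 x.
Proof. by rewrite /rt -iterSr. Qed.

Lemma rt_sqr n x : 0 <= x -> rt n.+1 x ^+ 2 = rt n x.
Proof. by move=> x0; rewrite sqr_sqrtr// rt_ge0. Qed.

Lemma rt_le n x : 0 <= x -> rt n x <= 1 + x.
Proof.
move=> x0; elim: n => [|n IH]; first by rewrite lerDr.
have := rt_sqr n x0; have := rt_ge0 n.+1 x0; nra.
Qed.

Lemma rt_expR n y : rt n (expR y) = expR (y / 2 ^+ n).
Proof.
elim: n => [|n IH]; first by rewrite expr0 divr1.
rewrite -[LHS]/(Num.sqrt (rt n _)) IH.
have -> : expR (y / 2 ^+ n) = expR (y / 2 ^+ n.+1) ^+ 2.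
  by rewrite -expRM_natl exprS; congr expR; field; rewrite expf_neq0.
by rewrite sqrtr_sqr ger0_norm// expR_ge0.
Qed.

Lemma mI_rt n f : cmeas f -> mI (fun t => rt n (cabs (f t))).
Proof.
move=> mf; elim: n => [|n IH]; first exact: mI_cabs.
by apply: (@mI_sqrt _ (fun t => rt n (cabs (f t)))) => // t; exact/rt_ge0/cabs_ge0.
Qed.

Lemma intg_rt n f : isL1 f -> intg (fun t => rt n (cabs (f t))).
Proof.
move=> Lf; have mr := mI_rt n (L1_cmeas Lf).
apply: intg_le mr (intgD (intg_cst 1) (L1_intg Lf)) _.
by move=> t _; rewrite ger0_norm ?rt_ge0 ?cabs_ge0//; exact/rt_le/cabs_ge0.
Qed.

(* Writing [A F = a b] with [|a|^2 = |b|^2 = A |F|] halves the exponent: the case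
   [2^-n] for [a] and [b] gives the case [2^-(n+1)] for [F]. *)
Lemma rt_Pext_le n f z : isH1 f -> fhat f 0 != 0 -> cabs z < 1 ->
  rt n (cabs (Pext f z)) <= RI (fun t => poisson z t * rt n (cabs (f t))).
Proof.
move=> + + z1; elim: n f => [|n IH] f Hf f0; first exact: cabs_Pext_le (H1_L1 Hf).
have [A [a [b [U [[A0 Ha Hb _] [_ _ H]]]]]] := szego_factorization Hf f0.
have AC0 : A%:C%C != 0 :> C by rewrite -cabs_gt0 cabs_real ger0_norm// ltW.
have mf := L1_cmeas (H1_L1 Hf).
have mab : cmeas (fun t => a t * b t) by exact/L1_cmeas/H1_L1/H2M_H1.
have abF : aeI (fun t => a t * b t = A%:C%C * f t).
  by apply: aeIS H _ => t _ [_ [_ _ ->]].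
have ab0 : fhat a 0 * fhat b 0 != 0.
  have := fhat_convH2 0 Ha Hb; rewrite big_nat1 subrr => <-.
  rewrite (fhat_ae 0 mab (cmeasM (cmeas_cst A%:C%C) mf) abF).
  by rewrite fhatZ ?mulf_neq0//; exact: H1_L1.
have {}ab0 : (fhat a 0 != 0) /\ (fhat b 0 != 0) by move: ab0; rewrite mulf_eq0 negb_or => /andP.
have Pab : Pext a z * Pext b z = A%:C%C * Pext f z.
  rewrite -Pext_H2M// (Pext_ae _ mab (cmeasM (cmeas_cst A%:C%C) mf) abF).
  by rewrite PextZ//; exact: H1_L1.
set I := RI _; pose rho := rt n.+1 A.
have I0 : 0 <= I.
  by apply: RI_ge0 => t _; rewrite mulr_ge0 ?poisson_ge0// rt_ge0// cabs_ge0.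
(* Since |h| = sqrt (A |f|), the case [n] for [h] involves the root of order [n.+1] of |f|, up to
   the factor [rho]. Multiplying the bounds for [a] and [b] gives rho^2 = [rt n A], which cancels
   against the A in a b = A f. *)
have key h : isH2 h -> fhat h 0 != 0 ->
    aeI (fun t => cabs (h t) ^+ 2 = A * cabs (f t)) ->
    rt n (cabs (Pext h z)) <= rho * I.
  move=> Hh h0 hh; apply: le_trans (IH h (H2_H1 Hh) h0) _.
  rewrite le_eqVlt; apply/orP; left; apply/eqP.
  rewrite /I -RIZ; last exact/intg_poisson/intg_rt/H1_L1.
  have mh : cmeas h by exact/L2_cmeas/H2_L2.
  apply: RI_ae.
  - exact: mI_M (mI_poisson z) (mI_rt n mh).
  - exact: mI_M (mI_cst _) (mI_M (mI_poisson z) (mI_rt n.+1 mf)).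
  - apply: aeIS hh _ => t _ e.
    have -> : cabs (h t) = Num.sqrt (A * cabs (f t)).
      by rewrite -e sqrtr_sqr ger0_norm ?cabs_ge0.
    by rewrite rtSr rtM ?cabs_ge0 ?(ltW A0)// mulrCA.
have ha := key a Ha ab0.1 (aeIS H (fun t _ h => let: conj _ (And5 h1 _ _ _ _) := h in h1)).
have hb := key b Hb ab0.2 (aeIS H (fun t _ h => let: conj _ (And5 _ h1 _ _ _) := h in h1)).
have Ap : 0 <= A := ltW A0.
have : rt n (cabs (Pext a z)) * rt n (cabs (Pext b z)) <= (rho * I) ^+ 2.
  by rewrite expr2; apply: ler_pM => //; exact/rt_ge0/cabs_ge0.
rewrite -rtM ?cabs_ge0// -cabsM Pab cabsM cabs_real ger0_norm//.
rewrite rtM ?cabs_ge0// exprMn rt_sqr//.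
have rA : 0 < rt n A.
  have [y <-] : exists y, expR y = A by exists (ln A); rewrite lnK.
  by rewrite rt_expR expR_gt0.
rewrite ler_pM2l// => h.
by rewrite -[I]ger0_norm// -sqrtr_sqr; exact: ler_wsqrtr.
Qed.

(** The difference quotient (x^s - 1) / s at s = 2^-n, which for x > 0 decreases to ln x. *)
Let D n (x : R) : R := 2 ^+ n * (rt n x - 1).

Let p2 n : 0 < 2 ^+ n :> R. Proof. by rewrite exprn_gt0. Qed.

Let D_le n x : 0 <= x -> D n x <= x - 1.
Proof.
move=> x0; elim: n => [|n IH]; first by rewrite /D expr0 mul1r.
apply: le_trans IH; rewrite /D exprS [2 * _]mulrC -mulrA ler_pM2l// -(rt_sqr n x0).
have := sqr_ge0 (rt n.+1 x - 1); nra.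
Qed.

Let D_ln n x : 0 < x -> ln x <= D n x.
Proof.
move=> x0; rewrite /D -{2}(lnK x0) rt_expR.
have := expR_ge1Dx (ln x / 2 ^+ n).
rewrite -lerBrDl ler_pdivrMr// mulrC; exact.
Qed.

Let D_cvg x : 0 < x -> D n x @[n --> \oo] --> ln x.
Proof.
move=> x0; pose y := ln x.
have yn : y / 2 ^+ n @[n --> \oo] --> 0.
  rewrite -[X in _ --> X](mulr0 y); apply: cvgMr.
  have -> : (fun n => (2 ^+ n)^-1) = (fun n => (2^-1 : R) ^+ n).
    by apply/funext => n; rewrite exprVn.
  by apply: cvg_expr; rewrite ger0_norm; lra.
have hi : y * expR (y / 2 ^+ n) @[n --> \oo] --> y.
  have h : expR (y / 2 ^+ n) @[n --> \oo] --> (1 : R).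
    by have := cvg_comp _ _ yn (@continuous_expR R 0); rewrite expR0.
  by rewrite -[X in _ --> X]mulr1; exact: cvgMr h.
apply: (@squeeze_cvgr _ _ _ _ (fun=> y) (fun n => y * expR (y / 2 ^+ n))).
- apply: nearW => n; rewrite D_ln//=.
  rewrite /D -{1}(lnK x0) rt_expR -/y.
  have := expR_ge1Dx (- (y / 2 ^+ n)); rewrite expRN => h.
  have e0 := expR_gt0 (y / 2 ^+ n).
  have h2 : expR (y / 2 ^+ n) - 1 <= y / 2 ^+ n * expR (y / 2 ^+ n).
    have := ler_wpM2r (ltW e0) h; rewrite mulVf ?gt_eqF//; lra.
  have := ler_wpM2l (ltW (p2 n)) h2.
  by rewrite mulrA [2 ^+ n * (y / _)]mulrC divfK ?gt_eqF.
- exact: cvg_cst.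
- exact: hi.
Qed.

(** [rt_Pext_le] becomes an inequality for [D n], whose limit is the logarithm. Fatou applies
    because |f| - 1 - D n is nonnegative, and it yields the integrability of ln |f| together with
    the inequality. *)
Lemma jensen f : isH1 f -> fhat f 0 != 0 ->
  intg (fun t => ln (cabs (f t))) /\
  forall z, cabs z < 1 -> Pext f z != 0 ->
    ln (cabs (Pext f z)) <= RI (fun t => poisson z t * ln (cabs (f t))).
Proof.
move=> Hf f0; have Lf := H1_L1 Hf; have mf := L1_cmeas Lf.
have nz : aeI (fun t => f t != 0).
  have [A [a [b [U [_ [_ _ H]]]]]] := szego_factorization Hf f0.
  by apply: aeIS H _ => t _ [].
pose g n t := cabs (f t) - 1 - D n (cabs (f t)).
have g0 n t : 0 <= g n t by rewrite subr_ge0 D_le// cabs_ge0.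
have i1 : intg (fun t => cabs (f t) - 1) by exact: intgB (L1_intg Lf) (intg_cst _).
have iD n : intg (fun t => D n (cabs (f t))).
  by apply: intgZ; apply: intgB (intg_cst _); exact: intg_rt.
have ig n : intg (g n) by exact: intgB.
have mln : mI (fun t => cabs (f t) - 1 - ln (cabs (f t))).
  exact: mI_B (intg_mI i1) (mI_ln (mI_cabs mf)).
have key z : cabs z < 1 -> Pext f z != 0 ->
    intg (fun t => poisson z t * (cabs (f t) - 1 - ln (cabs (f t)))) /\
    RI (fun t => poisson z t * (cabs (f t) - 1 - ln (cabs (f t)))) <=
      RI (fun t => poisson z t * (cabs (f t) - 1)) - ln (cabs (Pext f z)).
  move=> z1 fz; apply: (@RI_fatou _ (fun n t => poisson z t * g n t)).
  - by move=> n; exact: intg_poisson.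
  - by move=> n t _; rewrite mulr_ge0 ?poisson_ge0.
  - exact: mI_M (mI_poisson z) mln.
  - apply: aeIS nz _ => t _ ft; apply: cvgMr; apply: cvgB; first exact: cvg_cst.
    by apply: D_cvg; rewrite cabs_gt0.
  - move=> n.
    have -> : RI (fun t => poisson z t * g n t) =
        RI (fun t => poisson z t * (cabs (f t) - 1)) -
        RI (fun t => poisson z t * D n (cabs (f t))).
      rewrite -RIB; [|exact: intg_poisson..].
      by apply: RI_eq => t _; rewrite mulrBr.
    rewrite lerD2l lerN2.
    apply: (@le_trans _ _ (D n (cabs (Pext f z)))).
      by apply: D_ln; rewrite cabs_gt0.
    have -> : RI (fun t => poisson z t * D n (cabs (f t))) =
        2 ^+ n * (RI (fun t => poisson z t * rt n (cabs (f t))) - 1).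
      have ip : intg (poisson z).
        by have := intg_poisson z1 (intg_cst 1); under eq_fun do rewrite mulr1.
      have ipr : intg (fun t => poisson z t * rt n (cabs (f t))).
        exact/intg_poisson/intg_rt.
      rewrite -[X in _ - X](RI_poisson z1) -RIB// -RIZ; last exact: intgB.
      by apply: RI_eq => t _; rewrite /D; ring.
    by rewrite ler_pM2l// lerD2r; exact: rt_Pext_le.
(* At z = 0 the Poisson kernel is 1, and [key] there gives integrability without a weight. *)
have iln : intg (fun t => ln (cabs (f t))).
  have z0 : cabs (0 : C) < 1 by rewrite cabs0.
  have P0 : Pext f 0 != 0 by rewrite Pext0.
  have [i0 _] := key 0 z0 P0.
  by have := intgB i1 i0; under eq_fun do rewrite poisson0 mul1r opprB addrC subrK.
split => // z z1 fz; have [_] := key z z1 fz.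
have -> : RI (fun t => poisson z t * (cabs (f t) - 1 - ln (cabs (f t)))) =
    RI (fun t => poisson z t * (cabs (f t) - 1)) -
    RI (fun t => poisson z t * ln (cabs (f t))).
  rewrite -RIB; [|exact: intg_poisson..].
  by apply: RI_eq => t _; rewrite mulrBr.
by rewrite lerD2l lerN2.
Qed.

End Poisson.

(** * Outer functions and rigidity *)

Section Rigidity.
Variable R : realType.
Local Notation C := R[i].
Implicit Types (f g w F U : R -> C) (k : R -> R) (z : C).

Lemma ln_le_sub1 (x : R) : 0 < x -> ln x <= x - 1.
Proof. by move=> x0; have := expR_ge1Dx (ln x); rewrite lnK ?posrE//; lra. Qed.

Lemma ln_cabsM (z v : C) : z != 0 -> v != 0 -> ln (cabs (z * v)) = ln (cabs z) + ln (cabs v).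
Proof. by move=> z0 v0; rewrite cabsM lnM// posrE cabs_gt0. Qed.

Lemma fhat_cst (c : C) (m : int) : fhat (fun=> c) m = c * (m == 0)%:R.
Proof.
rewrite fhatE (cint_eq (g := fun t => c * E (- m) t)); last by move=> t _; rewrite mulrC.
by rewrite cintZ ?cint_E ?oppr_eq0//; exact: L1E.
Qed.

Lemma H1_cst (c : C) : isH1 (fun=> c).
Proof. exact/H2_H1/H2_cst. Qed.

Lemma H1_real_const k : isH1 (fun t => (k t)%:C%C) -> exists c, aeI (fun t => k t = c).
Proof.
move=> [Lk k0]; exists (complex.Re (fhat (fun t => (k t)%:C%C) 0)).
have kJ (m : int) : fhat (fun t => (k t)%:C%C) m = (fhat (fun t => (k t)%:C%C) (- m))^*%C.
  rewrite -fhatJ//; apply: fhat_eq => t.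
  by apply: complex_ext; rewrite ?ReJ ?ImJ //= oppr0.
have := fhat_ae_eq Lk (L1_cst (fhat (fun t => (k t)%:C%C) 0)).
move=> H; apply: aeIS (H _) _ => [m|t _ <-//].
rewrite fhat_cst; have [->|] := eqVneq m 0; first by rewrite mulr1.
rewrite neq_lt mulr0 => /orP[|] m0; first exact: k0.
by rewrite kJ k0 ?oppr_lt0// conjc0.
Qed.

(** The square norm A^2 of U is already exhausted by its mean, so Bessel's identity leaves nothing
    for the rest of U. *)
Lemma unimodular_const U (A : R) : isL2 U -> aeI (fun t => cabs (U t) = A) ->
  A <= cabs (fhat U 0) -> aeI (fun t => U t = fhat U 0).
Proof.
move=> LU UA hA.
have A0 : 0 <= A by have [t _ <-] := aeI_exists UA; exact: cabs_ge0.
have := bessel 1 LU; rewrite big_nat1.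
have -> : n2 U = A ^+ 2.
  rewrite -[RHS](@RI_cst R); apply: RI_ae.
  - exact: mI_X (mI_cabs (L2_cmeas LU)).
  - exact: mI_cst.
  - by apply: aeIS UA _ => t _ ->.
move=> e.
have Ld : isL2 (fun t => U t - \sum_(0 <= j < 1) fhat U j * E j t).
  exact: L2B LU (L2_sumE _ _ _).
have n0 : n2 (fun t => U t - \sum_(0 <= j < 1) fhat U j * E j t) = 0.
  apply/le_anti; rewrite n2_ge0 andbT e subr_le0.
  by rewrite ler_pXn2r ?nnegrE ?cabs_ge0.
apply: aeIS (n2_eq0 Ld n0) _ => t _ /eqP; rewrite subr_eq0 big_nat1 E0 mulr1.
by move/eqP.
Qed.

Lemma inner_nonconst w : inner w -> ~ is_const w -> cabs (fhat w 0) < 1.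
Proof.
move=> [Hw w1] nc; rewrite ltNge; apply/negP => h; apply: nc.
by exists (fhat w 0); apply: unimodular_const w1 h; exact/H2_L2/Hinf_H2.
Qed.

(** Once the zero at the origin is divided out, nonvanishing comes with the Szegő factorization. *)
Lemma H1_neq0 f : isH1 f -> ~ aeI (fun t => f t = 0) -> aeI (fun t => f t != 0).
Proof.
move=> Hf nz; have [m [g [Hg g0 fg]]] := H1_order Hf nz.
have [A [a [b [U [_ [_ _ H]]]]]] := szego_factorization Hg g0.
by apply: aeIS H _ => t _ [gt _]; rewrite fg mulf_neq0// E_neq0.
Qed.

Definition rigid F : Prop := forall k (M : R), mI k -> aeI (fun t => `|k t| <= M) ->
  isH1 (fun t => (k t)%:C%C * F t) -> exists c, aeI (fun t => k t = c).

(** The outer identity at 0 and Jensen for b force U to be a constant c, so p_n^2 F tends to c in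
    L^1. For bounded k the H^1 functions p_n^2 k F then tend to c k; hence k is a real function in
    H^1. *)
Lemma outer_rigid F : outer F -> rigid F.
Proof.
move=> [HF nzF _ _ jF] k M mk kM HkF; have LF := H1_L1 HF.
have z0 : cabs (0 : C) < 1 by rewrite cabs0.
have F0 : fhat F 0 != 0 by rewrite -Pext0 nzF.
have [A [a [b [U [[A0 Ha Hb HU] [b0 pU H]]]]]] := szego_factorization HF F0.
have LU := H1_L1 HU.
have AC : cabs (A%:C%C : C) = A by rewrite cabs_real ger0_norm// ltW.
have lnF : ln (cabs (fhat F 0)) = RI (fun t => ln (cabs (F t))).
  have := jF 0 z0; rewrite Pext0 => ->.
  by apply: (@RI_eq R) => t _; rewrite poisson0 mul1r.
(* As |b|^2 = A |F| and b has mean A, Jensen at 0 reads ln A <= (ln A + ln |F(0)|) / 2, where F(0)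
   is the mean of F. *)
have AF : A <= cabs (fhat F 0).
  have b0' : fhat b 0 != 0 by rewrite b0 -cabs_gt0 AC.
  have [ib jb] := jensen (H2_H1 Hb) b0'.
  have [iF _] := jensen HF F0.
  have Pb : Pext b 0 != 0 by rewrite Pext0.
  have := jb 0 z0 Pb; rewrite Pext0 b0 AC.
  have -> : RI (fun t => poisson 0 t * ln (cabs (b t))) =
      2^-1 * (ln A + RI (fun t => ln (cabs (F t)))).
    rewrite -[ln A](@RI_cst R) -RID//; last exact: intg_cst.
    rewrite -RIZ; last exact: intgD (intg_cst _) iF.
    apply: RI_ae.
    - exact: mI_M (mI_poisson _) (intg_mI ib).
    - exact: intg_mI (intgZ _ (intgD (intg_cst _) iF)).
    - apply: aeIS H _ => t _ [Ft [_ bF _ _ _]]; rewrite poisson0 mul1r.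
      have Fp : 0 < cabs (F t) by rewrite cabs_gt0.
      have bp : 0 < cabs (b t).
        rewrite lt_def cabs_ge0 andbT; apply/eqP => bt.
        by have := mulr_gt0 A0 Fp; rewrite -bF bt expr0n ltxx.
      have := congr1 (@ln R) bF; rewrite lnXn// lnM ?posrE// mulr2n => h.
      by lra.
  by move=> h; rewrite -ler_ln ?posrE ?cabs_gt0// lnF; lra.
(* Every p^2 F has the mean of F because p(0) = 1. *)
have U0 : fhat U 0 = fhat F 0.
  apply: fhat_lim => // e e0; have [p p0 hp] := pU e e0.
  exists (fun t => pe (p * p) t * F t); first exact: L1_peM.
  by split => //; rewrite (H1_peM _ HF).2 hornerM p0 !mul1r.
have UA : aeI (fun t => cabs (U t) = A).
  by apply: aeIS H _ => t _ [_ [_ _ _ -> _]].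
have L2U : isL2 U.
  by apply: (@L2_bound_ae _ _ A) (L1_cmeas LU) _; apply: aeIS UA _ => t _ ->.
have := unimodular_const L2U UA; rewrite U0 => /(_ AF) Uc.
set c := fhat F 0 in Uc F0.
have mkC := cmeas_real mk.
have kMC : aeI (fun t => cabs ((k t)%:C%C : C) <= `|M| + 1).
  apply: aeIS kM _ => t _ h; rewrite cabs_real; apply: le_trans h _.
  by apply: le_trans (ler_norm _) _; rewrite lerDl.
have M0 : 0 < `|M| + 1 by rewrite ltr_wpDl.
have Hkc : isH1 (fun t => (k t)%:C%C * c).
  apply: H1_closed; first exact: L1M_bound_ae (L1_cst c) mkC kMC.
  move=> e e0; have [p p0 hp] := pU (e / (`|M| + 1)) (divr_gt0 e0 M0).
  have Lp := L1_peM (p * p) LF.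
  exists (fun t => pe (p * p) t * ((k t)%:C%C * F t)).
    exact: (H1_peM _ HkF).1.
  rewrite (L1norm_ae (g := fun t => (k t)%:C%C * (U t - pe (p * p) t * F t))).
  - apply: le_trans (L1normM_bound_ae (L1B LU Lp) mkC kMC) _.
    by rewrite mulrC -ler_pdivlMr.
  - apply: cmeasB; first exact: cmeasM mkC (cmeas_cst _).
    exact: cmeasM (cmeas_pe _) (cmeasM mkC (L1_cmeas LF)).
  - exact: cmeasM mkC (L1_cmeas (L1B LU Lp)).
  - by apply: aeIS Uc _ => t _ ->; ring.
apply: H1_real_const; have := H1Z c^-1 Hkc.
by under eq_fun do rewrite mulrCA mulVf// mulr1.
Qed.

Lemma ReE_nonconst (c : R) : ~ aeI (fun t => complex.Re (E 1 t) = c).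
Proof.
move=> H; have LN : isL1 (@E R (-1)) by exact: L1E.
have e : fhat (fun t => E 1 t + E (-1) t) 1 = fhat (fun=> (2 * c)%:C%C) 1.
  apply: fhat_ae; [exact: cmeasD (cmeasE _ _) (cmeasE _ _)|exact: cmeas_cst|].
  apply: aeIS H _ => t _ h; rewrite EN.
  by apply: complex_ext; rewrite ?ReD ?ImD ?ReJ ?ImJ ?h /= ?subrr//; ring.
move: e; rewrite fhatD ?fhat_cst ?fhat_E//=; last exact: L1E.
by rewrite mulr0 addr0 => /eqP; rewrite oner_eq0.
Qed.

Lemma real_mul_H1 F U : isH1 (fun t => U t * F t) -> isH1 (fun t => (U t)^*%C * F t) ->
  isH1 (fun t => (complex.Re (U t))%:C%C * F t) /\
  isH1 (fun t => (complex.Im (U t))%:C%C * F t).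
Proof.
move=> H1 H2; split.
  have := H1Z (2^-1)%:C%C (H1D H1 H2).
  rewrite (_ : (fun t => _) = fun t => (complex.Re (U t))%:C%C * F t)//.
  apply/funext => t; rewrite -mulrDl mulrA; congr (_ * _).
  by apply: complex_ext; rewrite ?ReM ?ImM ?ReD ?ImD ?ReJ ?ImJ /=; lra.
have := H1Z (Complex 0 (- 2^-1)) (H1B H1 H2).
rewrite (_ : (fun t => _) = fun t => (complex.Im (U t))%:C%C * F t)//.
apply/funext => t; rewrite -mulrBl mulrA; congr (_ * _).
by apply: complex_ext; rewrite ?ReM ?ImM ?ReD ?ImD ?ReN ?ImN ?ReJ ?ImJ /=; lra.
Qed.

Lemma H1_shift f : isH1 f -> fhat f 0 = 0 -> isH1 (fun t => E (-1) t * f t).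
Proof.
move=> Hf f0; split; first exact/L1_EM/H1_L1.
move=> m m0; rewrite fhatEM opprK.
have [->|m1] := eqVneq m (-1); first by rewrite addNr.
by apply: Hf.2; rewrite lt_neqAle lezD1 m0 andbT addr_eq0.
Qed.

(** If the mean vanishes, conj(ζ) F is still in H^1, hence so is F Re ζ, although Re ζ is bounded,
    real and not constant. *)
Lemma rigid_fhat0 F : isH1 F -> rigid F -> fhat F 0 != 0.
Proof.
move=> HF rF; apply/eqP => F0.
have HE : isH1 (fun t => (E 1 t)^*%C * F t).
  by have := H1_shift HF F0; under eq_fun do rewrite EN.
have [HR _] := real_mul_H1 (H1_EM 1 HF) HE.
have E1 : aeI (fun t => `|complex.Re (E 1 t : C)| <= 1).
  by apply: aeI_all => t _; apply: le_trans (normRe_le _) _; rewrite cabsE.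
have [c] := rF _ 1 (cmeasE R 1).1 E1 HR.
exact: ReE_nonconst.
Qed.

(* The weights [p^2 F] of the Szego extremal problem tend to [U] in L^1; rigidity
   makes [U] constant, so [2 ln|p| + ln|F|] is asymptotically constant and the
   Jensen inequalities of [p] and [F] both become equalities. *)
Lemma rigid_outer F : isH1 F -> rigid F -> outer F.
Proof.
move=> HF rF; have LF := H1_L1 HF; have F0 := rigid_fhat0 HF rF.
have [A [a [b [U [[A0 Ha Hb HU] [b0 pU H]]]]]] := szego_factorization HF F0.
have mU := L1_cmeas (H1_L1 HU).
have UA : aeI (fun t => cabs (U t) = A).
  by apply: aeIS H _ => t _ [_ [_ _ _ -> _]].
have nzF : aeI (fun t => F t != 0) by apply: aeIS H _ => t _ [].
have HiU : isHinf U.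
  split; last by case: HU.
  by case: mU => m1 m2; split => //; exists A; apply: aeIS UA _ => t _ ->.
have AC0 : A%:C%C != 0 :> C by rewrite -cabs_gt0 cabs_real ger0_norm// ltW.
(* From U b = A a, a b = A F and |U| = A it follows that conj(U) F = b^2. *)
have HJ : isH1 (fun t => (U t)^*%C * F t).
  apply: H1_ae (H2M_H1 Hb Hb) _ _; first exact: cmeasM (cmeasJ mU) (L1_cmeas LF).
  apply: aeIS H _ => t _ [_ [_ _ abF Ut Ub]].
  have UU : U t * (U t)^*%C = A%:C%C * A%:C%C by rewrite mulcC Ut expr2 rmorphM.
  apply: (mulfI (mulf_neq0 AC0 AC0)).
  transitivity ((U t)^*%C * (A%:C%C * (A%:C%C * F t))); first by ring.
  rewrite -abF; transitivity ((U t)^*%C * b t * (A%:C%C * a t)); first by ring.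
  by rewrite -Ub -UU; ring.
have [HR HI] := real_mul_H1 (HinfM_H1 HiU HF) HJ.
have [|x hx] := rF _ A mU.1 _ HR.
  by apply: aeIS UA _ => t _ <-; exact: normRe_le.
have [|y hy] := rF _ A mU.2 _ HI.
  by apply: aeIS UA _ => t _ <-; exact: normIm_le.
pose c : C := Complex x y.
have Uc : aeI (fun t => U t = c).
  by apply: aeIS2 hx hy _ => t _ h1 h2; apply: complex_ext.
have cA : cabs c = A.
  have : aeI (fun t => U t = c /\ cabs (U t) = A) by apply: aeIS2 Uc UA _.
  by move=> /aeI_exists[t _ [<-]].
have pc e : 0 < e -> exists2 p, p.[0] = 1 & L1norm (fun t => c - pe (p * p) t * F t) <= e.
  move=> e0; have [p p0 hp] := pU e e0; exists p => //.
  rewrite (L1norm_ae (g := fun t => U t - pe (p * p) t * F t))//.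
  - exact/L1_cmeas/(L1B (L1_cst _))/L1_peM.
  - exact/L1_cmeas/(L1B (H1_L1 HU))/L1_peM.
  - by apply: aeIS Uc _ => t _ ->.
have [iF jF] := jensen HF F0.
(* L^1 closeness of p^2 F to c passes to Poisson means at z, where the kernel is bounded; in
   particular the extension of F cannot vanish there. *)
have approx z : cabs z < 1 -> forall x : R, 0 < x -> exists2 p, p.[0] = 1 &
    RI (fun t => poisson z t * cabs (c - pe (p * p) t * F t)) <= A * x /\
    A * (1 - x) <= cabs (p.[z] * p.[z] * Pext F z).
  move=> z1 x0 x00; have [M M0 hM] := poisson_bound z1.
  have [|p p0 hp] := pc (A * x0 / M).
    by rewrite divr_gt0// mulr_gt0.
  exists p => //.
  have Ld := L1B (L1_cst c) (L1_peM (p * p) LF).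
  have h1 : RI (fun t => poisson z t * cabs (c - pe (p * p) t * F t)) <= A * x0.
    apply: le_trans (RI_poisson_le z1 hM (L1_intg Ld) (fun t => cabs_ge0 _)) _.
    by rewrite mulrC -ler_pdivlMr.
  split => //; have := le_trans (cabs_Pext_le z1 Ld) h1.
  rewrite PextB//; [|exact: L1_cst|exact: L1_peM].
  rewrite Pext_cst// Pext_pe// hornerM => h2.
  have := cabsD (c - p.[z] * p.[z] * Pext F z) (p.[z] * p.[z] * Pext F z).
  by rewrite subrK cA; nra.
have nzP z : cabs z < 1 -> Pext F z != 0.
  move=> z1; have [|p _ [_ h]] := approx z z1 2^-1; first by rewrite invr_gt0.
  apply/eqP => Fz; move: h; rewrite Fz mulr0 cabs0; nra.
split => // z z1; apply/le_anti/andP; split; first exact: jF (nzP z z1).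
change (RI (fun t => poisson z t * ln (cabs (F t))) <= ln (cabs (Pext F z))).
apply/ler_addgt0Pl => d d0.
(* [main] costs x0, and ln (1 - x0) >= - 2 x0, valid up to 1/2, costs 2 x0; a third of [d] pays for
   both. *)
pose x0 := Num.min (d / 3) 2^-1.
have x00 : 0 < x0 by rewrite lt_min divr_gt0 //= invr_gt0.
have [x0d x02] : x0 <= d / 3 /\ x0 <= 2^-1.
  by split; rewrite ge_min lexx ?orbT.
have [p p0 [hp hz]] := approx z z1 x0 x00.
have Ax : 0 < A * (1 - x0) by rewrite mulr_gt0//; lra.
have pF0 : p.[z] * p.[z] * Pext F z != 0.
  by rewrite -cabs_gt0; exact: lt_le_trans hz.
have pz : p.[z] != 0.
  by apply/eqP => e; move: pF0; rewrite e !mul0r eqxx.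
have Hp : isH1 (pe p) /\ fhat (pe p) 0 = 1.
  have := H1_peM p (H1_cst 1); rewrite fhat_cst p0 !mulr1.
  by under eq_fun do rewrite mulr1.
have Pp : Pext (pe p) z = p.[z].
  have := Pext_pe p z1 (H1_cst 1); rewrite Pext_cst// mulr1 => <-.
  by congr Pext; apply/funext => t; rewrite mulr1.
have p00 : fhat (pe p) 0 != 0 by rewrite Hp.2 oner_eq0.
have nzp : aeI (fun t => pe p t != 0).
  have [A' [a' [b' [U' [_ [_ _ H']]]]]] := szego_factorization Hp.1 p00.
  by apply: aeIS H' _ => t _ [].
have [ip jp] := jensen Hp.1 p00.
have := jp z z1; rewrite Pp => /(_ pz) {}jp.
have Ld := L1B (L1_cst c) (L1_peM (p * p) LF).
have iP : intg (poisson z).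
  by have := intg_poisson z1 (intg_cst 1); under eq_fun do rewrite mulr1.
have main : RI (fun t => poisson z t * ln (cabs (F t))) +
    2 * RI (fun t => poisson z t * ln (cabs (pe p t))) <= ln A + x0.
  have i1 := intg_poisson z1 iF; have i2 := intg_poisson z1 ip.
  have i3 := intg_poisson z1 (L1_intg Ld).
  rewrite -RIZ// -RID//; last exact: intgZ.
  apply: (@le_trans _ _ (RI (fun t => ln A * poisson z t +
      A^-1 * (poisson z t * cabs (c - pe (p * p) t * F t))))).
    apply: RI_le_ae; [exact: intgD (intgZ _ _)|exact: intgD (intgZ _ _) (intgZ _ _)|].
    apply: aeIS2 nzF nzp _ => t _ Ft pt.
    have P0 := poisson_ge0 t z1.
    have ppF : pe (p * p) t * F t = pe p t * pe p t * F t by rewrite /pe hornerM.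
    set Q := cabs (c - pe (p * p) t * F t).
    suff h : ln (cabs (F t)) + 2 * ln (cabs (pe p t)) <= ln A + A^-1 * Q.
      by have := ler_wpM2l P0 h; nra.
    have q0 : 0 < cabs (pe p t * pe p t * F t).
      by rewrite cabs_gt0 !mulf_neq0.
    have e : ln (cabs (pe p t * pe p t * F t)) = ln (cabs (F t)) + 2 * ln (cabs (pe p t)).
      by rewrite !ln_cabsM ?mulf_neq0//; ring.
    (* With q = |p^2 F| the bound ln q <= ln A + q / A - 1 linearizes the logarithm at the limiting
       value A, and q <= A + Q. *)
    have := ln_le_sub1 (divr_gt0 q0 A0).
    rewrite lnM ?posrE ?invr_gt0// lnV ?posrE// e.
    have h1 : cabs (pe p t * pe p t * F t) <= A + Q.
      rewrite -cA /Q -ppF cabs_distC.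
      by apply: le_trans (cabsD _ _); rewrite subrKC.
    have : cabs (pe p t * pe p t * F t) / A <= 1 + A^-1 * Q.
      by rewrite ler_pdivrMr// mulrDl mul1r [A^-1 * Q]mulrC divfK// gt_eqF.
    lra.
  rewrite RID; [|exact: intgZ..].
  rewrite (RIZ _ iP) (RIZ _ i3) RI_poisson// mulr1 lerD2l.
  by rewrite mulrC ler_pdivrMr// [x0 * A]mulrC.
have lz : ln (cabs (p.[z] * p.[z] * Pext F z)) = ln (cabs (Pext F z)) + 2 * ln (cabs p.[z]).
  by rewrite !ln_cabsM ?mulf_neq0 ?nzP//; ring.
have : ln (A * (1 - x0)) <= ln (cabs (p.[z] * p.[z] * Pext F z)).
  by rewrite ler_ln ?posrE ?cabs_gt0.
have y0 : 0 < 1 - x0 by lra.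
rewrite lz lnM ?posrE// => hl.
have : - ln (1 - x0) <= 2 * x0.
  rewrite -lnV ?posrE//; apply: le_trans (ln_le_sub1 _) _; first by rewrite invr_gt0.
  have : (1 - x0)^-1 <= 1 + 2 * x0.
    by rewrite -[_^-1]mul1r ler_pdivrMr//; nra.
  lra.
have xd : 3 * x0 <= d by lra.
lra.
Qed.

End Rigidity.

(** * Extreme points of the unit ball of the quotient *)

Section InnerFunctions.
Variable R : realType.
Local Notation C := R[i].
Implicit Types (f g w th : R -> C).

Lemma inner_cmeas w : inner w -> cmeas w.
Proof. by move=> [Hw _]; exact/L2_cmeas/H2_L2/Hinf_H2. Qed.

Lemma innerM v w : inner v -> inner w -> inner (fun t : R => v t * w t).
Proof.
move=> Iv Iw; have [Hv v1] := Iv; have [Hw w1] := Iw.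
have mvw := cmeasM (inner_cmeas Iv) (inner_cmeas Iw).
have u : aeI (fun t => cabs (v t * w t) = 1).
  by apply: aeIS2 v1 w1 _ => t _ h1 h2; rewrite cabsM h1 h2 mulr1.
split=> //; split; last by have [] := HinfM_H1 Hv (H2_H1 (Hinf_H2 Hw)).
by case: mvw => m1 m2; split=> //; exists 1; apply: aeIS u _ => t _ ->.
Qed.

Lemma innerE (n : nat) : inner (@E R n).
Proof.
have h1 : aeI (fun t => cabs (E n t : C) = 1) by apply: aeI_all => t _; exact: cabsE.
split=> //; split.
  have [m1 m2] := cmeasE R n; split=> //; exists 1.
  by apply: aeIS h1 _ => t _ ->.
by move=> k k0; rewrite fhat_E lt_eqF//; exact: lt_le_trans k0 _.
Qed.

Lemma innerX w n : inner w -> inner (fun t => w t ^+ n).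
Proof.
move=> Iw; elim: n => [|n IH].
  by have := innerE 0; rewrite (_ : E 0 = fun t => w t ^+ 0)//; apply/funext => t; rewrite E0.
by under eq_fun do rewrite exprS; exact: innerM.
Qed.

(* Comparing [n]-th coefficients in [g = w g'] shows, by induction on [n], that
   they shrink by the factor [|w^(0)| < 1] at each division. *)
Lemma inner_divisible_eq0 w (B : R) (S : (R -> C) -> Prop) :
  inner w -> cabs (fhat w 0) < 1 ->
  (forall g, S g -> isH1 g /\ L1norm g <= B) ->
  (forall g, S g -> exists2 g', S g' & aeI (fun t => g t = w t * g' t)) ->
  forall g, S g -> aeI (fun t => g t = 0).
Proof.
move=> Iw w1 SB Sw; have [Hw _] := Iw; have mw := inner_cmeas Iw.
have coef (n : nat) : forall g, S g -> fhat g n = 0.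
  elim/ltn_ind: n => n IH.
  have bound m : forall g, S g -> cabs (fhat g n) <= cabs (fhat w 0) ^+ m * B.
    elim: m => [|m IHm] g Sg.
      by rewrite mul1r; have [Hg gB] := SB g Sg; apply: le_trans (cabs_fhat_le _ (H1_L1 Hg)) gB.
    have [g' Sg' gg'] := Sw g Sg; have [Hg _] := SB g Sg; have [Hg' _] := SB g' Sg'.
    rewrite (fhat_ae _ (L1_cmeas (H1_L1 Hg)) (cmeasM mw (L1_cmeas (H1_L1 Hg'))) gg').
    (* The coefficients of g' below [n] vanish by induction, so only the term with the mean of w
       survives. *)
    rewrite fhat_convHinf// big_nat_recl// big_nat big1 => [|j /andP[_ jn]].
      by rewrite addr0 subr0 cabsM exprS -mulrA ler_wpM2l ?cabs_ge0// IHm.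
    have -> : n%:Z - j.+1%:Z = (n - j.+1)%N by rewrite subzn.
    by rewrite (IH (n - j.+1)%N) ?mulr0// ltn_subrL (leq_ltn_trans _ jn).
  move=> g Sg; apply: eq_of_cabs_le => e e0; rewrite subr0.
  have [|m hm] := @geometric_small R (cabs (fhat w 0)) B e _ e0; first by rewrite cabs_ge0.
  exact: le_trans (bound m g Sg) hm.
move=> g Sg; have [Hg _] := SB g Sg; apply: fhat_inj; first exact: H1_L1.
by case=> n; [exact: coef|apply: Hg.2].
Qed.

End InnerFunctions.

(** * Norm-preserving tilts and equality in the triangle inequality *)

Section Perturbation.
Variable R : realType.
Local Notation C := R[i].
Implicit Types (f g h F : R -> C) (k : R -> R).

Lemma cabs_half : cabs (2^-1 : C) = 2^-1.
Proof.
rewrite cabsV (_ : (2 : C) = 2%:C%C); first by rewrite cabs_real ger0_norm.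
by apply: complex_ext => //=; rewrite addr0.
Qed.

Lemma realCD (x y : R) : ((x + y)%:C%C : C) = x%:C%C + y%:C%C.
Proof. exact: rmorphD. Qed.

Lemma realCB (x y : R) : ((x - y)%:C%C : C) = x%:C%C - y%:C%C.
Proof. exact: rmorphB. Qed.

Lemma realCM (x y : R) : ((x * y)%:C%C : C) = x%:C%C * y%:C%C.
Proof. exact: rmorphM. Qed.

Lemma realC1 : ((1 : R)%:C%C : C) = 1.
Proof. by []. Qed.

Lemma realCN1 : ((-1 : R)%:C%C : C) = -1.
Proof. by apply: complex_ext => //=; rewrite oppr0. Qed.

Lemma L1normZ (c : C) f : isL1 f -> L1norm (fun t => c * f t) = cabs c * L1norm f.
Proof.
move=> Lf; rewrite !L1normE -RIZ; last exact: L1_intg.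
by apply: RI_eq => t _; rewrite cabsM.
Qed.

Lemma intg_cabsM F k (M : R) : isL1 F -> mI k -> aeI (fun t => `|k t| <= M) ->
  intg (fun t => cabs (F t) * k t).
Proof.
move=> LF mk kM.
apply: intg_le_ae (mI_M (mI_cabs (L1_cmeas LF)) mk) (intgZ M (L1_intg LF)) _.
apply: aeIS kM _ => t _ h; rewrite normrM ger0_norm ?cabs_ge0// mulrC.
by rewrite ler_wpM2r ?cabs_ge0.
Qed.

(** As 1 + k is nonnegative, the modulus is affine in k and the norm changes exactly by the integral
    of |F| k. *)
Lemma L1norm_tilt F k : isL1 F -> mI k -> aeI (fun t => `|k t| <= 1) ->
  RI (fun t => cabs (F t) * k t) = 0 ->
  L1norm (fun t => (1 + k t)%:C%C * F t) = L1norm F.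
Proof.
move=> LF mk k1 k0; have mF := L1_cmeas LF.
have ik := intg_cabsM LF mk k1.
rewrite !L1normE -[RHS]addr0 -k0 -RID//; last exact: L1_intg.
have m1 := mI_D (mI_cst 1) mk.
apply: RI_ae.
- exact: mI_cabs (cmeasM (cmeas_real m1) mF).
- exact: mI_D (mI_cabs mF) (intg_mI ik).
- apply: aeIS k1 _ => t _; rewrite ler_norml => /andP[h1 h2].
  by rewrite cabsM cabs_real ger0_norm; lra.
Qed.

Lemma H1_tilt F k : isH1 F -> isH1 (fun t => (k t)%:C%C * F t) ->
  isH1 (fun t => (1 + k t)%:C%C * F t).
Proof.
move=> HF HkF; have := H1D HF HkF.
by under eq_fun do rewrite -{1}[F _]mul1r -mulrDl -realC1 -realCD.
Qed.

(** Equality in the triangle inequality makes g and h nonnegative multiples of their sum. If the sum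
    is zero both vanish, and division by zero gives k = 0. *)
Lemma aligned_midpoint (g h : C) : cabs g + cabs h = cabs (g + h) ->
  let k := (cabs g - cabs h) / cabs (g + h) in
  [/\ `|k| <= 1, g = (1 + k)%:C%C * ((g + h) / 2) & h = (1 - k)%:C%C * ((g + h) / 2)].
Proof.
move=> e k; have g0 := cabs_ge0 g; have h0 := cabs_ge0 h.
have [s0|s0] := eqVneq (cabs (g + h)) 0.
  have gz : g = 0 by apply/eqP; rewrite -cabs_eq0; apply/eqP; lra.
  have hz : h = 0 by apply/eqP; rewrite -cabs_eq0; apply/eqP; lra.
  by rewrite /k gz hz addr0 subrr !mul0r normr0 !mulr0.
have sp : 0 < cabs (g + h) by rewrite lt_def s0 cabs_ge0.
(* The squared modulus of g |h| - h |g| is 2 |g| |h| (|g| |h| - Re (g conj(h))), which is zero in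
   the case of equality. *)
have al : g * (cabs h)%:C%C = h * (cabs g)%:C%C.
  apply/eqP; rewrite -subr_eq0 -cabs_eq0 -sqrf_eq0; apply/eqP.
  rewrite cabs_sqrD cabsN !cabsM !cabs_real !ger0_norm//.
  have := cabs_sqrD g h; rewrite -e sqrrD => h1.
  have -> : complex.Re (g * (cabs h)%:C%C * (- (h * (cabs g)%:C%C))^*%C) =
      - (cabs g * cabs h * complex.Re (g * h^*%C)).
    by case: (g) (h) => a b [c d]; rewrite /=; ring.
  have : complex.Re (g * h^*%C) = cabs g * cabs h by move: h1; rewrite mulr2n; lra.
  by move=> ->; ring.
have sC : (cabs (g + h))%:C%C != 0 :> C by rewrite -cabs_gt0 cabs_real gtr0_norm.
have c2 : (2 : C) != 0 by rewrite pnatr_eq0.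
have kC : (k%:C%C : C) = ((cabs g)%:C%C - (cabs h)%:C%C) / (cabs (g + h))%:C%C.
  by rewrite /k realCM realCB -fmorphV.
have eC : (cabs (g + h))%:C%C = (cabs g)%:C%C + (cabs h)%:C%C :> C by rewrite -realCD e.
split.
- rewrite /k normrM normfV [`|cabs (g + h)|]gtr0_norm// ler_pdivrMr// mul1r -e.
  by rewrite ler_norml; lra.
- rewrite realCD realC1 kC; apply: (mulIf (mulf_neq0 sC c2)).
  transitivity (((cabs (g + h))%:C%C + ((cabs g)%:C%C - (cabs h)%:C%C)) * (g + h)).
    rewrite eC; transitivity (2 * (g * (cabs g)%:C%C + g * (cabs h)%:C%C)); first by ring.
    by rewrite al; ring.
  by field.
- rewrite realCB realC1 kC; apply: (mulIf (mulf_neq0 sC c2)).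
  transitivity (((cabs (g + h))%:C%C - ((cabs g)%:C%C - (cabs h)%:C%C)) * (g + h)).
    rewrite eC; transitivity (2 * (h * (cabs g)%:C%C + h * (cabs h)%:C%C)); first by ring.
    by rewrite -al; ring.
  by field.
Qed.

(** The defect |g| + |h| - |g + h| is nonnegative with integral at most 1 + 1 - 2, so it vanishes
    almost everywhere and [aligned_midpoint] applies pointwise. *)
Lemma extremal_midpoint g h : isL1 g -> isL1 h -> L1norm g <= 1 -> L1norm h <= 1 ->
  1 <= L1norm (fun t => (g t + h t) / 2) ->
  exists k, [/\ mI k, aeI (fun t => `|k t| <= 1),
    aeI (fun t => g t = (1 + k t)%:C%C * ((g t + h t) / 2)) &
    aeI (fun t => h t = (1 - k t)%:C%C * ((g t + h t) / 2))].
Proof.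
move=> Lg Lh g1 h1 s1; have Ls := L1D Lg Lh.
have mg := L1_cmeas Lg; have mh := L1_cmeas Lh; have ms := L1_cmeas Ls.
have s2 : L1norm (fun t => (g t + h t) / 2) = 2^-1 * L1norm (fun t => g t + h t).
  rewrite -cabs_half -L1normZ//; congr L1norm.
  by apply/funext => t; rewrite mulrC.
have id : intg (fun t => cabs (g t) + cabs (h t) - cabs (g t + h t)).
  by apply: intgB (L1_intg Ls); apply: intgD; exact: L1_intg.
have d0 t : 0 <= cabs (g t) + cabs (h t) - cabs (g t + h t).
  by rewrite subr_ge0 cabsD.
have I0 : RI (fun t => cabs (g t) + cabs (h t) - cabs (g t + h t)) = 0.
  apply/le_anti; rewrite RI_ge0 ?andbT => [|t _]; last exact: d0.
  rewrite RIB; [|by apply: intgD; exact: L1_intg|exact: L1_intg].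
  rewrite RID; [|exact: L1_intg..]; rewrite -!L1normE; lra.
have al : aeI (fun t => cabs (g t) + cabs (h t) = cabs (g t + h t)).
  apply: aeIS (RI_eq0 id (fun t _ => d0 t) I0) _ => t _ /eqP.
  by rewrite subr_eq0 => /eqP.
exists (fun t => (cabs (g t) - cabs (h t)) / cabs (g t + h t)); split.
- apply: mI_M (mI_B (mI_cabs mg) (mI_cabs mh)) _.
  exact: (@mI_inv _ (fun t => cabs (g t + h t)) (fun t => cabs_ge0 _) (mI_cabs ms)).
- by apply: aeIS al _ => t _ /aligned_midpoint[].
- by apply: aeIS al _ => t _ /aligned_midpoint[].
- by apply: aeIS al _ => t _ /aligned_midpoint[].
Qed.

End Perturbation.

(** * Cosets, their minimizers and extremality *)

Section Quotient.
Variable R : realType.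
Local Notation C := R[i].
Variables (th : R -> C) (Phi : set (R -> C)).
Hypothesis Ith : inner th.
Hypothesis ctPhi : forall phi, Phi phi -> isCT phi.
Implicit Types (f g h F : R -> C) (k : R -> R).

Lemma L1_isCTM (phi f : R -> C) : isCT phi -> isL1 f -> isL1 (fun t => f t * phi t).
Proof.
move=> ct Lf; have [T tT hT] := fejer ct ltr01.
have md := cmeasB (cmeas_isCT ct) (L1_cmeas (L1_trig tT)).
have LT : isL1 (fun t => T t * f t).
  have [s ->] := tT; under eq_fun do rewrite mulr_suml.
  by apply: L1_sum => p; exact: L1_ZEM.
have := L1D (L1M_bound Lf md hT) LT.
by under eq_fun do rewrite -mulrDl subrK mulrC.
Qed.

Lemma H1Phi_lin (a b : C) g h : H1Phi Phi g -> H1Phi Phi h ->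
  H1Phi Phi (fun t => a * g t + b * h t).
Proof.
move=> [Hg g0] [Hh h0]; split; first by apply: H1D; exact: H1Z.
move=> phi Pphi; have ct := ctPhi Pphi.
have Lg := L1_isCTM ct (H1_L1 Hg); have Lh := L1_isCTM ct (H1_L1 Hh).
transitivity (cint (fun t => a * (g t * phi t) + b * (h t * phi t))).
  by apply: cint_eq => t _; ring.
rewrite cintD; [|exact: L1Z..].
by rewrite !cintZ// g0// h0// !mulr0 addr0.
Qed.

Lemma inE_lin (a b : C) g h : Defs.inE th Phi g -> Defs.inE th Phi h ->
  Defs.inE th Phi (fun t => a * g t + b * h t).
Proof.
move=> [g1 [Eg gg1]] [h1 [Eh hh1]]; exists (fun t => a * g1 t + b * h1 t).
split; first exact: H1Phi_lin.
by apply: aeIS2 gg1 hh1 _ => t _ -> ->; ring.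
Qed.

Lemma inE_ae g h : Defs.inE th Phi g -> aeI (fun t => h t = g t) -> Defs.inE th Phi h.
Proof.
move=> [g1 [Eg gg1]] hg; exists g1; split=> //.
by apply: aeIS2 gg1 hg _ => t _ <-.
Qed.

Lemma qnorm_le_coset f F : cmeas f -> cmeas F -> Defs.inE th Phi (fun t => F t - f t) ->
  qnorm th Phi f <= L1norm F.
Proof.
move=> mf mF [g [Eg Fg]]; apply: le_trans (qnorm_le th f Eg) _.
rewrite le_eqVlt; apply/orP; left; apply/eqP; apply: L1norm_ae => //.
  have [Hg _] := Eg.
  exact: cmeasD mf (cmeasM (inner_cmeas Ith) (L1_cmeas (H1_L1 Hg))).
by apply: aeIS Fg _ => t _ <-; rewrite subrKC.
Qed.

Lemma minimizer_coset f : isH1 f -> exists2 F, Mset th Phi f F & isH1 F.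
Proof.
move=> Hf; have [g Eg qg] := minimizer_exists Ith ctPhi Hf.
have HF : isH1 (fun t => f t + th t * g t).
  by apply: H1D => //; apply: HinfM_H1; [exact: Ith.1|exact: Eg.1].
exists (fun t => f t + th t * g t) => //; split=> //.
by exists g; split=> //; apply: aeI_all => t _; rewrite addrAC subrr add0r.
Qed.

(** A nonconstant inner function has mean of modulus less than 1. For constant th, the function 1 in
    Phi forces elements of [H1Phi] to have mean zero, so ζ divides them. *)
Lemma inE_inner_factor : (is_const th -> Phi (fun=> 1)) ->
  exists w, [/\ inner w, cabs (fhat w 0) < 1 &
    forall h, Defs.inE th Phi h -> exists2 g, isH1 g & aeI (fun t => h t = w t * g t)].
Proof.
move=> cPhi; have [cth|ncth] := pselect (is_const th); last first.
  exists th; split=> //; first exact: inner_nonconst.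
  by move=> h [g [[Hg _] hg]]; exists g.
exists (E 1); split; first exact: innerE.
  by rewrite fhat_E cabs0.
move=> h [g [[Hg Phig] hg]]; have [c thc] := cth.
have g0 : fhat g 0 = 0.
  rewrite -(Phig _ (cPhi cth)) fhatE.
  by apply: cint_eq => t _; rewrite oppr0 E0 mul1r mulr1.
exists (fun t => c * (E (-1) t * g t)); first exact/H1Z/H1_shift.
apply: aeIS2 hg thc _ => t _ -> ->.
by rewrite mulrCA [E 1 t * _]mulrA [E 1 t * _]mulrC EK mul1r.
Qed.

Section ExtremeCoset.
Variable f : R -> C.
Hypothesis Hf : isH1 f.
Hypothesis qf : qnorm th Phi f = 1.

Lemma Mset_norm F : Mset th Phi f F -> L1norm F = 1.
Proof. by case=> _ _ ->. Qed.

Lemma Mset_midpoint F G : Mset th Phi f F -> Mset th Phi f G ->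
  Mset th Phi f (fun t => (F t + G t) / 2).
Proof.
move=> MF MG; have [HF EF _] := MF; have [HG EG _] := MG.
have c2 : (2 : C) != 0 by rewrite pnatr_eq0.
have HS : isH1 (fun t => (F t + G t) / 2).
  by have := H1Z 2^-1 (H1D HF HG); under eq_fun do rewrite mulrC.
have ES : Defs.inE th Phi (fun t => (F t + G t) / 2 - f t).
  apply: inE_ae (inE_lin 2^-1 2^-1 EF EG) _.
  by apply: aeI_all => t _; field.
split=> //; apply/le_anti/andP; split; last first.
  by apply: qnorm_le_coset ES; exact/L1_cmeas/H1_L1.
rewrite qf; have := L1normD (L1Z 2^-1 (H1_L1 HF)) (L1Z 2^-1 (H1_L1 HG)).
rewrite !L1normZ ?cabs_half ?(Mset_norm MF) ?(Mset_norm MG); [|exact: H1_L1..].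
have -> : (fun t => (F t + G t) / 2) = fun t => 2^-1 * F t + 2^-1 * G t.
  by apply/funext => t; rewrite mulrC mulrDr.
lra.
Qed.

(** Passing to minimizers of both cosets turns quotient norms into L^1 norms; their midpoint is a
    minimizer of f + E, hence F. Once rigidity makes k a constant c, the norms |1 + c| and |1 - c|
    are both at most 1 only for c = 0. *)
Lemma outer_unique_extreme F : outer F -> Mset th Phi f F ->
  (forall xi, Mset th Phi f xi -> aeI (fun t => xi t = F t)) -> extremeQ th Phi f.
Proof.
move=> oF MF uF; split; first by rewrite qf.
move=> g h Hg Hh qg qh Efgh.
have [g' [Hg' Eg' ng'] _] := minimizer_coset Hg.
have [h' [Hh' Eh' nh'] _] := minimizer_coset Hh.
have c2 : (2 : C) != 0 by rewrite pnatr_eq0.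
pose s t := (g' t + h' t) / 2.
have Hs : isH1 s by have := H1Z 2^-1 (H1D Hg' Hh'); under eq_fun do rewrite mulrC.
have Lg' := H1_L1 Hg'; have Lh' := H1_L1 Hh'.
have Es : Defs.inE th Phi (fun t => s t - f t).
  apply: inE_ae (inE_lin 1 (-1) (inE_lin 2^-1 2^-1 Eg' Eh') Efgh) _.
  by apply: aeI_all => t _; rewrite /s; field.
have s1 : 1 <= L1norm s.
  by rewrite -qf; apply: qnorm_le_coset Es; exact/L1_cmeas/H1_L1.
rewrite -ng' in qg; rewrite -nh' in qh.
have [k [mk k1 gk hk]] := extremal_midpoint Lg' Lh' qg qh s1.
have half t : cabs (s t) <= 2^-1 * (cabs (g' t) + cabs (h' t)).
  rewrite /s mulrC cabsM cabs_half//.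
  by rewrite ler_pM2l ?invr_gt0//; exact: cabsD.
have sle : L1norm s <= 1.
  apply: (@le_trans _ _ (2^-1 * (L1norm g' + L1norm h'))); last by lra.
  rewrite !L1normE -RID; [|exact: L1_intg..].
  have iS : intg (fun t => cabs (g' t) + cabs (h' t)) by apply: intgD; exact: L1_intg.
  by rewrite -RIZ//; apply: RI_le => //; [exact/L1_intg/H1_L1|exact: intgZ].
have sF : aeI (fun t => s t = F t).
  by apply: uF; split=> //; apply/le_anti; rewrite qf sle s1.
have [HF _ _] := MF; have mF := L1_cmeas (H1_L1 HF).
have HkF : isH1 (fun t => (k t)%:C%C * F t).
  apply: H1_ae (H1B Hg' Hs) _ _; first exact: cmeasM (cmeas_real mk) mF.
  apply: aeIS2 gk sF _ => t _ e e'.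
  by rewrite -e' {1}e -/(s t) realCD realC1; ring.
have [c kc] := outer_rigid oF mk k1 HkF.
have F1 := Mset_norm MF.
have ng : L1norm g' = `|1 + c|.
  rewrite (L1norm_ae (g := fun t => (1 + c)%:C%C * F t)).
  - by rewrite L1normZ ?F1 ?mulr1 ?cabs_real//; exact: H1_L1.
  - exact: L1_cmeas.
  - exact: cmeasM (cmeas_cst _) mF.
  - by apply: aeIS3 gk sF kc _ => t _ -> <- ->.
have nh : L1norm h' = `|1 - c|.
  rewrite (L1norm_ae (g := fun t => (1 - c)%:C%C * F t)).
  - by rewrite L1normZ ?F1 ?mulr1 ?cabs_real//; exact: H1_L1.
  - exact: L1_cmeas.
  - exact: cmeasM (cmeas_cst _) mF.
  - by apply: aeIS3 hk sF kc _ => t _ -> <- ->.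
have c0 : c = 0.
  move: qg qh; rewrite ng nh !ler_norml => /andP[_ a1] /andP[_ a2].
  by apply/le_anti; apply/andP; split; lra.
have gh : aeI (fun t => g' t = h' t).
  apply: aeIS3 gk hk kc _ => t _ e1 e2 kt.
  by rewrite e1 [RHS]e2 kt c0 addr0 subr0.
apply: inE_ae (inE_lin 1 (-1) Eh' Eg') _.
by apply: aeIS gh _ => t _ ->; ring.
Qed.

Hypothesis cPhi : is_const th -> Phi (fun=> 1).
Hypothesis ext : extremeQ th Phi f.

(** F (1 + k / M) and F (1 - k / M) average to F, and both have norm 1 because k has zero integral
    against |F|. Extremality puts their difference in E, so the tilted function stays in the
    coset. *)
Lemma extreme_tilt F k (M : R) : Mset th Phi f F -> mI k -> 0 < M ->
  aeI (fun t => `|k t| <= M) -> isH1 (fun t => (k t)%:C%C * F t) ->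
  RI (fun t => cabs (F t) * k t) = 0 ->
  Defs.inE th Phi (fun t => (k t)%:C%C * F t) /\
  Mset th Phi f (fun t => (1 + M^-1 * k t)%:C%C * F t).
Proof.
move=> MF mk M0 kM HkF k0; have [HF EF _] := MF; have LF := H1_L1 HF.
have F1 := Mset_norm MF; have mF := L1_cmeas LF.
have ik := intg_cabsM LF mk kM.
have tilt (s : R) : `|s| <= 1 -> isH1 (fun t => (1 + s * M^-1 * k t)%:C%C * F t) /\
    L1norm (fun t => (1 + s * M^-1 * k t)%:C%C * F t) = 1.
  move=> s1; split.
    apply: H1_tilt => //; have := H1Z (s * M^-1)%:C%C HkF.
    by under eq_fun do rewrite mulrA -realCM.
  rewrite -[RHS]F1; apply: L1norm_tilt => //; first exact: mI_M (mI_cst _) mk.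
    apply: aeIS kM _ => t _ h; rewrite !normrM normfV [`|M|]gtr0_norm//.
    have : M^-1 * `|k t| <= 1 by rewrite mulrC ler_pdivrMr// mul1r.
    have := normr_ge0 s; have : 0 <= M^-1 * `|k t| by rewrite mulr_ge0// invr_ge0 ltW.
    by rewrite -mulrA; nra.
  transitivity (RI (fun t => s * M^-1 * (cabs (F t) * k t))).
    by apply: RI_eq => t _; rewrite mulrCA.
  by rewrite RIZ// k0 mulr0.
have [|H1 n1] := tilt 1; first by rewrite normr1.
have [|H2 n2] := tilt (-1); first by rewrite normrN normr1.
have c2 : (2 : C) != 0 by rewrite pnatr_eq0.
have MC0 : M%:C%C != 0 :> C by rewrite -cabs_gt0 cabs_real gtr0_norm.
have Ed : Defs.inE th Phi (fun t => (1 + 1 * M^-1 * k t)%:C%C * F t -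
    (1 + -1 * M^-1 * k t)%:C%C * F t).
  apply: ext.2 => //.
  - by rewrite -[leRHS]n1; exact: qnorm_le_L1norm.
  - by rewrite -[leRHS]n2; exact: qnorm_le_L1norm.
  - apply: inE_ae (inE_lin (-1) 0 EF EF) _; apply: aeI_all => t _.
    by rewrite !(realCD, realCM, realC1, realCN1); field.
have Ek : Defs.inE th Phi (fun t => (k t)%:C%C * F t).
  apply: inE_ae (inE_lin (M%:C%C / 2) 0 Ed Ed) _; apply: aeI_all => t _.
  rewrite !(realCD, realCM, realC1, realCN1) [(M^-1)%:C%C]fmorphV.
  by field.
split=> //; move: H1 n1; under eq_fun do rewrite mul1r.
move=> H1 n1; split=> //; last by rewrite qf.
apply: inE_ae (inE_lin 1 (M^-1)%:C%C EF Ek) _; apply: aeI_all => t _.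
by rewrite !(realCD, realCM, realC1); ring.
Qed.

(* Let [h F] be half the difference of two minimizers, and [w] an inner function
   dividing [E].  If [h F = w^(n+1) g], tilting the midpoint [F] by
   [h Re (l w^(n+1))], with [l] chosen to preserve the norm, shows that
   [g (l^* + l w^(2n+2)) / 2] lies in [E], hence that [w] divides [g] again. *)
Lemma extreme_unique F1 F2 : Mset th Phi f F1 -> Mset th Phi f F2 ->
  aeI (fun t => F1 t = F2 t).
Proof.
move=> M1 M2; pose F t := (F1 t + F2 t) / 2.
have MF : Mset th Phi f F by exact: Mset_midpoint.
have [HF EF _] := MF; have LF := H1_L1 HF; have mF := L1_cmeas LF.
have [HF1 EF1 _] := M1; have [HF2 EF2 _] := M2.
have c2 : (2 : C) != 0 by rewrite pnatr_eq0.
have [h [mh h1 Fh1 Fh2]] : exists k, [/\ mI k, aeI (fun t => `|k t| <= 1),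
    aeI (fun t => F1 t = (1 + k t)%:C%C * F t) &
    aeI (fun t => F2 t = (1 - k t)%:C%C * F t)].
  by apply: extremal_midpoint; rewrite ?Mset_norm//; exact: H1_L1.
have [w [Iw w0 Ew]] := inE_inner_factor cPhi.
have mhF : cmeas (fun t => (h t)%:C%C * F t) by exact: cmeasM (cmeas_real mh) mF.
have EhF : Defs.inE th Phi (fun t => (h t)%:C%C * F t).
  apply: inE_ae (inE_lin 2^-1 (- 2^-1) EF1 EF2) _.
  apply: aeIS2 Fh1 Fh2 _ => t _ -> ->.
  by rewrite realCD realCB realC1; field.
have LhF : isL1 (fun t => (h t)%:C%C * F t).
  apply: (L1M_bound_ae LF (cmeas_real mh)); apply: aeIS h1 _ => t _.
  by rewrite cabs_real; exact: id.
pose S g := isH1 g /\ exists n, aeI (fun t => (h t)%:C%C * F t = w t ^+ n.+1 * g t).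
have SB g : S g -> isH1 g /\ L1norm g <= L1norm (fun t => (h t)%:C%C * F t).
  move=> [Hg [n hg]]; split=> //; have [Hwn wn1] := innerX n.+1 Iw.
  have mg := L1_cmeas (H1_L1 Hg); have mwn := inner_cmeas (innerX n.+1 Iw).
  by rewrite (L1norm_ae mhF (cmeasM mwn mg) hg) L1normM_unimodular.
have Sw g : S g -> exists2 g', S g' & aeI (fun t => g t = w t * g' t).
  move=> [Hg [n hg]]; have Iu := innerX n.+1 Iw; set u := fun t => w t ^+ n.+1.
  have mu : cmeas u := inner_cmeas Iu.
  have Lu : isL1 (fun t => (cabs (F t) * h t)%:C%C * u t).
    apply: L1_le_ae (L1_intg LF) _.
      exact: cmeasM (cmeas_real (mI_M (mI_cabs mF) mh)) mu.
    apply: aeIS2 h1 Iu.2 _ => t _ ht ut.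
    rewrite cabsM cabs_real ut mulr1 normrM ger0_norm ?cabs_ge0//.
    by rewrite ler_piMr ?cabs_ge0.
  (* The choice l = i conj(I) makes l I purely imaginary, so that k below has zero integral against
     |F|; for I = 0 the value 1 will do. *)
  have [l l0 hl] : exists2 l : C, l != 0 &
      complex.Re (l * cint (fun t => (cabs (F t) * h t)%:C%C * u t)) = 0.
    set I := cint _; have [->|I0] := eqVneq I 0.
      by exists 1; rewrite ?oner_eq0// mulr0.
    exists (Complex 0 1 * I^*%C).
      rewrite mulf_neq0 ?conjc_eq0//; apply/eqP => /(congr1 (@complex.Im R)) /=.
      by move/eqP; rewrite oner_eq0.
    by case: (I) => x y /=; ring.
  pose k t := h t * complex.Re (l * u t).
  have mlu : cmeas (fun t => l * u t) := cmeasM (cmeas_cst l) mu.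
  have mk : mI k by exact: mI_M mh mlu.1.
  have kl : aeI (fun t => `|k t| <= cabs l).
    apply: aeIS2 h1 Iu.2 _ => t _ ht ut; rewrite normrM -[leRHS]mul1r.
    apply: ler_pM => //; apply: le_trans (normRe_le _) _.
    by rewrite cabsM ut mulr1.
  (* Since |u| = 1, the conjugate of u in Re (l u) cancels the factor u of h F; this is where
     divisibility of h F by u is used. *)
  pose q t := 2^-1 * (l * (u t * (u t * g t)) + l^*%C * g t).
  have Hq : isH1 q.
    apply/H1Z/H1D/H1Z => //; apply: H1Z.
    by apply: HinfM_H1; [exact: Iu.1|apply: HinfM_H1; [exact: Iu.1|]].
  have kF : aeI (fun t => (k t)%:C%C * F t = q t).
    apply: aeIS2 hg Iu.2 _ => t _ e ut.
    have uu : u t * (u t)^*%C = 1 by rewrite mulcC ut expr1n.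
    have Re2 : ((complex.Re (l * u t))%:C%C : C) = 2^-1 * (l * u t + l^*%C * (u t)^*%C).
      rewrite -conjM; set v := l * u t.
      apply: (mulfI c2); rewrite mulrA mulfV// mul1r.
      by case: (v) => x y; apply: complex_ext => /=; ring.
    rewrite /k realCM mulrAC e Re2 /q -/(u t).
    transitivity (2^-1 * (l * (u t * (u t * g t)) + l^*%C * (u t * (u t)^*%C) * g t)).
      by ring.
    by rewrite uu mulr1.
  have HkF : isH1 (fun t => (k t)%:C%C * F t).
    exact: H1_ae Hq (cmeasM (cmeas_real mk) mF) kF.
  have k0 : RI (fun t => cabs (F t) * k t) = 0.
    rewrite -hl -cintZ// cintE /=; apply: RI_eq => t _.
    rewrite /k; move: (u t) (cabs (F t)) => [x y] r; case: (l) => a b /=; ring.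
  have lp : 0 < cabs l by rewrite cabs_gt0.
  have [EkF _] := extreme_tilt MF mk lp kl HkF k0.
  have [g1 Hg1 kg1] := Ew _ EkF.
  have lJ0 : l^*%C != 0 by rewrite conjc_eq0.
  (* Obtained by solving w g1 = q for g: the term l u^2 g already contains the factor w, as u =
     w^(n+1). *)
  pose g' t := (l^*%C)^-1 * (2 * g1 t - l * (w t ^+ n * (u t * g t))).
  have Hg' : isH1 g'.
    apply/H1Z/H1B; apply: H1Z => //.
    apply: HinfM_H1; first exact: (innerX n Iw).1.
    by apply: HinfM_H1 => //; exact: Iu.1.
  have gg' : aeI (fun t => g t = w t * g' t).
    apply: aeIS2 kF kg1 _ => t _ e1 e2.
    apply: (mulfI lJ0).
    transitivity (2 * (w t * g1 t) - l * (u t * (u t * g t))).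
      by rewrite -e2 e1 /q; field.
    by rewrite /g' {1}/u exprS; field; rewrite lJ0.
  exists g' => //; split=> //; exists n.+1.
  by apply: aeIS2 hg gg' _ => t _ -> {1}->; rewrite mulrA -exprSr.
have [g Hg hg] := Ew _ EhF.
have Sg : S g by split=> //; exists 0.
have g0 := inner_divisible_eq0 Iw w0 SB Sw Sg.
have hF0 : aeI (fun t => (h t)%:C%C * F t = 0).
  by apply: aeIS2 hg g0 _ => t _ -> ->; rewrite mulr0.
apply: aeIS3 Fh1 Fh2 hF0 _ => t _ -> -> e.
by rewrite realCD realCB !mulrDl mulNr e oppr0.
Qed.

(** Subtracting the |F|-weighted mean c of k makes the tilt norm-preserving, so F (1 + (k - c) / N)
    is again a minimizer. Uniqueness, together with F nonzero almost everywhere, leaves k = c. *)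
Lemma extreme_rigid F : Mset th Phi f F -> rigid F.
Proof.
move=> MF k M mk kM HkF; have [HF EF _] := MF; have LF := H1_L1 HF.
have mF := L1_cmeas LF; have F1 := Mset_norm MF.
pose c := RI (fun t => cabs (F t) * k t).
exists c; pose k' t := k t - c; pose N := `|M| + `|c| + 1.
have N0 : 0 < N by rewrite ltr_wpDl// addr_ge0.
have mk' : mI k' by exact: mI_B mk (mI_cst _).
have k'N : aeI (fun t => `|k' t| <= N).
  apply: aeIS kM _ => t _ h; apply: le_trans (ler_normB _ _) _.
  by rewrite /N; have := ler_norm M; lra.
have ik := intg_cabsM LF mk kM.
have HkF' : isH1 (fun t => (k' t)%:C%C * F t).
  have := H1B HkF (H1Z c%:C%C HF).
  by under eq_fun do rewrite -mulrBl -realCB.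
have k0 : RI (fun t => cabs (F t) * k' t) = 0.
  transitivity (RI (fun t => cabs (F t) * k t - c * cabs (F t))).
    by apply: RI_eq => t _; rewrite /k'; ring.
  rewrite RIB//; last exact/intgZ/L1_intg.
  by rewrite (RIZ c (L1_intg LF)) -L1normE F1 mulr1 subrr.
have [_ MF'] := extreme_tilt MF mk' N0 k'N HkF' k0.
have Fnz : aeI (fun t => F t != 0).
  apply: H1_neq0 => // z; move: F1; rewrite (L1norm_ae mF (cmeas_cst 0) z).
  by rewrite L1normE; under RI_eq do rewrite cabs0; rewrite RI_cst => /eqP; rewrite eq_sym oner_eq0.
apply: aeIS2 (extreme_unique MF' MF) Fnz _ => t _ e Ft.
have : (N^-1 * k' t)%:C%C * F t = 0.
  by move: e; rewrite realCD mulrDl mul1r -[RHS]addr0 => /addrI.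
move/eqP; rewrite mulf_eq0 (negbTE Ft) orbF -cabs_eq0 cabs_real normr_eq0.
by rewrite mulf_eq0 invr_eq0 gt_eqF//= subr_eq0 => /eqP.
Qed.

End ExtremeCoset.
End Quotient.

Theorem theorem1p1 (R : realType) (th : R -> R[i]) (Phi : set (R -> R[i]))
    (f : R -> R[i]) :
  inner th ->
  (forall phi, Phi phi -> isCT phi) ->
  (is_const th -> Phi (fun _ => 1)) ->
  isH1 f ->
  qnorm th Phi f = 1 ->
  (extremeQ th Phi f <->
   exists F : R -> R[i],
     [/\ outer F, Mset th Phi f F &
         forall xi, Mset th Phi f xi -> aeI (fun t => xi t = F t)]).
Proof.
move=> Ith ctPhi cPhi Hf qf; split=> [ext|[F [oF MF uF]]].
  have [F MF HF] := minimizer_coset Ith ctPhi Hf; exists F; split=> //.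
    exact: rigid_outer HF (extreme_rigid Ith ctPhi Hf qf cPhi ext MF).
  by move=> xi Mxi; exact (extreme_unique Ith ctPhi Hf qf cPhi ext Mxi MF).
exact (outer_unique_extreme Ith ctPhi Hf qf oF MF uF).
Qed.
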